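(* Let $f\colon M^2\to\mathbb{R}^N$ be a surface with flat normal bundle free of umbilical points. Let $\mathcal{E}=(E_0,E_1)$ be the orthogonal net on $M^2$ determined by its curvature lines. Assume that those corresponding to $E_0$ are geodesics. Then there exist locally a product representation $\psi\colon I\times J\to M^2$ of $\mathcal{E}$, where $I,J\subset\mathbb{R}$ are open intervals, a smooth curve $\beta\colon J\to\mathbb{R}^N$, a parallel vector bundle isometry $\phi\colon J\times\mathbb{R}^s\to E$ onto a flat parallel subbundle $E$ of $N_\beta J$ and a smooth curve $\alpha\colon I\to\Omega(\beta;\phi)\subset\mathbb{R}^s$ such that $f\circ\psi$ is the partial tube determined by $(\alpha,\beta,\phi)$, i.e. $f(\psi(u,v))=\beta(v)+\phi_v(\alpha(u))$.
   Context: $M^2$ carries the metric induced by the immersion $f$. A point is umbilical if the second fundamental form there is $\langle\cdot,\cdot\rangle$ times a fixed normal vector. Since the normal bundle is flat and there are no umbilical points, there are, at every point, exactly two (orthogonal) tangent directions diagonalizing simultaneously all shape operators; their integral curves are the curvature lines, and $E_0,E_1$ are the corresponding line subbundles (labelled so that the curvature lines tangent to $E_0$ are geodesics). ''Locally'' means in a neighbourhood of each point. A (local) product representation $\psi\colon I\times J\to M^2$ of $\mathcal{E}$ is a diffeomorphism onto an open subset mapping the tangent spaces of the factors $I$ and $J$ onto $E_0$ and $E_1$, respectively. For a regular (immersed) curve $\beta\colon J\to\mathbb{R}^N$, $N_\beta J$ is the normal bundle with its normal connection and $A^\beta_\xi$ its shape operators, $\langle A^\beta_\xi X,Y\rangle=\langle\alpha_\beta(X,Y),\xi\rangle$,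 where $\alpha_\beta$ is the second fundamental form of $\beta$. A parallel vector bundle isometry $\phi\colon J\times\mathbb{R}^s\to E\subset N_\beta J$ is a smooth bundle map such that each $\phi_v=\phi(v,\cdot)\colon\mathbb{R}^s\to E(v)$ is a linear isometry and $v\mapsto\phi_v(y)$ is parallel in the normal connection for each fixed $y$. $\Omega(\beta;\phi)=\{Y\in\mathbb{R}^s:\ I-A^\beta_{\phi_v(Y)}\text{ is nonsingular for every }v\in J\}$. In the definition of partial tube the curves $\alpha$ and $\beta$ are immersions (regular), and the partial tube determined by $(\alpha,\beta,\phi)$ is the immersion $(u,v)\mapsto\beta(v)+\phi_v(\alpha(u))$. *)

(* Defs.v *)
From HB Require Import structures.
From mathcomp Require Import all_boot all_order all_algebra.
From mathcomp Require Import all_classical all_reals all_analysis.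

Set Implicit Arguments.
Unset Strict Implicit.
Unset Printing Implicit Defensive.
Import Order.TTheory GRing.Theory Num.Theory.
Import numFieldNormedType.Exports.
Local Open Scope classical_set_scope.
Local Open Scope ring_scope.

(* All uses are on open sets of finite-dimensional spaces, where
   "f is differentiable and every x |-> df_x(v) is C^k" is C^(k+1). *)
Fixpoint Ck (R : realType) (V W : normedModType R) (k : nat) (U : set V)
    (f : V -> W) : Prop :=
  if k is k'.+1 then
    (forall x, U x -> differentiable f x) /\ (forall v, Ck k' U ('D_v f))
  else forall x, U x -> {for x, continuous f}.

Definition smooth_on (R : realType) (V W : normedModType R) (U : set V)
    (f : V -> W) : Prop := forall k, Ck k U f.

Definition dotp (R : realType) (N : nat) (x y : 'rV[R]_N) : R :=
  (x *m y^T) 0 0.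

(* Geometry of an immersion g of an open subset of V into R^N.  V is 'rV_2
   (surfaces, in a chart) or R (curves), and e : 'I_n -> V is the standard basis
   of V; tangent vectors of the domain are elements of V.  Constant vector
   fields commute, so no Lie bracket appears below. *)
Section Immersion.
Variables (R : realType) (V : normedModType R) (n : nat) (e : 'I_n -> V).
Variable N : nat.
Implicit Types (U : set V) (g : V -> 'rV[R]_N) (x X Y Z : V).

(* i-th row = g_*(e_i), so that the row space is the tangent space. *)
Definition tangent_mx g x : 'M[R]_(n, N) := \matrix_(i < n) 'D_(e i) g x.

Definition immersion_on U g : Prop :=
  smooth_on U g /\ forall x, U x -> row_free (tangent_mx g x).

Definition metric g x X Y : R := dotp ('D_X g x) ('D_Y g x).

Definition normal_space g x : set 'rV[R]_N :=
  [set xi | forall X, dotp xi ('D_X g x) = 0].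

(* Projection onto the orthogonal complement of the tangent space, along the
   tangent space; it acts on the right of row vectors. *)
Definition normal_proj g x : 'M[R]_N :=
  proj_mx (kermx (tangent_mx g x)^T) <<tangent_mx g x>>%MS.

Definition second_ff g x X Y : 'rV[R]_N := 'D_X ('D_Y g) x *m normal_proj g x.

(* The matrix, in the basis e and acting on the right of coordinate row vectors,
   of the A such that  metric (A X) Y = <second_ff X Y, xi>. *)
Definition shape_op g x (xi : 'rV[R]_N) : 'M[R]_n :=
  (\matrix_(i, j) dotp (second_ff g x (e i) (e j)) xi)
  *m invmx (\matrix_(i, j) metric g x (e i) (e j)).

Definition umbilical g x : Prop :=
  exists2 eta, normal_space g x eta &
    forall X Y, second_ff g x X Y = metric g x X Y *: eta.

Definition normal_conn g X (xi : V -> 'rV[R]_N) x : 'rV[R]_N :=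
  'D_X xi x *m normal_proj g x.

Definition is_section U (E : V -> set 'rV[R]_N) (xi : V -> 'rV[R]_N) : Prop :=
  smooth_on U xi /\ forall x, U x -> E x (xi x).

(* Vanishing of the curvature tensor of the normal connection on sections of E,
   which is the full normal bundle or a parallel subbundle of it. *)
Definition flat_on U g (E : V -> set 'rV[R]_N) : Prop :=
  forall U' xi, open U' -> U' `<=` U -> is_section U' E xi ->
  forall x X Y, U' x ->
    normal_conn g X (normal_conn g Y xi) x
    = normal_conn g Y (normal_conn g X xi) x.

Definition smooth_subbundle U (s : nat) (E : V -> {vspace 'rV[R]_N}) : Prop :=
  forall x, U x -> exists U', [/\ open U', U' x, U' `<=` U &
    exists xi : 'I_s -> V -> 'rV[R]_N,
      (forall i, smooth_on U' (xi i)) /\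
      forall y, U' y -> basis_of (E y) [seq xi i y | i <- enum 'I_s]].

Definition flat_parallel_subbundle U g (s : nat)
    (E : V -> {vspace 'rV[R]_N}) : Prop :=
  let Eset := fun x => [set xi | xi \in E x] in
  [/\ smooth_subbundle U s E,
      forall x, U x -> Eset x `<=` normal_space g x,
      forall U' xi, open U' -> U' `<=` U -> is_section U' Eset xi ->
        forall x X, U' x -> normal_conn g X xi x \in E x
    & flat_on U g Eset].

(* <nabla_X Y, Z> for the Levi-Civita connection of the induced metric and
   constant fields X, Y, Z: Christoffel symbols of the first kind. *)
Definition christoffel1 g x X Y Z : R :=
  2^-1 * ('D_X (fun y => metric g y Y Z) x + 'D_Y (fun y => metric g y X Z) x
          - 'D_Z (fun y => metric g y X Y) x).

(* <nabla_{c'} c', Z> = 0 for all Z. *)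
Definition geodesic_at g (c : R -> V) (t : R) : Prop :=
  forall Z, metric g (c t) (derive1 (derive1 c) t) Z
    + christoffel1 g (c t) (derive1 c t) (derive1 c t) Z = 0.

End Immersion.

Record chart (R : realType) (M : topologicalType) (n : nat) := Chart {
  cdom : set M;
  cmap : M -> 'rV[R]_n;
  cinv : 'rV[R]_n -> M;
  cdom_open : open cdom;
  cimg_open : open (cmap @` cdom);
  cmap_cont : forall q, cdom q -> {for q, continuous cmap};
  cinv_cont : forall x, (cmap @` cdom) x -> {for x, continuous cinv};
  cmapK : forall q, cdom q -> cinv (cmap q) = q }.

(* An atlas comes with a preferred chart at each point; the preferred charts
   suffice to determine the smooth structure. *)
Record atlas (R : realType) (M : topologicalType) (n : nat) := Atlas {
  chart_at : M -> chart R M n;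
  mem_chart_at : forall p, cdom (chart_at p) p;
  chart_compat : forall p q,
    smooth_on (cmap (chart_at p) @` (cdom (chart_at p) `&` cdom (chart_at q)))
              (cmap (chart_at q) \o cinv (chart_at p)) }.

(* The tangent space at p is 'rV_n, by coordinates in the preferred chart at p. *)
Section Manifold.
Variables (R : realType) (M : topologicalType) (n : nat) (A : atlas R M n).

Definition cimg (p : M) : set 'rV[R]_n :=
  cmap (chart_at A p) @` cdom (chart_at A p).

Definition coord (p : M) : 'rV[R]_n := cmap (chart_at A p) p.

Definition local_expr (W : Type) (f : M -> W) (p : M) : 'rV[R]_n -> W :=
  f \o cinv (chart_at A p).

Definition smooth_from (W : normedModType R) (D : set M) (f : M -> W) : Prop :=
  forall p, smooth_on (cmap (chart_at A p) @` (cdom (chart_at A p) `&` D))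
                      (local_expr f p).

Definition smooth_into (V : normedModType R) (U : set V) (h : V -> M) : Prop :=
  forall x, U x -> exists U', [/\ open U', U' x, U' `<=` U,
    h @` U' `<=` cdom (chart_at A (h x)) &
    smooth_on U' (cmap (chart_at A (h x)) \o h)].

(* Differential at x of h : V -> M, with values in the tangent space at h x. *)
Definition mdiff (V : normedModType R) (h : V -> M) (x X : V) : 'rV[R]_n :=
  'D_X (cmap (chart_at A (h x)) \o h) x.

Definition diffeo_onto_open (V : normedModType R) (U : set V) (h : V -> M) : Prop :=
  [/\ open U, smooth_into U h, open (h @` U) &
      exists k : M -> V, (forall x, U x -> k (h x) = x) /\ smooth_from (h @` U) k].

(* Line subbundles of the tangent bundle: locally spanned by a smooth vector
   field X, written in the preferred chart at p. *)
Definition smooth_line_field (E : M -> {vspace 'rV[R]_n}) : Prop :=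
  (forall p, \dim (E p) = 1%N) /\
  forall p, exists U, exists X : 'rV[R]_n -> 'rV[R]_n,
    [/\ open U, U (coord p), U `<=` cimg p, smooth_on U X &
      forall x, U x ->
        let h := cinv (chart_at A p) in E (h x) = <[mdiff h x (X x)]>%VS].

End Manifold.

Definition basis2 (R : realType) (i : 'I_2) : 'rV[R]_2 := delta_mx 0 i.
Definition basis1 (R : realType) (i : 'I_1) : R := 1.

Section Surface.
Variables (R : realType) (M : topologicalType) (A : atlas R M 2) (N : nat).
Variable f : M -> 'rV[R]_N.
Local Notation e2 := (@basis2 R).

Definition surface_immersion : Prop :=
  forall p, immersion_on e2 (cimg A p) (local_expr A f p).

Definition flat_normal_bundle : Prop :=
  forall p, flat_on e2 (cimg A p) (local_expr A f p)
                    (normal_space (local_expr A f p)).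

Definition umbilic_free : Prop :=
  forall p, ~ umbilical e2 (local_expr A f p) (coord A p).

Definition principal_line (p : M) (L : {vspace 'rV[R]_2}) : Prop :=
  \dim L = 1%N /\
  forall xi, normal_space (local_expr A f p) (coord A p) xi ->
    exists lam : R, forall X, X \in L ->
      X *m shape_op e2 (local_expr A f p) (coord A p) xi = lam *: X.

Definition curvature_net (E0 E1 : M -> {vspace 'rV[R]_2}) : Prop :=
  [/\ smooth_line_field A E0, smooth_line_field A E1,
      forall p X Y, X \in E0 p -> Y \in E1 p ->
        metric (local_expr A f p) (coord A p) X Y = 0
    & forall p, principal_line p (E0 p) /\ principal_line p (E1 p)].

(* Integral curves of E, parametrized by arc length, on open intervals K. *)
Definition unit_speed_integral_curve (E : M -> {vspace 'rV[R]_2})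
    (K : set R) (c : R -> M) : Prop :=
  smooth_into A K c /\
  forall t, K t -> let X := mdiff A c t 1 in
    X \in E (c t) /\
    metric (local_expr A f (c t)) (coord A (c t)) X X = 1.

Definition geodesic_lines (E : M -> {vspace 'rV[R]_2}) : Prop :=
  forall (K : set R) (c : R -> M), open K -> is_interval K ->
    unit_speed_integral_curve E K c ->
    forall t, K t ->
      geodesic_at (local_expr A f (c t)) (cmap (chart_at A (c t)) \o c) t.

Definition product_representation (E0 E1 : M -> {vspace 'rV[R]_2})
    (I J : set R) (psi : R * R -> M) : Prop :=
  diffeo_onto_open A (I `*` J) psi /\
  forall x, (I `*` J) x ->
    [set mdiff A psi x (a, 0) | a in setT] = [set X | X \in E0 (psi x)] /\
    [set mdiff A psi x (0, b) | b in setT] = [set X | X \in E1 (psi x)].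

End Surface.

Section PartialTube.
Variables (R : realType) (N s : nat).
Local Notation e1 := (@basis1 R).
Implicit Types (J : set R) (beta : R -> 'rV[R]_N) (E : R -> {vspace 'rV[R]_N}).
Implicit Types (phi : R -> 'rV[R]_s -> 'rV[R]_N) (alpha : R -> 'rV[R]_s).

Definition parallel_bundle_isometry J beta E phi : Prop :=
  [/\ smooth_on (J `*` [set: 'rV[R]_s]) (fun z : R * 'rV[R]_s => phi z.1 z.2),
      forall v, J v -> linear (phi v),
      forall v, J v -> forall y z, dotp (phi v y) (phi v z) = dotp y z,
      forall v, J v -> range (phi v) = [set xi | xi \in E v]
    & forall v y, J v -> normal_conn e1 beta 1 (phi ^~ y) v = 0].

Definition Omega J beta phi : set 'rV[R]_s :=
  [set Y | forall v, J v ->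
    1%:M - shape_op e1 beta v (phi v Y) \in unitmx].

Definition partial_tube alpha beta phi (u v : R) : 'rV[R]_N :=
  beta v + phi v (alpha u).

End PartialTube.

(* Main.v *)
(** Let X and Y be the unit fields spanning E0 and E1 in a chart, and T and B the
    derivatives of the immersion g along them.  The net is conjugate, so D_X B is
    tangent, and since T is unit and the X-curves are geodesics, D_X B = 0.  Hence
    v := <g - g(x0), B> satisfies X v = 0, while the 1-form <T, dg> is closed, with
    a primitive u satisfying X u = 1 and Y u = 0.  In the coordinates (u, v) the
    surface G has G_u = T and G_v parallel to B, where B depends on v only.  Thus
    for fixed u the vector G(u, v) - G(u0, v) is normal to the curve
    beta := G(u0, .) and has derivative along beta', i.e. it is a parallel normal
    section; expanding it in a maximal orthonormal family of parallel normal
    sections of beta gives phi and alpha.  The nonsingularity of I - A_xi is that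
    of the ratio between G_v and beta'. *)

(* The net is given as two line fields and the hypothesis on E0 speaks of curves only. The first
   task is therefore to extract pointwise identities for the unit fields: the one differential
   equation solved is that of an integral curve of X, along which the geodesic hypothesis becomes
   <D_X T, dg> = 0. From there on the coordinates are explicit functions on the surface, and only
   their inverse has to be constructed, by a contraction argument. The base point g(x0) in v is what
   makes Y v = 1 + <g - g(x0), D_Y B> equal to 1 at x0, hence nonzero nearby. The inverse of (u, v)
   has the partial derivatives X and Y / (Y v), which are smooth expressions in the inverse itself;
   its smoothness follows order by order. In the same spirit, parallel sections along beta are read
   off the surface: every G(u, .) - beta is one. Choosing E as the span of all of them makes it
   contain these differences at once, and the dimension N bounds its rank. *)
From HB Require Import structures.
Require Import Defs.
From mathcomp Require Import all_boot all_order all_algebra.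
From mathcomp Require Import all_classical all_reals all_analysis.
From mathcomp Require Import ring lra.

Set Implicit Arguments.
Unset Strict Implicit.
Unset Printing Implicit Defensive.
Import Order.TTheory GRing.Theory Num.Theory.
Import numFieldNormedType.Exports.
Local Open Scope classical_set_scope.
Local Open Scope ring_scope.

(** * Calculus of C^k maps *)

Section Differentiability.
Context {R : realType}.
Implicit Types V W X Z : normedModType R.

Lemma differentiable_eps V W (f : V -> W) x : differentiable f x ->
  forall e, 0 < e -> \forall y \near x,
    `|f y - f x - 'd f x (y - x)| <= e * `|y - x|.
Proof.
move=> /diff_locallyP[_ /eqaddoP df] e e0.
rewrite (near_shift 0 x) /=; apply: filterS (df e e0) => h /=.
by rewrite /= !fctE /= subr0 addrK opprD addrA.
Qed.

(** The way in which maps built by hand (functions with given partials, inverse maps) are shown to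
    be differentiable, with their differential. *)
Lemma differentiable_of_eps V W (f : V -> W) x (L : {linear V -> W}) :
  continuous L ->
  (forall e, 0 < e -> \forall y \near x, `|f y - f x - L (y - x)| <= e * `|y - x|) ->
  differentiable f x /\ 'd f x = L :> (V -> W).
Proof.
move=> cL fL.
have e : f \o shift x = cst (f x) + L +o_ 0 id.
  apply/eqaddoP => e e0; have := fL e e0.
  rewrite (near_shift 0 x) /=; apply: filterS => h /=.
  by rewrite /= !fctE /= subr0 addrK opprD addrA.
by have d := diff_unique cL e; split=> //; apply/diff_locallyP; rewrite d.
Qed.

Lemma derive_linear V W (f : V -> W) x : differentiable f x ->
  forall a v w, 'D_(a *: v + w) f x = a *: 'D_v f x + 'D_w f x.
Proof. by move=> df a v w; rewrite !deriveE // linearP. Qed.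

Lemma deriveDv V W (f : V -> W) x v w : differentiable f x ->
  'D_(v + w) f x = 'D_v f x + 'D_w f x.
Proof. by move=> df; rewrite -[v]scale1r derive_linear // !scale1r. Qed.

Lemma deriveZv V W (f : V -> W) x a v : differentiable f x ->
  'D_(a *: v) f x = a *: 'D_v f x.
Proof. by move=> df; rewrite -[a *: v]addr0 derive_linear // derive0 addr0. Qed.

Lemma derive_real W (f : R -> W) (x a : R) : differentiable f x ->
  'D_a f x = a *: 'D_1 f x.
Proof. by move=> df; rewrite -(deriveZv a (1 : R) df) [_ *: _]mulr1. Qed.

Lemma derive_comp V W Z (f : V -> W) (g : W -> Z) x v :
  differentiable f x -> differentiable g (f x) ->
  'D_v (g \o f) x = 'D_('D_v f x) g (f x).
Proof.
move=> df dg; rewrite deriveE; last exact: differentiable_comp.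
by rewrite diff_comp // !deriveE.
Qed.

Lemma derive_clinear V W (L : {linear V -> W}) x v : continuous L -> 'D_v L x = L v.
Proof. by move=> cL; rewrite deriveE ?diff_lin //; apply: linear_differentiable. Qed.

Lemma derive_comp_clinear V W Z (f : V -> W) (L : {linear W -> Z}) x v :
  continuous L -> differentiable f x -> 'D_v (L \o f) x = L ('D_v f x).
Proof.
move=> cL df; rewrite derive_comp //; last exact: linear_differentiable.
by rewrite derive_clinear.
Qed.

Lemma differentiable_near V W (f g : V -> W) x :
  (\near x, f x = g x) -> differentiable f x -> differentiable g x.
Proof.
move=> fg df; have fgx : f x = g x := nbhs_singleton fg.
have [] // := @differentiable_of_eps _ _ g x ('d f x) (diff_continuous df).
move=> e e0; near=> y; have -> : g y = f y by near: y; apply: filterS fg.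
by rewrite -fgx; near: y; apply: differentiable_eps.
Unshelve. all: by end_near. Qed.

Lemma near_eq_open V (U : set V) (W : Type) (f g : V -> W) x :
  open U -> U x -> {in U, f =1 g} -> \near x, f x = g x.
Proof.
move=> oU Ux fg; have : \near x, U x by apply: open_nbhs_nbhs.
by apply: filterS => y Uy; apply: fg; rewrite inE.
Qed.

(* Finite dimensionality in coordinates: [Ck] only controls directional
   derivatives, so the C^k chain rule needs a frame on the middle space. *)
Definition frame V n (e : 'I_n -> V) (c : 'I_n -> {linear V -> R}) : Prop :=
  (forall i, continuous (c i)) /\ forall v, v = \sum_i c i v *: e i.

Lemma derive_frame V W n (e : 'I_n -> V) c (f : V -> W) x v :
  frame e c -> differentiable f x -> 'D_v f x = \sum_i c i v *: 'D_(e i) f x.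
Proof.
move=> [_ ec] df; rewrite deriveE // {1}(ec v) linear_sum.
by apply: eq_bigr => i _; rewrite linearZ deriveE.
Qed.

(** One product rule serves both scaling and the dot product, which are registered as bilinear maps
    below. *)
Lemma bilin_diff V W Z X (b : {bilinear V -> W -> Z}) (f : X -> V) (g : X -> W) x :
  continuous (fun p : V * W => b p.1 p.2) -> differentiable f x -> differentiable g x ->
  differentiable (fun y => b (f y) (g y)) x /\
  forall v, 'D_v (fun y => b (f y) (g y)) x = b (f x) ('D_v g x) + b ('D_v f x) (g x).
Proof.
move=> cb df dg; have dp := differentiable_pair df dg.
have db := differentiable_bilin (f x, g x) cb.
have dc : differentiable (fun y => b (f y) (g y)) x.
  exact: (@differentiable_comp _ _ _ _ (fun y => (f y, g y)) (fun p => b p.1 p.2)).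
split=> // v; rewrite deriveE //.
rewrite (@diff_comp _ _ _ _ (fun y => (f y, g y)) (fun p => b p.1 p.2)) //=.
by rewrite diff_bilin //= diff_pair //= !deriveE.
Qed.

End Differentiability.

(** * Scaling and the dot product as continuous bilinear maps *)

Section Bilinear.
Context {R : realType}.

Lemma scale_is_bilinear (W : normedModType R) :
  bilinear_for (GRing.Scale.Law.clone _ _ *:%R _) (GRing.Scale.Law.clone _ _ *:%R _)
    (@GRing.scale R W : R -> W -> W).
Proof. by split=> [w|a] c x y /=; rewrite ?scalerDl ?scalerDr ?scalerA // mulrC. Qed.

HB.instance Definition _ (W : normedModType R) :=
  bilinear_isBilinear.Build R R W W _ _ (@GRing.scale R W) (@scale_is_bilinear W).

Lemma scale_continuous2 (W : normedModType R) :
  continuous (fun p : R * W => p.1 *: p.2).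
Proof. by move=> [a w]; apply: scale_continuous. Qed.

Lemma dotp_is_bilinear N :
  bilinear_for (GRing.Scale.Law.clone _ _ *:%R _) (GRing.Scale.Law.clone _ _ *:%R _)
    (@dotp R N).
Proof.
split=> [w|a] c x y /=; rewrite /dotp; first by rewrite mulmxDl -scalemxAl !mxE.
by rewrite linearP /= mulmxDr -scalemxAr !mxE.
Qed.

HB.instance Definition _ N :=
  bilinear_isBilinear.Build R _ _ R _ _ (@dotp R N) (@dotp_is_bilinear N).

Lemma dotpE N (x y : 'rV[R]_N) : dotp x y = \sum_i x 0 i * y 0 i.
Proof. by rewrite /dotp mxE; apply: eq_bigr => i _; rewrite mxE. Qed.

Lemma fst_continuous (U V : normedModType R) : continuous (fst : U * V -> U).
Proof. by move=> [a b]; apply: cvg_fst. Qed.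

Lemma snd_continuous (U V : normedModType R) : continuous (snd : U * V -> V).
Proof. by move=> [a b]; apply: cvg_snd. Qed.

Lemma dotp_continuous2 N : continuous (fun p : 'rV[R]_N * 'rV[R]_N => dotp p.1 p.2).
Proof.
move=> p; rewrite /continuous_at.
rewrite (_ : (fun p => _) = \sum_i (fun p : 'rV[R]_N * 'rV[R]_N => p.1 0 i * p.2 0 i)).
  have -> : dotp p.1 p.2 = (\sum_i (fun p : 'rV[R]_N * 'rV[R]_N => p.1 0 i * p.2 0 i)) p.
    by rewrite dotpE fct_sumE.
  elim/big_ind: _ => [|f g cf cg|i _]; first exact: cvg_cst; first exact: cvgD.
  apply: cvgM; [apply: (@continuous_comp _ _ _ fst (fun x : 'rV_N => x 0 i))|
    apply: (@continuous_comp _ _ _ snd (fun x : 'rV_N => x 0 i))].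
  - exact: fst_continuous.
  - exact: coord_continuous.
  - exact: snd_continuous.
  - exact: coord_continuous.
by apply/funext => q; rewrite dotpE fct_sumE.
Qed.

Lemma dotpC N (x y : 'rV[R]_N) : dotp x y = dotp y x.
Proof. by rewrite !dotpE; apply: eq_bigr => i _; rewrite mulrC. Qed.

Lemma dotp_ge0 N (x : 'rV[R]_N) : 0 <= dotp x x.
Proof. by rewrite dotpE; apply: sumr_ge0 => i _; apply: sqr_ge0. Qed.

Lemma dotp_eq0 N (x : 'rV[R]_N) : dotp x x = 0 -> x = 0.
Proof.
rewrite dotpE => /psumr_eq0P e; apply/rowP => i; rewrite mxE.
have /eqP := e (fun i _ => sqr_ge0 (x 0 i)) i isT.
by rewrite -expr2 sqrf_eq0 => /eqP.
Qed.

Lemma dotp_gt0 N (x : 'rV[R]_N) : x != 0 -> 0 < dotp x x.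
Proof. by move=> x0; rewrite lt_def dotp_ge0 andbT; apply: contra_neq x0 => /dotp_eq0. Qed.

Lemma dotpDl N (x y z : 'rV[R]_N) : dotp (x + y) z = dotp x z + dotp y z.
Proof. exact: linearDl. Qed.

Lemma dotpDr N (x y z : 'rV[R]_N) : dotp x (y + z) = dotp x y + dotp x z.
Proof. exact: linearDr. Qed.

Lemma dotpZl N a (y z : 'rV[R]_N) : dotp (a *: y) z = a * dotp y z.
Proof. exact: linearZl_LR. Qed.

Lemma dotpZr N a (y z : 'rV[R]_N) : dotp y (a *: z) = a * dotp y z.
Proof. exact: linearZr_LR. Qed.

Lemma dotp0l N (z : 'rV[R]_N) : dotp 0 z = 0.
Proof. exact: linear0l. Qed.

Lemma dotp0r N (z : 'rV[R]_N) : dotp z 0 = 0.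
Proof. exact: linear0r. Qed.

Lemma dotpBl N (x y z : 'rV[R]_N) : dotp (x - y) z = dotp x z - dotp y z.
Proof. exact: linearBl. Qed.

Lemma dotp_sumr N n (x : 'rV[R]_N) (F : 'I_n -> 'rV[R]_N) :
  dotp x (\sum_i F i) = \sum_i dotp x (F i).
Proof. exact: linear_sumr. Qed.

End Bilinear.

(** * Closure properties of C^k maps *)

Section Smooth.
Context {R : realType}.
Implicit Types V W X Z : normedModType R.

(** On an open set, equality of functions passes to their directional derivatives, hence to every
    order. This lets each closure lemma below compute a derivative on [U] only. *)
Lemma Ck_ext V W k (U : set V) (f g : V -> W) :
  open U -> {in U, f =1 g} -> Ck k U f -> Ck k U g.
Proof.
move=> oU; elim: k f g => [|k IH] f g fg /=.
  move=> cf x Ux; have nfg := near_eq_open oU Ux fg.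
  rewrite /prop_for /continuous_at -(nbhs_singleton nfg).
  by apply: cvg_trans (cf x Ux); apply: near_eq_cvg.
move=> [df Df]; split=> [x Ux|v].
  by apply: differentiable_near (df x Ux); apply: near_eq_open fg.
apply: IH (Df v) => x; rewrite inE => Ux.
exact: near_eq_derive (near_eq_open oU Ux fg).
Qed.

Lemma Ck_sub V W k (U U' : set V) (f : V -> W) : U' `<=` U -> Ck k U f -> Ck k U' f.
Proof.
elim: k f => [|k IH] f sU /=; first by move=> cf x /sU; apply: cf.
by move=> [df Df]; split=> [x /sU|v]; [apply: df|apply: IH (Df v)].
Qed.

Lemma CkW V W k (U : set V) (f : V -> W) : Ck k.+1 U f -> Ck k U f.
Proof.
elim: k f => [|k IH] f [df Df].
  by move=> x Ux; apply: differentiable_continuous; apply: df.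
by split=> // v; apply: IH.
Qed.

Lemma Ck_cst V W k (U : set V) (a : W) : Ck k U (cst a).
Proof.
elim: k a => [|k IH] a /=; first by move=> x _; apply: cvg_cst.
split=> [x _|v]; first exact: differentiable_cst.
rewrite (_ : 'D_v (cst a) = cst 0) //.
by apply/funext => x; rewrite derive_cst.
Qed.

Lemma Ck_clinear V W k (U : set V) (L : {linear V -> W}) : continuous L -> Ck k U L.
Proof.
move=> cL; case: k => [|k] /=; first by move=> x _; apply: cL.
split=> [x _|v]; first exact: linear_differentiable.
rewrite (_ : 'D_v L = cst (L v)); first exact: Ck_cst.
by apply/funext => x; rewrite derive_clinear.
Qed.

Lemma Ck_comp_clinear V W Z k (U : set V) (f : V -> W) (L : {linear W -> Z}) :
  open U -> continuous L -> Ck k U f -> Ck k U (L \o f).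
Proof.
move=> oU cL; elim: k f => [|k IH] f /=.
  by move=> cf x Ux; apply: continuous_comp; [apply: cf|apply: cL].
move=> [df Df]; split=> [x Ux|v].
  by apply: differentiable_comp; [apply: df|apply: linear_differentiable].
apply: (Ck_ext (f := L \o 'D_v f)) => // [x|]; last exact: IH.
by rewrite inE => Ux; rewrite derive_comp_clinear //; apply: df.
Qed.

Lemma Ck_add V W k (U : set V) (f g : V -> W) :
  open U -> Ck k U f -> Ck k U g -> Ck k U (f \+ g).
Proof.
move=> oU; elim: k f g => [|k IH] f g /=.
  by move=> cf cg x Ux; apply: cvgD; [apply: cf|apply: cg].
move=> [df Df] [dg Dg]; split=> [x Ux|v].
  by apply: differentiableD; [apply: df|apply: dg].
apply: (Ck_ext (f := 'D_v f \+ 'D_v g)) => // [x|]; last exact: IH.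
by rewrite inE => Ux; rewrite deriveD //; apply: diff_derivable; auto.
Qed.

(** Each term of the Leibniz rule differentiates one factor and keeps the other, weakened by one
    order, so that the induction hypothesis applies to both. *)
Lemma Ck_bilin V W X Z (b : {bilinear V -> W -> Z}) k (U : set X) (f : X -> V) (g : X -> W) :
  open U -> continuous (fun p : V * W => b p.1 p.2) ->
  Ck k U f -> Ck k U g -> Ck k U (fun x => b (f x) (g x)).
Proof.
move=> oU cb; elim: k f g => [|k IH] f g.
  move=> cf cg x Ux.
  apply: (@continuous_comp _ _ _ (fun x => (f x, g x)) (fun p => b p.1 p.2)); last exact: cb.
  by apply: cvg_pair; [apply: cf|apply: cg].
move=> Cf Cg; have [df Df] := Cf; have [dg Dg] := Cg; split=> [x Ux|v].
  by have [] := bilin_diff cb (df x Ux) (dg x Ux).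
apply: (Ck_ext (f := (fun x => b (f x) ('D_v g x)) \+ (fun x => b ('D_v f x) (g x)))) => //.
  by move=> x; rewrite inE => Ux; have [_ ->] := bilin_diff cb (df x Ux) (dg x Ux).
by apply: Ck_add => //; [exact: IH (CkW Cf) (Dg v)|exact: IH (Df v) (CkW Cg)].
Qed.

Lemma Ck_scale V W k (U : set V) (a : V -> R) (f : V -> W) :
  open U -> Ck k U a -> Ck k U f -> Ck k U (fun x => a x *: f x).
Proof. by move=> oU; apply: Ck_bilin => //; apply: scale_continuous2. Qed.

Lemma Ck_mul V k (U : set V) (a f : V -> R) :
  open U -> Ck k U a -> Ck k U f -> Ck k U (fun x => a x * f x).
Proof. exact: Ck_scale. Qed.

Lemma Ck_dotp V N k (U : set V) (f g : V -> 'rV[R]_N) :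
  open U -> Ck k U f -> Ck k U g -> Ck k U (fun x => dotp (f x) (g x)).
Proof. by move=> oU; apply: Ck_bilin => //; apply: dotp_continuous2. Qed.

Lemma Ck_sum V W k (U : set V) n (f : 'I_n -> V -> W) :
  open U -> (forall i, Ck k U (f i)) -> Ck k U (fun x => \sum_i f i x).
Proof.
move=> oU Cf; rewrite -fct_sumE; elim/big_ind: _ => [|g h Cg Ch|i _]; last exact: Cf.
  exact: (Ck_cst k U (0 : W)).
exact: Ck_add.
Qed.

Lemma Ck_coord V N k (U : set V) (f : V -> 'rV[R]_N) i :
  open U -> Ck k U f -> Ck k U (fun x => f x 0 i).
Proof.
move=> oU Cf; apply: (Ck_ext (f := fun x => dotp (f x) (delta_mx 0 i))) => //.
  move=> x _; rewrite dotpE (bigD1 i) //= mxE !eqxx mulr1 big1 ?addr0 // => j ji.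
  by rewrite mxE eqxx (negbTE ji) mulr0.
by apply: Ck_dotp => //; apply: Ck_cst.
Qed.

Lemma Ck_rV V N k (U : set V) (f : V -> 'rV[R]_N) :
  open U -> (forall i, Ck k U (fun x => f x 0 i)) -> Ck k U f.
Proof.
move=> oU Cf; apply: (Ck_ext (f := fun x => \sum_i f x 0 i *: (delta_mx 0 i : 'rV_N))) => //.
  by move=> x _; rewrite -row_sum_delta.
by apply: Ck_sum => // i; apply: Ck_scale => //; apply: Ck_cst.
Qed.

(** The chain rule differentiates [g] in the direction ['D_v f x], which varies with [x]. Expanding
    it in the frame leaves fixed directions with varying coefficients, to which the induction
    applies. *)
Lemma Ck_comp V W Z n (e : 'I_n -> W) c k (U : set V) (U' : set W) (f : V -> W) (g : W -> Z) :
  frame e c -> open U -> open U' -> (forall x, U x -> U' (f x)) ->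
  Ck k U f -> Ck k U' g -> Ck k U (g \o f).
Proof.
move=> ec oU oU' fU; elim: k f g fU => [|k IH] f g fU Cf Cg.
  by move=> x Ux; apply: continuous_comp; [apply: Cf|apply/Cg/fU].
have [df Df] := Cf; have [dg Dg] := Cg; split=> [x Ux|v].
  by apply: differentiable_comp; [apply: df|apply/dg/fU].
apply: (Ck_ext (f := fun x => \sum_i c i ('D_v f x) *: 'D_(e i) g (f x))) => //.
  move=> x; rewrite inE => Ux; rewrite derive_comp; [|exact: df|exact/dg/fU].
  by rewrite -(derive_frame _ ec) //; apply/dg/fU.
apply: Ck_sum => // i; apply: Ck_scale => //.
  by apply: (Ck_comp_clinear (L := c i) oU _ (Df v)); have [] := ec.
exact: (IH f ('D_(e i) g) fU (CkW Cf) (Dg _)).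
Qed.

(** The derivative of 1 / f is a polynomial in 1 / f and f', so one order of regularity of 1 / f
    yields the next. The square root below is treated alike. *)
Lemma Ck_inv V k (U : set V) (f : V -> R) :
  open U -> (forall x, U x -> f x != 0) -> Ck k U f -> Ck k U (fun x => (f x)^-1).
Proof.
move=> oU f0; elim: k => [|k IH] Cf.
  by move=> x Ux; apply: cvgV; [apply: f0|apply: Cf].
have [df Df] := Cf; split=> [x Ux|v].
  by apply: differentiableV; [apply: df|apply: f0].
have CV := IH (CkW Cf).
apply: (Ck_ext (f := fun x => -1 * ((f x)^-1 * (f x)^-1 * 'D_v f x))) => //.
  move=> x; rewrite inE => Ux; rewrite deriveV; [|exact: f0|exact/diff_derivable/df].
  by rewrite /= mulN1r scaleNr /GRing.scale /= expr2 invfM.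
by apply: Ck_mul; [|exact: Ck_cst|exact: Ck_mul (Ck_mul oU CV CV) (Df v)].
Qed.

Lemma Ck_sqrt V k (U : set V) (f : V -> R) :
  open U -> (forall x, U x -> 0 < f x) -> Ck k U f -> Ck k U (fun x => Num.sqrt (f x)).
Proof.
move=> oU f0; elim: k => [|k IH] Cf.
  by move=> x Ux; apply: (@continuous_comp _ _ _ f); [apply: Cf|apply: sqrt_continuous].
have [df Df] := Cf.
have ds x : U x -> differentiable (Num.sqrt : R -> R) (f x).
  by move=> Ux; apply/derivable1_diffP; have := is_derive1_sqrt (f0 x Ux) => -[].
split=> [x Ux|v]; first by apply: differentiable_comp; [apply: df|apply: ds].
have CV := IH (CkW Cf).
apply: (Ck_ext (f := fun x => 'D_v f x * (2 * Num.sqrt (f x))^-1)) => //.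
  move=> x; rewrite inE => Ux; rewrite (derive_comp (f := f)); [|exact: df|exact: ds].
  by rewrite derive_real ?derive_sqrt ?f0 //; exact: ds.
apply: (Ck_mul oU (Df v)); apply: Ck_inv => // [x Ux|].
  by rewrite mulf_neq0 // gt_eqF // sqrtr_gt0 f0.
by apply: Ck_mul => //; apply: Ck_cst.
Qed.

End Smooth.

(** * Coordinate frames, mean value estimates, symmetry of second derivatives *)

Section Frames.
Context {R : realType}.
Implicit Types V W X Z : normedModType R.

(** A named form of the coordinate function, to which a linear structure can be attached. *)
Definition rcoord n (i : 'I_n) (x : 'rV[R]_n) : R := x 0 i.

Lemma rcoord_is_linear n (i : 'I_n) : linear (rcoord i).
Proof. by move=> a x y; rewrite /rcoord !mxE. Qed.

HB.instance Definition _ n (i : 'I_n) :=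
  GRing.isLinear.Build R 'rV[R]_n R _ (rcoord i) (rcoord_is_linear i).

Lemma frame_rV n : @frame R 'rV[R]_n n (fun i => delta_mx 0 i) (fun i => @rcoord n i).
Proof.
by split=> [i|v]; [exact: coord_continuous|rewrite {1}(row_sum_delta v)].
Qed.

Lemma frame_real : @frame R R 1 (@basis1 R) (fun=> idfun).
Proof. by split=> [i x|v]; [exact: cvg_id|rewrite big_ord1 [_ *: _]mulr1]. Qed.

Definition basis_pair (i : 'I_2) : R * R := if i == 0 then (1, 0) else (0, 1).
Definition coord_pair (i : 'I_2) : {linear (R * R)%type -> R} :=
  if i == 0 then (fst : {linear (R * R)%type -> R}) else (snd : {linear (R * R)%type -> R}).

Lemma frame_pair : frame basis_pair coord_pair.
Proof.
split=> [i|[a b]]; last first.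
  rewrite big_ord_recl big_ord1 /basis_pair /coord_pair /=.
  by rewrite -[RHS]/(a * 1 + b * 0, a * 0 + b * 1) !mulr0 !mulr1 addr0 add0r.
by rewrite /coord_pair; case: ifP => _; [exact: fst_continuous|exact: snd_continuous].
Qed.

Lemma mx_norm_le n (x : 'rV[R]_n) (e : R) :
  0 <= e -> (forall i, `|x 0 i| <= e) -> `|x| <= e.
Proof.
move=> e0 xe; rewrite [`|x|]mx_normrE; apply: bigmax_le => // -[i j] _ /=.
by rewrite ord1.
Qed.

Lemma coord_le_norm n (x : 'rV[R]_n) i : `|x 0 i| <= `|x|.
Proof. by rewrite [leRHS]mx_normrE; apply: (le_bigmax _ _ (0, i)). Qed.

Lemma derive_coord V n (f : V -> 'rV[R]_n) x v i :
  differentiable f x -> 'D_v (fun y => f y 0 i) x = 'D_v f x 0 i.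
Proof.
by move=> df; apply: (derive_comp_clinear (L := @rcoord n i)) => //; apply: coord_continuous.
Qed.

Lemma differentiable_rcoord V n (f : V -> 'rV[R]_n) x i :
  differentiable f x -> differentiable (fun y => f y 0 i) x.
Proof.
by move=> df; apply: (@differentiable_comp _ _ _ _ f (@rcoord n i)) => //; apply: differentiable_coord.
Qed.

Lemma derive_line V W (f : V -> W) x v (t : R) : differentiable f (x + t *: v) ->
  differentiable (fun s : R => f (x + s *: v)) t /\
  'D_1 (fun s : R => f (x + s *: v)) t = 'D_v f (x + t *: v).
Proof.
move=> df.
have dl : differentiable (fun s : R => x + s *: v) t.
  by apply: differentiableD => //; apply: differentiableZl.
have Dl : 'D_1 (fun s : R => x + s *: v) t = v.
  rewrite deriveD //; last exact/diff_derivable/differentiableZl.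
  by rewrite derive_cst add0r deriveE // diff_val scale1r.
split; first exact: (@differentiable_comp _ _ _ _ (fun s : R => x + s *: v) f).
by rewrite (derive_comp (f := fun s : R => x + s *: v)) // Dl.
Qed.

Lemma derive_translate V W (f : V -> W) x a : differentiable f (x + a) ->
  differentiable (fun y => f (y + a)) x /\
  forall u, 'D_u (fun y => f (y + a)) x = 'D_u f (x + a).
Proof.
move=> df; have ds : differentiable (fun y : V => y + a) x.
  exact: (differentiableD (f := id) (g := cst a)).
split=> [|u]; first exact: (@differentiable_comp _ _ _ _ (fun y => y + a) f).
rewrite (derive_comp (f := fun y => y + a)) //; congr ('D_ _ f _).
rewrite (deriveD (f := id) (g := cst a)); [|exact: derivable_id|exact: derivable_cst].
by rewrite derive_id derive_cst addr0.
Qed.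

(** The norm of a row vector is the maximum of its coordinates, so the scalar mean value theorem in
    each coordinate costs no constant. The vector [m] is the expected increment. *)
Lemma mvt_segment V n (f : V -> 'rV[R]_n) x v m (C : R) :
  (forall t : R, 0 <= t <= 1 -> differentiable f (x + t *: v) /\
     `|'D_v f (x + t *: v) - m| <= C) ->
  `|f (x + v) - f x - m| <= C.
Proof.
move=> H; have C0 : 0 <= C.
  by have [|_] := H 0; [rewrite lexx ler01|apply: le_trans].
apply: mx_norm_le => // i.
pose g (t : R) : R := f (x + t *: v) 0 i.
have dg (t : R) : 0 <= t <= 1 -> differentiable g t /\ 'D_1 g t = 'D_v f (x + t *: v) 0 i.
  move=> /H[df _]; have [dl Dl] := derive_line df.
  by split; [exact: (differentiable_rcoord i dl)|rewrite (derive_coord (1 : R) i dl) Dl].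
have [t||t t01 E] := @MVT_segment R g (fun t => 'D_1 g t) 0 1 ler01.
- rewrite in_itv /= => /andP[t0 t1].
  by apply/derivableP/diff_derivable; have [] := dg t; rewrite ?(ltW t0) ?(ltW t1).
- apply: derivable_within_continuous => t; rewrite in_itv /= => t01.
  by apply/diff_derivable; have [] := dg t t01.
rewrite in_itv /= in t01; have [_ Hm] := H t t01; have [_ Dg] := dg t t01.
move: E; rewrite subr0 mulr1 Dg /g scale1r scale0r addr0 => E.
rewrite !mxE E; apply: le_trans Hm; apply: le_trans (coord_le_norm _ i).
by rewrite !mxE.
Qed.

(** The symmetric ball around [a] spares a distinction between [b] on the left and on the right of
    [a]. *)
Lemma mvt_real n (f : R -> 'rV[R]_n) (a b : R) m (C : R) :
  (forall t : R, `|t - a| <= `|b - a| -> differentiable f t /\ `|'D_1 f t - m| <= C) ->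
  `|f b - f a - (b - a) *: m| <= C * `|b - a|.
Proof.
move=> H; rewrite -{1}[b](subrK a) [_ + a]addrC; apply: mvt_segment => t /andP[t0 t1].
have [|df le] := H (a + t *: (b - a)).
  by rewrite addrC addKr normrZ ger0_norm // ler_piMl.
by split=> //; rewrite derive_real // -scalerBr normrZ mulrC ler_wpM2r.
Qed.

(** For a C^1 map the linear approximation at [x0] is uniform over pairs of nearby points: the mean
    value theorem is applied to the deviation of the partials from their values at [x0]. Inversion,
    Lipschitz bounds and the symmetry of second derivatives all rest on it. *)
Lemma strict_diff V k (e : 'I_k -> V) c n (U : set V) (f : V -> 'rV[R]_n) x0 :
  frame e c -> open U -> U x0 -> Ck 1 U f ->
  forall eps, 0 < eps -> exists2 r, 0 < r &
    (forall x, `|x - x0| < r -> U x) /\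
    forall x y, `|x - x0| < r -> `|y - x0| < r ->
      `|f y - f x - 'D_(y - x) f x0| <= eps * `|y - x|.
Proof.
move=> ec oU Ux0 [df Df] eps eps0.
have [K [K0 HK]] : exists K : R, 0 < K /\ forall v, \sum_i `|c i v| <= K * `|v|.
  have Hi i : exists K : R, 0 < K /\ forall v, `|c i v| <= K * `|v|.
    by have [K K0 HK] := linear_lipschitz (ec.1 i); exists K.
  have [K HK] := choice Hi.
  (* The summand 1 keeps [K] positive even for an empty frame; [eps] is divided by it. *)
  exists (1 + \sum_i K i); split.
    by rewrite ltr_pwDl // sumr_ge0 // => i _; apply/ltW; have [] := HK i.
  move=> v; rewrite mulrDl mul1r mulr_suml -[leLHS]add0r lerD // ler_sum // => i _.
  by have [] := HK i.
have [r r0 Hr] : exists2 r, 0 < r & forall x, `|x - x0| < r ->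
    U x /\ forall i, `|'D_(e i) f x - 'D_(e i) f x0| <= eps / K.
  have : \forall x \near x0, U x /\ forall i, `|'D_(e i) f x - 'D_(e i) f x0| <= eps / K.
    near=> x; split; first by near: x; apply: open_nbhs_nbhs.
    near: x; apply: filter_forall => i; exact: cvgr_distC_le (Df (e i) x0 Ux0) _ (divr_gt0 eps0 K0).
  move=> /nbhs_normP[r /= r0 Hr]; exists r => // x xr; apply: Hr => /=.
  by rewrite distrC.
exists r => //; split=> [x /Hr[]//|x y xr yr].
have -> : y = x + (y - x) by rewrite addrC subrK.
rewrite [X in 'D_X f x0]addrC addKr [X in eps * `|X|]addrC addKr.
apply: mvt_segment => t /andP[t0 t1].
have [] := Hr (x + t *: (y - x)).
  have -> : x + t *: (y - x) - x0 = (1 - t) *: (x - x0) + t *: (y - x0).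
    rewrite scalerBl scale1r -(addrA (x - x0)) [- _ + _]addrC -scalerBr opprB addrA subrK.
    by rewrite addrAC.
  apply: le_lt_trans (ler_normD _ _) _; rewrite !normrZ (ger0_norm t0) ger0_norm ?subr_ge0 //.
  (* The strict inequality comes from the first term, whose weight vanishes at t = 1; that endpoint
     is treated apart. *)
  have [t_eq1|t_lt1] := eqVneq t 1; first by rewrite t_eq1 subrr mul0r add0r mul1r.
  have {}t1 : 0 < 1 - t by rewrite subr_gt0 lt_neqAle t_lt1.
  have -> : r = (1 - t) * r + t * r by ring.
  by apply: ltr_leD; [rewrite ltr_pM2l|apply: ler_wpM2l => //; apply: ltW].
move=> Uz Hz; split; first exact: df.
rewrite (derive_frame (y - x) ec (df _ Uz)) (derive_frame (y - x) ec (df _ Ux0)).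
rewrite -sumrB; apply: le_trans (ler_norm_sum _ _ _) _.
have -> : eps * `|y - x| = eps / K * (K * `|y - x|) by field; apply: lt0r_neq0.
apply: le_trans (ler_wpM2l (ltW (divr_gt0 eps0 K0)) (HK (y - x))).
rewrite mulr_sumr; apply: ler_sum => i _.
by rewrite -scalerBr normrZ mulrC ler_wpM2r.
Unshelve. all: by end_near. Qed.

Lemma locally_lipschitz V k (e : 'I_k -> V) c n (U : set V) (f : V -> 'rV[R]_n) x0 :
  frame e c -> open U -> U x0 -> Ck 1 U f ->
  exists r L : R, [/\ 0 < r, 0 < L, forall x, `|x - x0| < r -> U x &
    forall x y, `|x - x0| < r -> `|y - x0| < r -> `|f y - f x| <= L * `|y - x|].
Proof.
move=> ec oU Ux0 Cf; have [r r0 [rU Hr]] := strict_diff ec oU Ux0 Cf ltr01.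
have df := Cf.1 x0 Ux0; have [K K0 HK] := linear_lipschitz (diff_continuous df).
exists r, (1 + K); split=> // [|x y xr yr]; first by rewrite addr_gt0.
rewrite -[f y - f x](subrK ('D_(y - x) f x0)); apply: le_trans (ler_normD _ _) _.
by rewrite mulrDl lerD ?Hr // deriveE.
Qed.

(* Both mixed derivatives are the limit of the same second difference quotient. *)
Lemma schwarz V k (e : 'I_k -> V) c n (U : set V) (f : V -> 'rV[R]_n) x0 v w :
  frame e c -> open U -> U x0 -> Ck 2 U f ->
  'D_v ('D_w f) x0 = 'D_w ('D_v f) x0.
Proof.
move=> ec oU Ux0 Cf; have [df Df] := Cf.
have main v' w' eps : 0 < eps -> exists2 r, 0 < r & forall h, 0 < h -> h < r ->
    `|(f (x0 + h *: w' + h *: v') - f (x0 + h *: w')) - (f (x0 + h *: v') - f x0)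
      - h ^+ 2 *: 'D_v' ('D_w' f) x0| <= eps * h ^+ 2 * `|v'|.
  move=> eps0; have [r r0 [rU Hr]] := strict_diff ec oU Ux0 (Df w') eps0.
  (* With h * B < r, the whole parallelogram with sides h v' and h w' at [x0] stays in the ball of
     radius [r]; the summand 1 makes [B] positive. *)
  pose B := `|v'| + `|w'| + 1.
  have B0 : 0 < B by rewrite ltr_wpDl // addr_ge0.
  exists (r / B); first exact: divr_gt0.
  move=> h h0 hr; rewrite ltr_pdivlMr // in hr.
  have bnd (s t : R) : 0 <= s <= 1 -> 0 <= t <= 1 ->
      `|x0 + s *: (h *: v') + t *: (h *: w') - x0| < r.
    move=> /andP[s0 s1] /andP[t0 t1]; rewrite [_ - x0]addrC -!addrA addKr.
    apply: le_lt_trans hr; apply: le_trans (ler_normD _ _) _.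
    rewrite !normrZ (ger0_norm s0) (ger0_norm t0) (gtr0_norm h0) /B.
    have hv : s * (h * `|v'|) <= h * `|v'| by rewrite ler_piMl // mulr_ge0 // ltW.
    have hw : t * (h * `|w'|) <= h * `|w'| by rewrite ler_piMl // mulr_ge0 // ltW.
    rewrite !mulrDr mulr1; lra.
  (* The second difference is the increment of the first difference [q] along h w', so the mean
     value theorem applies to [q]. *)
  pose q x := f (x + h *: v') - f x.
  apply: (mvt_segment (f := q)) => t t01.
  have b1 := bnd 1 t; have b0 := bnd 0 t.
  rewrite !(scale1r, scale0r, addr0, lexx, ler01, andbT) in b1 b0.
  have {}b1 := b1 isT t01; have {}b0 := b0 isT t01.
  rewrite [x0 + _ + _]addrAC in b1.
  have [d1 D1] := derive_translate (df _ (rU _ b1)); have d0 := df _ (rU _ b0).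
  split; first exact: differentiableB.
  rewrite deriveB; [|exact: diff_derivable|exact: diff_derivable].
  rewrite D1 !deriveZv //; [|exact/df/rU].
  rewrite -scalerBr expr2 -scalerA -scalerBr normrZ (gtr0_norm h0).
  have := Hr _ _ b0 b1; rewrite [X in 'D_X _ x0]addrC addKr deriveZv; last exact: (Df w').1.
  rewrite [X in eps * `|X|]addrC addKr normrZ (gtr0_norm h0) => Hb.
  by rewrite [leRHS](_ : _ = h * (eps * (h * `|v'|))) ?ler_pM2l //; ring.
apply/eqP; rewrite -subr_eq0 -normr_le0; apply/ler_addgt0Pl => eps eps0; rewrite addr0.
pose B := `|v| + `|w| + 1.
have B0 : 0 < B by rewrite ltr_wpDl // addr_ge0.
have [r r0 Hr] := main v w _ (divr_gt0 eps0 B0).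
have [r' r'0 Hr'] := main w v _ (divr_gt0 eps0 B0).
pose h := Num.min r r' / 2.
have m0 : 0 < Num.min r r' by rewrite lt_min r0.
have h0 : 0 < h by rewrite divr_gt0.
have hm : h < Num.min r r' by rewrite /h ltr_pdivrMr // ltr_pMr // ltr1n.
move: (hm); rewrite lt_min => /andP[hr hr'].
have := Hr h h0 hr; have := Hr' h h0 hr'.
set P := f _ - f _ - (f _ - f x0); set Q := f _ - f _ - (f _ - f x0) => HP HQ.
have PQ : P = Q.
  rewrite /P /Q [x0 + h *: v + h *: w]addrAC !opprB !addrA.
  by rewrite (ACl (1*4*3*2)).
have h20 : 0 < h ^+ 2 by rewrite exprn_gt0.
rewrite -(ler_pM2l h20) -(gtr0_norm h20) -normrZ scalerBr.
rewrite PQ in HP; apply: le_trans (ler_distD Q _ _) _; rewrite distrC.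
apply: le_trans (lerD HQ HP) _; rewrite -mulrDr gtr0_norm //.
have -> : eps / B * h ^+ 2 * (`|v| + `|w|) = h ^+ 2 * eps * ((`|v| + `|w|) / B) by ring.
rewrite ler_piMr //; first exact/ltW/mulr_gt0.
by rewrite ler_pdivrMr // mul1r /B lerDl.
Qed.

End Frames.

(** * Integral curves, primitives of closed forms, inverse functions *)

Section UniformFixpoint.
Context {R : realType}.

(* Banach's theorem for the sup distance, in terms of pointwise bounds, as
   unbounded functions [I -> W] carry no norm. *)
Lemma uniform_fixpoint (I : Type) (W : completeNormedModType R) (S : set (I -> W))
    (T : (I -> W) -> I -> W) (d0 : I -> W) (K : R) :
  S d0 -> (forall d, S d -> S (T d)) ->
  (forall t, `|T d0 t - d0 t| <= K) ->
  (forall d d' C, S d -> S d' -> (forall t, `|d' t - d t| <= C) ->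
     forall t, `|T d' t - T d t| <= C / 2) ->
  (forall d, (forall e, 0 < e -> exists2 d', S d' & forall t, `|d' t - d t| <= e) -> S d) ->
  exists2 d, S d & forall t, T d t = d t.
Proof.
move=> Sd0 ST TK Tc Scl.
pose s n := iter n T d0.
have Ss n : S (s n) by elim: n => //= n; apply: ST.
have step n t : `|s n.+1 t - s n t| <= K / 2 ^+ n.
  elim: n t => [|n IH] t; first by rewrite expr0 divr1 TK.
  by rewrite exprSr invfM mulrA; exact: (Tc _ _ _ (Ss n) (Ss n.+1) IH).
(* The exact form of the geometric sum, for the induction on [m] to close; only the bound in [dist']
   is used later. *)
have dist n m t : `|s (n + m)%N t - s n t| <= 2 * K / 2 ^+ n * (1 - (2 ^+ m)^-1).
  elim: m => [|m IH]; first by rewrite addn0 subrr normr0 expr0 invr1 subrr mulr0.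
  rewrite addnS -[_ - _](subrKA (s (n + m)%N t)); apply: le_trans (ler_normD _ _) _.
  apply: le_trans (lerD (step _ _) IH) _; rewrite exprD exprS.
  have n2 : (2 : R) ^+ n != 0 by rewrite expf_neq0.
  have m2 : (2 : R) ^+ m != 0 by rewrite expf_neq0.
  rewrite le_eqVlt; apply/orP; left; apply/eqP; field; exact/andP.
(* The index type may be empty, so the sign of [K] is known only from a point [t]. *)
have K0 t : 0 <= K := le_trans (normr_ge0 _) (TK t).
have dist' n m t : `|s (n + m)%N t - s n t| <= 2 * K / 2 ^+ n.
  apply: le_trans (dist n m t) _; rewrite ler_piMr //.
  by rewrite divr_ge0 ?mulr_ge0 ?exprn_ge0 // (K0 t).
have small e : 0 < e -> exists n : nat, 2 * K / 2 ^+ n <= e.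
  move=> e0; have /cvgrPdist_le : (2 * K) * (2^-1 : R) ^+ n @[n --> \oo] --> (2 * K) * 0.
    by apply: cvgM; [exact: cvg_cst|apply: cvg_expr; rewrite gtr0_norm // invf_lt1 // ltr1n].
  move=> /(_ e e0)[n _ /(_ n (leqnn n))] /= H; exists n.
  by rewrite mulr0 sub0r normrN in H; apply: le_trans H; rewrite exprVn ler_norm.
have cv t : exists l : W, s n t @[n --> \oo] --> l.
  apply/(@cvg_ex W)/cauchy_cvgP/cauchy_ballP => e e0; near_simpl.
  have [n Hn] := small (e / 3) (divr_gt0 e0 (ltr0n _ 3)).
  exists ([set m | (n <= m)%N], [set m | (n <= m)%N]); first by split; exists n.
  move=> [a b] /= [na nb]; rewrite -ball_normE /=.
  rewrite -(subrKA (s n t)); apply: le_lt_trans (ler_normD _ _) _.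
  have := dist' n (a - n)%N t; have := dist' n (b - n)%N t; rewrite !subnKC // => Hb Ha.
  rewrite [`|s n t - _|]distrC.
  apply: le_lt_trans (lerD (le_trans Ha Hn) (le_trans Hb Hn)) _.
  by rewrite -mulrDr gtr_pMr // -mulr2n -[_ *+ 2]mulr_natr mulrC ltr_pdivrMr // mul1r ltr_nat.
have [d Hd] := choice cv.
have lim n t : `|s n t - d t| <= 2 * K / 2 ^+ n.
  apply/ler_addgt0Pl => e e0; have /cvgrPdist_le /(_ e e0)[N _ HN] := Hd t.
  have := HN (n + N)%N (leq_addl _ _) => /= H.
  rewrite -(subrKA (s (n + N)%N t)) addrC; apply: le_trans (ler_normD _ _) _.
  by rewrite lerD // distrC.
have Sd : S d.
  by apply: Scl => e e0; have [n Hn] := small e e0; exists (s n) => // t; apply: le_trans Hn.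
exists d => // t; apply/eqP; rewrite -subr_eq0 -normr_le0; apply/ler_addgt0Pl => e e0.
rewrite addr0; have [n Hn] := small (e / 2) (divr_gt0 e0 (ltr0n _ 2)).
rewrite -(subrKA (s n.+1 t)); apply: le_trans (ler_normD _ _) _.
have H1 : `|T d t - s n.+1 t| <= e / 2 / 2.
  by apply: (Tc (s n) d) => // u; rewrite distrC; apply: le_trans Hn.
have H2 : `|s n.+1 t - d t| <= e / 2.
  apply: le_trans (lim _ _) _; apply: le_trans Hn; rewrite ler_wpM2l ?mulr_ge0 ?(K0 t) //.
  by rewrite lef_pV2 ?posrE ?exprn_gt0 // exprS ler_peMl ?exprn_ge0 // ler1n.
apply: le_trans (lerD H1 H2) _; rewrite [leRHS]splitr lerD2r ler_pdivrMr //.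
by rewrite ler_peMr ?ler1n // ltW // divr_gt0.
Unshelve. all: by end_near. Qed.

(** A solution of H x = w is a fixed point of x - H x + w, which the hypothesis makes a contraction
    of ratio 1/2. *)
Lemma inverse_near_identity (V : completeNormedModType R) (H : V -> V) x0 r w :
  (forall x y, `|x - x0| < r -> `|y - x0| < r -> `|H y - H x - (y - x)| <= 2^-1 * `|y - x|) ->
  `|w - H x0| < r / 2 -> exists2 x, `|x - x0| < r & H x = w.
Proof.
(* The map moves [x0] by |w - H x0| = r' / 2 and halves distances, so it preserves the closed ball
   of radius [r']; this ball lies in the open one of radius [r]. *)
move=> Hc wr; pose r' := 2 * `|w - H x0|.
have r'r : r' < r by rewrite /r' mulrC -ltr_pdivlMr.
have r0 : 0 < r by apply: le_lt_trans r'r; rewrite mulr_ge0.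
have c x y : `|x - x0| < r -> `|y - x0| < r -> `|(y - H y + w) - (x - H x + w)| <= `|y - x| / 2.
  move=> xr yr; rewrite mulrC; apply: le_trans (Hc x y xr yr); rewrite -normrN.
  rewrite le_eqVlt; apply/orP; left; apply/eqP; congr `|_|.
  by rewrite opprB [y - H y + w]addrC addrKA !opprB !addrA (ACl (3*2*1*4)).
(* Over a one-point index type the functions are points of [V]. *)
have [||t|d d' C Sd Sd' dC t|d Hd|d Sd Hd] := @uniform_fixpoint unit V
  [set d | `|d tt - x0| <= r'] (fun d t => d t - H (d t) + w) (fun=> x0) r'.
- by rewrite /= subrr normr0 mulr_ge0.
- move=> d /= Sd; rewrite -(subrKA (x0 - H x0 + w)).
  apply: le_trans (ler_normD _ _) _; rewrite [r']splitr; apply: lerD.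
    apply: le_trans (c _ _ _ _) _; rewrite ?subrr ?normr0 // ?ler_pM2r //.
    exact: le_lt_trans r'r.
  by rewrite [_ - x0]addrC -!addrA addKr [- _ + _]addrC /r' mulrC mulKf.
- by rewrite [_ - x0]addrC -!addrA addKr [- _ + _]addrC /r' ler_peMl // ler1n.
- apply: le_trans (c _ _ _ _) _; case: t; rewrite ?(le_lt_trans Sd) ?(le_lt_trans Sd') //.
  by rewrite ler_pM2r.
- apply/ler_addgt0Pl => e e0; have [d' Sd' H'] := Hd e e0.
  rewrite -(subrKA (d' tt)); apply: le_trans (ler_normD _ _) _.
  by rewrite lerD // distrC.
exists (d tt); first exact: le_lt_trans r'r.
have /eqP := Hd tt; rewrite -addrA -subr_eq0 [_ - d tt]addrC addKr [- _ + _]addrC.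
by rewrite subr_eq0 eq_sym => /eqP.
Qed.

End UniformFixpoint.

(** * Primitives of continuous functions of one variable *)

Section Primitive.
Context {R : realType}.

(** Integration starts at c - r so that the fundamental theorem covers both sides of [c]; the
    constant is then adjusted to vanish at [c]. *)
Lemma exists_primitive_real (g : R -> R) (c r : R) : continuous g ->
  exists G : R -> R, G c = 0 /\
    forall t, `|t - c| < r -> differentiable G t /\ 'D_1 G t = g t.
Proof.
move=> cg; pose F x : R := (\int[lebesgue_measure]_(t in [set` `[c - r, x]]) g t)%R.
exists (fun x => F x - F c); split=> [|t tcr]; first by rewrite subrr.
have [||||dF DF] := @continuous_FTC1_closed R g (c - r) t (c + r).
- by rewrite -ltrBlDl; apply: le_lt_trans tcr; rewrite ler_norm.
- apply: continuous_compact_integrable; first exact: segment_compact.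
  exact: continuous_subspaceT.
- by rewrite ltrBlDr -ltrBlDl; apply: le_lt_trans tcr; rewrite distrC ler_norm.
- exact: cg.
have {}dF : differentiable F t by apply/derivable1_diffP.
split; first exact: (differentiableB (f := F) (g := cst (F c))).
rewrite (deriveB (f := F) (g := cst (F c))); [|exact: diff_derivable|exact: derivable_cst].
by rewrite derive_cst subr0 -DF derive1E.
Qed.

Lemma differentiable_rV (n : nat) (f : R -> 'rV[R]_n) (x : R) :
  (forall i, differentiable (fun y => f y 0 i) x) -> differentiable f x.
Proof.
move=> df; apply/derivable1_diffP/derivable_mxP => i j; rewrite ord1.
exact/diff_derivable.
Qed.

Lemma exists_primitive n (g : R -> 'rV[R]_n) (c r : R) : continuous g ->
  exists G : R -> 'rV[R]_n, G c = 0 /\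
    forall t, `|t - c| < r -> differentiable G t /\ 'D_1 G t = g t.
Proof.
move=> cg; have Hi i : exists G : R -> R, G c = 0 /\
    forall t, `|t - c| < r -> differentiable G t /\ 'D_1 G t = g t 0 i.
  apply: (@exists_primitive_real (fun t => g t 0 i)) => t.
  by apply: (@continuous_comp _ _ _ g (fun x : 'rV_n => x 0 i)); [exact: cg|exact: coord_continuous].
have [G HG] := choice Hi; exists (fun t => \row_i G i t); split=> [|t tcr].
  by apply/rowP => i; rewrite !mxE; have [] := HG i.
have dG : differentiable (fun t => \row_i G i t) t.
  apply: differentiable_rV => // i; have [_ /(_ t tcr)[dGi _]] := HG i.
  by rewrite (_ : (fun y => _) = G i) //; apply/funext => y; rewrite mxE.
split=> //; apply/rowP => i; have [_ /(_ t tcr)[_ <-]] := HG i.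
rewrite -(derive_coord (1 : R) i dG); congr ('D_1 _ t).
by apply/funext => y; rewrite mxE.
Qed.

End Primitive.

(** * Retractions onto closed balls *)

Section Clamp.
Context {R : realType}.

(** For r >= 0, the nearest-point retraction of the line onto [a - r, a + r]. Precomposing with it
    makes local data global and keeps Lipschitz bounds. *)
Definition clampr (a r x : R) : R := Num.max (a - r) (Num.min x (a + r)).

Lemma clampr_id (a r x : R) : `|x - a| <= r -> clampr a r x = x.
Proof.
by rewrite ler_distl => /andP[h1 h2]; rewrite /clampr (min_idPl h2) (max_idPr h1).
Qed.

Lemma clampr_bound (a r x : R) : 0 <= r -> `|clampr a r x - a| <= r.
Proof.
move=> r0; rewrite ler_distl /clampr le_max lexx /= ge_max ge_min lexx orbT andbT.
lra.
Qed.

Lemma clampr_lip (a r x y : R) : `|clampr a r y - clampr a r x| <= `|y - x|.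
Proof.
rewrite /clampr; case: (leP x (a + r)) => h1; case: (leP y (a + r)) => h2;
  have [h3|h3] := leP (a - r) x; have [h4|h4] := leP (a - r) y;
  have [h5|h5] := leP (a - r) (a + r); rewrite ?subrr ?normr0 // ler_norml;
  case: (ler0P (y - x)) => h6; apply/andP; split; lra.
Qed.

(** Coordinatewise, because the closed balls of the maximum norm are cubes. *)
Definition clamp n (a : 'rV[R]_n) (r : R) (x : 'rV[R]_n) : 'rV[R]_n :=
  \row_i clampr (a 0 i) r (x 0 i).

Lemma clamp_id n (a : 'rV[R]_n) r x : `|x - a| <= r -> clamp a r x = x.
Proof.
move=> xr; apply/rowP => i; rewrite mxE clampr_id //; apply: le_trans xr.
by apply: le_trans (coord_le_norm _ i); rewrite !mxE.
Qed.

Lemma clamp_bound n (a : 'rV[R]_n) r x : 0 <= r -> `|clamp a r x - a| <= r.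
Proof. by move=> r0; apply: mx_norm_le => // i; rewrite !mxE clampr_bound. Qed.

Lemma clamp_lip n (a : 'rV[R]_n) r x y : `|clamp a r y - clamp a r x| <= `|y - x|.
Proof.
apply: mx_norm_le => // i; rewrite !mxE; apply: le_trans (clampr_lip _ _ _ _) _.
by apply: le_trans (coord_le_norm _ i); rewrite !mxE.
Qed.

Lemma lipschitz_continuous (V W : normedModType R) (f : V -> W) (L : R) : 0 < L ->
  (forall x y, `|f y - f x| <= L * `|y - x|) -> continuous f.
Proof.
move=> L0 H x; apply/cvgrPdist_le => e e0; near=> y.
rewrite distrC; apply: le_trans (H x y) _; rewrite mulrC -ler_pdivlMr // distrC.
by near: y; apply: cvgr_dist_le; [exact: cvg_id|exact: divr_gt0].
Unshelve. all: by end_near. Qed.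

End Clamp.

(** Lets row vectors serve as the complete target space of [uniform_fixpoint]. *)
HB.instance Definition _ (R : realType) m n :=
  Uniform_isComplete.Build 'M[R]_(m, n) (@cauchy_cvg 'M[R]_(m, n)).

(** * Existence of integral curves *)

Section Picard.
Context {R : realType}.

Lemma mvt_real0 n (f : R -> 'rV[R]_n) (s C : R) : f 0 = 0 ->
  (forall t : R, `|t| <= `|s| -> differentiable f t /\ `|'D_1 f t| <= C) ->
  `|f s| <= C * `|s|.
Proof.
move=> f0 H; have := @mvt_real R n f 0 s 0 C; rewrite f0 scaler0 !subr0; apply => t.
by rewrite !subr0; apply: H.
Qed.

Lemma picard n (U : set 'rV[R]_n) (X : 'rV[R]_n -> 'rV[R]_n) x0 :
  open U -> U x0 -> Ck 1 U X ->
  exists r (c : R -> 'rV[R]_n), [/\ 0 < r, c 0 = x0 &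
    forall t, `|t| < r -> [/\ U (c t), differentiable c t & 'D_1 c t = X (c t)]].
Proof.
move=> oU Ux0 CX.
have [rho2 [L [rho20 L0 rhoU HL]]] := locally_lipschitz (frame_rV n) oU Ux0 CX.
pose rho := rho2 / 2.
have rho0 : 0 < rho by rewrite divr_gt0.
have rho_lt : rho < rho2 by rewrite /rho ltr_pdivrMr // ltr_pMr // ltr1n.
(* Clamping makes the field globally Lipschitz and bounded. *)
pose P := clamp x0 rho.
have Pb x : `|P x - x0| < rho2 by apply: le_lt_trans rho_lt; apply: clamp_bound; apply: ltW.
pose Y x := X (P x).
have Ylip x y : `|Y y - Y x| <= L * `|y - x|.
  by apply: le_trans (HL _ _ (Pb x) (Pb y)) _; rewrite ler_pM2l // clamp_lip.
have cY : continuous Y := lipschitz_continuous L0 Ylip.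
(* A bound for the clamped field, made positive by the 1 since [rho] is divided by it. *)
pose B := `|X x0| + L * rho + 1.
have B0 : 0 < B by rewrite ltr_wpDl // addr_ge0 // mulr_ge0 // ltW.
have Yb x : `|Y x| <= B.
  rewrite -[Y x](subrK (X x0)); apply: le_trans (ler_normD _ _) _.
  rewrite addrC /B -addrA lerD2l; apply: ler_wpDr; first exact: ler01.
  have -> : X x0 = Y x0 by rewrite /Y /P clamp_id // subrr normr0 ltW.
  rewrite /Y; have := HL _ _ (Pb x0) (Pb x); rewrite {3 4}/P => H; apply: le_trans H _.
  rewrite ler_pM2l // [clamp x0 rho x0]clamp_id ?subrr ?normr0 ?(ltW rho0) //.
  by apply: clamp_bound; apply: ltW.
(* Up to time rho / B a curve of speed at most [B] stays within [rho] of [x0]; up to time 1 / (2 L)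
   the integral operator contracts by 1/2. *)
pose r := Num.min (rho / B) ((2 * L)^-1).
have r0 : 0 < r by rewrite lt_min divr_gt0 //= invr_gt0 mulr_gt0.
have rB : r * B <= rho by rewrite -ler_pdivlMr // ge_min lexx.
have rL : L * r <= 2^-1.
  by rewrite mulrC -ler_pdivlMr // -invfM ge_min lexx orbT.
have r_lt : r < r + 1 by rewrite ltrDl.
(* [Prim] has to be a total function of the integrand: for a discontinuous one the condition is
   void. The radius r + 1 keeps the closed interval of radius [r] inside the open one where the
   primitive is differentiable. *)
pose isPrim (g G : R -> 'rV[R]_n) := continuous g -> G 0 = 0 /\ forall t : R, `|t - 0| < r + 1 ->
  differentiable G t /\ 'D_1 G t = g t.
have exPrim g : exists G, isPrim g G.
  have [cg|ncg] := pselect (continuous g); last by exists g.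
  by have [G HG] := exists_primitive 0 (r + 1) cg; exists G.
pose Prim g := sval (cid (exPrim g)).
have HPrim g : isPrim g (Prim g) := svalP (cid (exPrim g)).
(* Likewise for the time parameter, so that [T] acts on curves defined on R. *)
pose tau := clampr 0 r.
have taub t : `|tau t| <= r by rewrite -[tau t]subr0 clampr_bound // ltW.
pose T (d : R -> 'rV[R]_n) (t : R) := x0 + Prim (Y \o d) (tau t).
have cYd (d : R -> 'rV[R]_n) : continuous d -> continuous (Y \o d).
  by move=> cd t; apply: continuous_comp; [apply: cd|apply: cY].
have key (d : R -> 'rV[R]_n) (s : R) : continuous d -> `|s| <= r -> [/\ Prim (Y \o d) 0 = 0,
    differentiable (Prim (Y \o d)) s & 'D_1 (Prim (Y \o d)) s = Y (d s)].
  move=> cd sr; have [P0 /(_ s) HP] := HPrim _ (cYd _ cd).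
  by have [|? ?] := HP; rewrite ?subr0 ?(le_lt_trans sr).
have bnd (d : R -> 'rV[R]_n) (s : R) : continuous d -> `|s| <= r -> `|Prim (Y \o d) s| <= rho.
  move=> cd sr; have [P0 _ _] := key d s cd sr.
  apply: le_trans (mvt_real0 (C := B) P0 _) _.
    by move=> t ts; have [_ dt ->] := key d t cd (le_trans ts sr).
  by apply: le_trans rB; rewrite mulrC ler_wpM2r // ltW.
have [||t|d d' C cd cd' dC t|d Hd|d cd Hd] := @uniform_fixpoint R R 'rV[R]_n
  [set d | continuous d] T (fun=> x0) rho.
- by move=> t; apply: cvg_cst.
- move=> d /= cd t; apply: cvgD; first exact: cvg_cst.
  apply: (@continuous_comp _ _ _ tau (Prim (Y \o d))).
    apply: (@lipschitz_continuous R R R tau 1) => // x y; rewrite mul1r; exact: clampr_lip.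
  by apply: differentiable_continuous; have [] := key d (tau t) cd (taub t).
- by rewrite /T addrC addKr bnd // => x; apply: cvg_cst.
- rewrite /T opprD addrACA subrr add0r.
  have C0 : 0 <= C := le_trans (normr_ge0 _) (dC 0).
  have [d0 _ _] := key d (tau t) cd (taub t).
  have [d'0 _ _] := key d' (tau t) cd' (taub t).
  have D0 : (Prim (Y \o d') \- Prim (Y \o d)) 0 = 0 by rewrite /= d0 d'0 subrr.
  apply: le_trans (mvt_real0 (C := L * C) D0 _) _.
    move=> s ts.
    have [_ ds Ds] := key d s cd (le_trans ts (taub t)).
    have [_ ds' Ds'] := key d' s cd' (le_trans ts (taub t)).
    split; first exact: differentiableB.
    have -> : 'D_1 (Prim (Y \o d') \- Prim (Y \o d)) s = Y (d' s) - Y (d s).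
      by rewrite -Ds -Ds'; apply: deriveB; exact: diff_derivable.
    by apply: le_trans (Ylip _ _) _; rewrite ler_pM2l.
  rewrite mulrAC [leRHS]mulrC; apply: ler_wpM2r => //.
  by apply: le_trans rL; rewrite ler_pM2l.
- move=> t; apply/cvgrPdist_le => e e0.
  have [d' cd' Hd'] := Hd (e / 3) (divr_gt0 e0 (ltr0n _ 3)).
  near=> s; rewrite -(subrKA (d' t)) -(subrKA (d' s) (d' t)).
  apply: le_trans (ler_normD _ _) _; apply: le_trans (lerD (lexx _) (ler_normD _ _)) _.
  have -> : e = e / 3 + (e / 3 + e / 3) by lra.
  apply: lerD; first by rewrite distrC.
  apply: lerD; last exact: Hd'.
  by near: s; apply: cvgr_dist_le; [exact: cd'|exact: divr_gt0].
exists r, d; split=> // [|t tr].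
  rewrite -Hd /T /tau clampr_id ?subrr ?normr0 ?(ltW r0) //.
  by have [|-> _ _] := key d 0 cd; rewrite ?addr0 // normr0 ltW.
have trle := ltW tr.
have [_ dt Dt] := key d t cd trle.
have dE s : `|s| <= r -> d s = x0 + Prim (Y \o d) s.
  by move=> sr; rewrite -Hd /T /tau clampr_id ?subr0.
have near_dE : \near t, x0 + Prim (Y \o d) t = d t.
  near=> s; rewrite dE //; near: s; apply: cvgr_le; last exact: tr.
  by apply: cvg_norm; exact: cvg_id.
have db : `|d t - x0| <= rho by rewrite dE // addrC addKr bnd.
split; first by apply: rhoU; apply: le_lt_trans rho_lt.
  by apply: differentiable_near near_dE _; apply: differentiableD.
rewrite -(near_eq_derive _ near_dE) deriveD //; last exact: diff_derivable.
by rewrite derive_cst add0r Dt /Y /P clamp_id.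
Unshelve. all: by end_near. Qed.

End Picard.

(** * Partial derivatives in the plane *)

Section Plane.
Context {R : realType}.
Local Notation e2 := (@basis2 R).

Lemma sum2 (W : zmodType) (F : 'I_2 -> W) : \sum_i F i = F 0 + F 1.
Proof. by rewrite big_ord_recl big_ord1; congr (_ + F _); apply: val_inj. Qed.

Definition mk2 (s t : R) : 'rV[R]_2 := s *: e2 0 + t *: e2 1.

Lemma mk2_0 s t : mk2 s t 0 0 = s.
Proof. by rewrite !mxE /= mulr1 mulr0 addr0. Qed.

Lemma mk2_1 s t : mk2 s t 0 1 = t.
Proof. by rewrite !mxE /= mulr1 mulr0 add0r. Qed.

Lemma mk2K (x : 'rV[R]_2) : mk2 (x 0 0) (x 0 1) = x.
Proof. by rewrite {3}[x]row_sum_delta sum2. Qed.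

Lemma mk2B s t (x : 'rV[R]_2) r :
  `|s - x 0 0| <= r -> `|t - x 0 1| <= r -> `|mk2 s t - x| <= r.
Proof.
move=> sr tr; apply: mx_norm_le => [|i]; first exact: le_trans sr.
rewrite mxE [(- x) 0 i]mxE; have [->|->] : i = 0 \/ i = 1.
- by case: i => -[|[|//]] ?; [left|right]; apply: val_inj.
- by rewrite mk2_0.
- by rewrite mk2_1.
Qed.

Lemma derive_mk2_0 (W : normedModType R) (f : 'rV[R]_2 -> W) s t :
  differentiable f (mk2 s t) -> differentiable (fun s => f (mk2 s t)) s /\
  'D_1 (fun s => f (mk2 s t)) s = 'D_(e2 0) f (mk2 s t).
Proof.
have -> : (fun s => f (mk2 s t)) = (fun s => f (t *: e2 1 + s *: e2 0)).
  by apply/funext => s'; rewrite /mk2 addrC.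
by rewrite /mk2 addrC => /derive_line.
Qed.

Lemma derive_mk2_1 (W : normedModType R) (f : 'rV[R]_2 -> W) s t :
  differentiable f (mk2 s t) -> differentiable (fun t => f (mk2 s t)) t /\
  'D_1 (fun t => f (mk2 s t)) t = 'D_(e2 1) f (mk2 s t).
Proof. exact: derive_line. Qed.

Lemma mvt_realR (f : R -> R) (a b m C : R) :
  (forall t : R, `|t - a| <= `|b - a| -> differentiable f t /\ `|'D_1 f t - m| <= C) ->
  `|f b - f a - (b - a) * m| <= C * `|b - a|.
Proof.
(* Multiplying by a row vector of norm 1 turns the scalar function into a vector-valued one without
   changing norms. *)
move=> H; pose d : 'rV[R]_1 := const_mx 1.
have d1 : `|d| = 1.
  apply/eqP; rewrite eq_le; apply/andP; split.
    by apply: mx_norm_le => // i; rewrite mxE normr1.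
  by have := coord_le_norm d 0; rewrite mxE normr1.
have := @mvt_real R 1 (fun t => f t *: d) a b (m *: d) C.
rewrite scalerA -!scalerBl normrZ d1 mulr1; apply => t /H[dt Dt].
have dd : differentiable (fun t => f t *: d) t by apply: differentiableZl.
split=> //; rewrite deriveE // diffZl // -deriveE // -scalerBl normrZ d1 mulr1 //.
Qed.

Lemma dotp_continuous N (a : 'rV[R]_N) : continuous (dotp a).
Proof.
move=> y; apply: (@Ck_dotp R 'rV[R]_N N 0 setT (cst a) id openT) => //; first exact: Ck_cst.
by move=> z _; apply: cvg_id.
Qed.

(** The increment from [x] to [y] is split at the corner with the first coordinate of [x] and the
    second of [y]. On each leg the mean value theorem compares it with [w x], up to the oscillation
    of [w], which is small by continuity. *)
Lemma differentiable_partials (u : 'rV[R]_2 -> R) (w : 'rV[R]_2 -> 'rV[R]_2)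
    (x : 'rV[R]_2) (r : R) :
  0 < r ->
  (forall y : 'rV[R]_2, `|y - x| < r -> [/\ differentiable (fun s => u (mk2 s (y 0 1))) (y 0 0),
     'D_1 (fun s => u (mk2 s (y 0 1))) (y 0 0) = w y 0 0,
     differentiable (fun t => u (mk2 (y 0 0) t)) (y 0 1) &
     'D_1 (fun t => u (mk2 (y 0 0) t)) (y 0 1) = w y 0 1]) ->
  {for x, continuous w} ->
  differentiable u x /\ forall v, 'D_v u x = dotp (w x) v.
Proof.
move=> r0 H cw.
have lin : linear (dotp (w x)) by move=> a y z; rewrite linearPr.
pose L : {linear 'rV[R]_2 -> R} := HB.pack (dotp (w x)) (GRing.isLinear.Build _ _ _ _ _ lin).
have cL : continuous L by apply: dotp_continuous.
have [|du Du] := @differentiable_of_eps R _ _ u x L cL; last first.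
  by split=> // v; rewrite deriveE // Du.
move=> e e0; have e20 : 0 < e / 2 by rewrite divr_gt0.
have [d /= d0 Hd] : exists2 d, 0 < d & forall y, `|y - x| < d -> `|w y - w x| <= e / 2.
  have /cvgrPdist_le /(_ _ e20) /nbhs_normP[d /= d0 Hd] := cw.
  by exists d => // y yd; rewrite distrC; apply: Hd; rewrite /= distrC.
near=> y.
have yd : `|y - x| < d by rewrite distrC; near: y; apply: cvgr_dist_lt d0; exact: cvg_id.
have yr : `|y - x| < r by rewrite distrC; near: y; apply: cvgr_dist_lt r0; exact: cvg_id.
have c0 : `|y 0 0 - x 0 0| <= `|y - x| by apply: le_trans (coord_le_norm _ 0); rewrite !mxE.
have c1 : `|y 0 1 - x 0 1| <= `|y - x| by apply: le_trans (coord_le_norm _ 1); rewrite !mxE.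
have H0 := @mvt_realR (fun s => u (mk2 s (y 0 1))) (x 0 0) (y 0 0) (w x 0 0) (e / 2).
have H1 := @mvt_realR (fun t => u (mk2 (x 0 0) t)) (x 0 1) (y 0 1) (w x 0 1) (e / 2).
have -> : u y - u x - L (y - x) =
    (u (mk2 (y 0 0) (y 0 1)) - u (mk2 (x 0 0) (y 0 1)) - (y 0 0 - x 0 0) * w x 0 0) +
    (u (mk2 (x 0 0) (y 0 1)) - u (mk2 (x 0 0) (x 0 1)) - (y 0 1 - x 0 1) * w x 0 1).
  by rewrite !mk2K /L /= dotpE sum2 !mxE; ring.
apply: le_trans (ler_normD _ _) _.
have -> : e * `|y - x| = e / 2 * `|y - x| + e / 2 * `|y - x| by field.
apply: lerD.
- apply: le_trans (H0 _) _; last by rewrite ler_pM2l.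
  move=> s sy; pose z := mk2 s (y 0 1).
  have zx : `|z - x| <= `|y - x| by apply: mk2B => //; apply: le_trans c0.
  have [] := H z (le_lt_trans zx yr); rewrite /z mk2_0 mk2_1 => dz -> _ _; split=> //.
  apply: le_trans (Hd z (le_lt_trans zx yd)).
  by apply: le_trans (coord_le_norm _ 0); rewrite !mxE.
- apply: le_trans (H1 _) _; last by rewrite ler_pM2l.
  move=> s sy; pose z := mk2 (x 0 0) s.
  have zx : `|z - x| <= `|y - x|.
    by apply: mk2B => //; [rewrite subrr normr0|apply: le_trans c1].
  have [] := H z (le_lt_trans zx yr); rewrite /z mk2_0 mk2_1 => _ _ dz ->; split=> //.
  apply: le_trans (Hd z (le_lt_trans zx yd)).
  by apply: le_trans (coord_le_norm _ 1); rewrite !mxE.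
Unshelve. all: by end_near. Qed.

End Plane.

(** * Primitives of closed 1-forms in the plane *)

Section Poincare.
Context {R : realType}.
Local Notation e2 := (@basis2 R).

Lemma derive_of_eps (W : normedModType R) (f : R -> W) (t : R) (m : W) :
  (forall e, 0 < e -> \forall s \near t, `|f s - f t - (s - t) *: m| <= e * `|s - t|) ->
  differentiable f t /\ 'D_1 f t = m.
Proof.
have lin : linear ( *:%R^~ m : R -> W) by move=> a x y; rewrite scalerDl scalerA.
pose L : {linear R -> W} := HB.pack ( *:%R^~ m : R -> W) (GRing.isLinear.Build _ _ _ _ _ lin).
have cL : continuous L by apply: scalel_continuous.
move=> H; have [df Df] := differentiable_of_eps cL H.
by split=> //; rewrite deriveE // Df /L /= scale1r.
Qed.

(** C^2 regularity makes the partial derivatives of [w] Lipschitz near [x0], which gives the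
    quadratic error bound used to differentiate an integral in its parameter. *)
Lemma poincare (U : set 'rV[R]_2) (w : 'rV[R]_2 -> 'rV[R]_2) (x0 : 'rV[R]_2) :
  open U -> U x0 -> Ck 2 U w ->
  (forall x, U x -> 'D_(e2 0) w x 0 1 = 'D_(e2 1) w x 0 0) ->
  exists2 r, 0 < r & exists u : 'rV[R]_2 -> R, forall x, `|x - x0| < r ->
    [/\ U x, differentiable u x & forall v, 'D_v u x = dotp (w x) v].
Proof.
move=> oU Ux0 Cw closed_w; have [dw Dw] := Cw.
have [r2 [L [r20 L0 rU HL]]] := locally_lipschitz (frame_rV 2) oU Ux0 (Dw (e2 1)).
pose r := r2 / 2.
have r0 : 0 < r by rewrite divr_gt0.
have r_lt : r < r2 by rewrite /r ltr_pdivrMr // ltr_pMr // ltr1n.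
have clU x : U (clamp x0 r x).
  by apply: rU; apply: le_lt_trans r_lt; apply: clamp_bound; apply: ltW.
pose W x := w (clamp x0 r x).
have WE x : `|x - x0| <= r -> W x = w x by move=> xr; rewrite /W clamp_id.
have cW : continuous W.
  move=> x; apply: (@continuous_comp _ _ _ (clamp x0 r) w); last first.
    by apply: differentiable_continuous; apply: dw.
  apply: (@lipschitz_continuous R _ _ (clamp x0 r) 1) => // y z.
  by rewrite mul1r clamp_lip.
have cWc i (h : R -> 'rV[R]_2) : continuous h -> continuous (fun t => W (h t) 0 i).
  move=> ch t; apply: (@continuous_comp _ _ _ (W \o h) (fun x : 'rV_2 => x 0 i)).
    by apply: continuous_comp; [apply: ch|apply: cW].
  exact: coord_continuous.
have cm0 (t : R) : continuous (fun s => mk2 s t).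
  move=> s; apply: differentiable_continuous.
  by have [] := derive_mk2_0 (f := id) (s := s) (t := t).
have cm1 (s : R) : continuous (fun t => mk2 s t).
  move=> t; apply: differentiable_continuous.
  by have [] := derive_mk2_1 (f := id) (s := s) (t := t).
(* For each height [t] a primitive along the horizontal line is chosen separately. Its dependence on
   [t] is established by [dA1] below. *)
have exA (t : R) := exists_primitive_real (x0 0 0) r2 (cWc 0 _ (cm0 t)).
pose A t := sval (cid (exA t)).
have [A0 HA] : (forall t, A t (x0 0 0) = 0) /\ forall t s : R, `|s - x0 0 0| < r2 ->
    differentiable (A t) s /\ 'D_1 (A t) s = W (mk2 s t) 0 0.
  by split=> t; rewrite /A; case: cid => G /= [? ?].
have [B [B0 HB]] := exists_primitive_real (x0 0 1) r2 (cWc 1 _ (cm1 (x0 0 0))).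
(* Integrate along the second axis, then along the first. *)
pose u (x : 'rV[R]_2) := A (x 0 1) (x 0 0) + B (x 0 1).
exists r => //; exists u => x xr.
have xr2 : `|x - x0| < r2 := lt_trans xr r_lt.
have nearW (z : 'rV[R]_2) : `|z - x0| < r -> \near z, w z = W z.
  move=> zr; near=> z'; rewrite WE //; apply/ltW; near: z'.
  by apply: cvgr_lt; last exact: zr; apply: cvg_norm; apply: cvgB; [exact: cvg_id|exact: cvg_cst].
have Wd (z : 'rV[R]_2) : `|z - x0| < r -> differentiable W z /\ forall v, 'D_v W z = 'D_v w z.
  move=> zr; split; first by apply: differentiable_near (nearW z zr) _; apply/dw/rU/(lt_trans zr).
  by move=> v; rewrite (near_eq_derive v (nearW z zr)).
have [du Du] : differentiable u x /\ forall v, 'D_v u x = dotp (W x) v; last first.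
  by split=> // [|v]; [exact: rU|rewrite Du WE // ltW].
apply: (@differentiable_partials R u W x (r - `|x - x0|)); [by rewrite subr_gt0| |exact: cW].
move=> y yx; have yr : `|y - x0| < r.
  by rewrite -(subrKA x); apply: le_lt_trans (ler_normD _ _) _; rewrite -ltrBrDr.
have yr2 : `|y - x0| < r2 := lt_trans yr r_lt.
have y0 : `|y 0 0 - x0 0 0| < r2.
  by apply: le_lt_trans yr2; apply: le_trans (coord_le_norm _ 0); rewrite !mxE.
have y1 : `|y 0 1 - x0 0 1| < r2.
  by apply: le_lt_trans yr2; apply: le_trans (coord_le_norm _ 1); rewrite !mxE.
have [dA DA] := HA (y 0 1) _ y0; have [dB DB] := HB _ y1.
rewrite mk2K in DA.
have -> : (fun s => u (mk2 s (y 0 1))) = (A (y 0 1) \+ cst (B (y 0 1))).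
  by apply/funext => s; rewrite /u mk2_0 mk2_1.
have -> : (fun t => u (mk2 (y 0 0) t)) = ((fun t => A t (y 0 0)) \+ B).
  by apply/funext => s; rewrite /u mk2_0 mk2_1.
have xin (s t : R) : `|s - x0 0 0| <= `|y 0 0 - x0 0 0| -> `|t - x0 0 1| < r ->
    `|mk2 s t - x0| < r.
  move=> sy tr; apply: le_lt_trans (_ : Num.max `|y - x0| `|t - x0 0 1| < r).
    apply: mk2B; rewrite le_max ?lexx ?orbT //.
    by rewrite (le_trans sy) //; apply: le_trans (coord_le_norm _ 0); rewrite !mxE.
  by rewrite gt_max yr.
(* The value predicted by closedness: the derivative in [t] of the integral of w_0 is the integral
   of the s-derivative of w_1, a difference of end values. *)
pose m := W y 0 1 - W (mk2 (x0 0 0) (y 0 1)) 0 1.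
have [dA1 DA1] : differentiable (fun t => A t (y 0 0)) (y 0 1) /\
    'D_1 (fun t => A t (y 0 0)) (y 0 1) = m.
  apply: derive_of_eps => e e0.
  have y1r : `|y 0 1 - x0 0 1| < r.
    by apply: le_lt_trans yr; apply: le_trans (coord_le_norm _ 1); rewrite !mxE.
  have y0r : `|y 0 0 - x0 0 0| < r.
    by apply: le_lt_trans yr; apply: le_trans (coord_le_norm _ 0); rewrite !mxE.
  have e1 : 0 < r - `|y 0 1 - x0 0 1| by rewrite subr_gt0.
  (* Chosen so that L * (e / (L * r)) * r = e in the final estimate. *)
  have e2' : 0 < e / (L * r) by rewrite divr_gt0 // mulr_gt0.
  near=> t.
  have t2 : `|t - y 0 1| < r - `|y 0 1 - x0 0 1|.
    by rewrite distrC; near: t; apply: cvgr_dist_lt e1; exact: cvg_id.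
  have t1 : `|t - x0 0 1| < r.
    by rewrite -(subrKA (y 0 1)); apply: le_lt_trans (ler_normD _ _) _; rewrite -ltrBrDr.
  have te : `|t - y 0 1| <= e / (L * r).
    by rewrite distrC; near: t; apply: cvgr_dist_le e2'; exact: cvg_id.
  (* The error of the linear approximation as a function of the endpoint [s]. Its s-derivative is
     the first-order Taylor remainder of w_0 in [t], at most L |t - y_1|^2. *)
  pose Q (s : R) : R := A t s - A (y 0 1) s - (t - y 0 1) * W (mk2 s (y 0 1)) 0 1.
  have := @mvt_realR R Q (x0 0 0) (y 0 0) 0 (L * `|t - y 0 1| * `|t - y 0 1|).
  rewrite mulr0 subr0 => HQ.
  have -> : A t (y 0 0) - A (y 0 1) (y 0 0) - (t - y 0 1) *: m = Q (y 0 0) - Q (x0 0 0).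
    by rewrite /Q !A0 mk2K /m /GRing.scale /=; ring.
  apply: le_trans (HQ _) _; last first.
    rewrite mulrAC; apply: ler_wpM2r => //.
    have -> : e = L * (e / (L * r)) * r by field; rewrite !gt_eqF.
    by apply: ler_pM; rewrite ?mulr_ge0 ?(ltW L0) ?(ltW y0r) // ler_pM2l.
  move=> s sy.
  have s2 : `|s - x0 0 0| < r2 by apply: le_lt_trans sy _.
  have [dAt DAt] := HA t s s2; have [dAy DAy] := HA (y 0 1) s s2.
  have zr := xin s (y 0 1) sy y1r; set z := mk2 s (y 0 1) in zr *.
  have [dWz DWz] := Wd z zr.
  have [dWs DWs] := derive_mk2_0 dWz.
  have dWs1 := differentiable_rcoord 1 dWs.
  have DWs1 := derive_coord (1 : R) 1 dWs.
  rewrite DWs DWz closed_w in DWs1; last by apply/rU/(lt_trans zr).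
  have dQ1 : differentiable (A t \- A (y 0 1)) s by apply: differentiableB.
  have dQ2 : differentiable (fun s => (t - y 0 1) *: W (mk2 s (y 0 1)) 0 1) s.
    exact: differentiableZ.
  split; first exact: (differentiableB dQ1 dQ2).
  have -> : 'D_1 Q s = W (mk2 s t) 0 0 - W z 0 0 - (t - y 0 1) * 'D_(e2 1) w z 0 0.
    rewrite (deriveB (f := A t \- A (y 0 1)) (diff_derivable dQ1) (diff_derivable dQ2)).
    rewrite (deriveB (diff_derivable dAt) (diff_derivable dAy)) DAt DAy.
    by rewrite (deriveZ (t - y 0 1) (diff_derivable dWs1)) DWs1.
  rewrite subr0 !WE ?(ltW zr) //; last exact/ltW/xin.
  apply: (@mvt_realR R (fun t => w (mk2 s t) 0 0)) => q qt.
  have q1 : `|q - x0 0 1| < r.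
    rewrite -(subrKA (y 0 1)); apply: le_lt_trans (ler_normD _ _) _.
    by rewrite -ltrBrDr; apply: le_lt_trans qt _.
  have qr := xin s q sy q1.
  have [dws Dws] := derive_mk2_1 (dw _ (rU _ (lt_trans qr r_lt))).
  split; first exact: differentiable_rcoord.
  rewrite (derive_coord (1 : R) 0 dws) Dws.
  apply: (@le_trans _ _ `|'D_(e2 1) w (mk2 s q) - 'D_(e2 1) w z|).
    by apply: le_trans (coord_le_norm _ 0); rewrite !mxE.
  apply: le_trans (HL _ _ (lt_trans zr r_lt) (lt_trans qr r_lt)) _.
  rewrite ler_pM2l //; apply: mk2B; rewrite ?mk2_0 ?mk2_1 ?subrr ?normr0 //.
split.
- exact: (differentiableD (f := A (y 0 1)) (g := cst (B (y 0 1)))).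
- rewrite (deriveD (f := A (y 0 1)) (g := cst (B (y 0 1))));
    [|exact: diff_derivable|exact: derivable_cst].
  by rewrite derive_cst addr0.
- exact: (differentiableD (f := fun t => A t (y 0 0)) (g := B)).
- rewrite (deriveD (f := fun t => A t (y 0 0)) (g := B)); [|exact: diff_derivable|exact: diff_derivable].
  by rewrite DA1 DB /m subrK.
Unshelve. all: by end_near. Qed.

End Poincare.

(** * Coordinates with prescribed behaviour along two fields *)

Section FrameCoordinates.
Context {R : realType}.

Lemma span2 (X Y : 'rV[R]_2) :
  (forall a b, a *: X + b *: Y = 0 -> a = 0 /\ b = 0) ->
  forall Z, exists a b, Z = a *: X + b *: Y.
Proof.
move=> ind Z; pose M : 'M[R]_2 := \matrix_(i < 2) (if i == 0 then X else Y).
have mulM (c : 'rV[R]_2) : c *m M = c 0 0 *: X + c 0 1 *: Y.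
  by rewrite mulmx_sum_row sum2 !rowK.
have uM : M \in unitmx.
  rewrite -row_free_unit -kermx_eq0; apply/eqP/row_matrixP => i; rewrite row0.
  have /sub_kermxP := row_sub i (kermx M); set c := row i _; rewrite mulM => /ind[c0 c1].
  apply/rowP => j; rewrite [RHS]mxE; have [->|->] // : j = 0 \/ j = 1.
  by case: j => -[|[|//]] ?; [left|right]; apply: val_inj.
exists ((Z *m invmx M) 0 0), ((Z *m invmx M) 0 1).
by rewrite -mulM mulmxKV.
Qed.

Lemma Ck_pair (V : normedModType R) k (U : set V) (f : V -> R) (g : V -> R) :
  open U -> Ck k U f -> Ck k U g -> Ck k U (fun x => (f x, g x)).
Proof.
move=> oU Cf Cg.
apply: (Ck_ext (f := (fun x => f x *: ((1, 0) : R * R)) \+ (fun x => g x *: ((0, 1) : R * R)))) => //.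
  move=> x _ /=; rewrite -[LHS]/(f x * 1 + g x * 0, f x * 0 + g x * 1).
  by rewrite !mulr0 !mulr1 addr0 add0r.
by apply: Ck_add => //; apply: Ck_scale => //; apply: Ck_cst.
Qed.

Lemma lin2B (a b c d m : R) (x y : 'rV[R]_2) :
  a *: x + (b / m) *: y - (c *: x + (d / m) *: y) = (a - c) *: x + ((b - d) / m) *: y.
Proof. by rewrite mulrBl !scalerBl addrACA -opprD. Qed.

Lemma near_norm_lt (V W : normedModType R) (f : V -> W) x a (e : R) :
  {for x, continuous f} -> `|f x - a| < e -> \forall y \near x, `|f y - a| < e.
Proof.
move=> cf; rewrite -subr_gt0 => h; have /cvgrPdist_lt /(_ _ h) := cf.
apply: filterS => y hy; rewrite -(subrKA (f x)); apply: le_lt_trans (ler_normD _ _) _.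
by rewrite -ltrBrDr distrC.
Qed.

Lemma open_absball (a r : R) : open [set u : R | `|u - a| < r].
Proof.
rewrite openE => x /= xr; exact: (near_norm_lt (f := id) cvg_id xr).
Qed.

Lemma open_absball2 (a b r : R) : open [set z : R * R | `|z.1 - a| < r /\ `|z.2 - b| < r].
Proof.
rewrite openE => z /= [z1 z2]; apply: filterI.
  exact: (near_norm_lt (@fst_continuous R R R z) z1).
exact: (near_norm_lt (@snd_continuous R R R z) z2).
Qed.

Lemma interval_absball (a r : R) : is_interval [set u : R | `|u - a| < r].
Proof.
move=> x y /=; rewrite !ltr_distl => /andP[x1 x2] /andP[y1 y2] z /andP[xz zy] /=.
by rewrite ltr_distl (lt_le_trans x1 xz) (le_lt_trans zy y2).
Qed.

Lemma derive_scaler (V W : normedModType R) (a : V -> R) (w : W) x Z :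
  differentiable a x -> 'D_Z (fun y => a y *: w) x = 'D_Z a x *: w.
Proof.
by move=> da; rewrite deriveE ?diffZl //; [rewrite -deriveE|exact: differentiableZl].
Qed.

Variables (U : set 'rV[R]_2) (X Y : 'rV[R]_2 -> 'rV[R]_2) (u v mu : 'rV[R]_2 -> R).
Variable x0 : 'rV[R]_2.
Hypotheses (oU : open U) (Ux0 : U x0) (sX : smooth_on U X) (sY : smooth_on U Y).
Hypotheses (su : smooth_on U u) (sv : smooth_on U v) (smu : smooth_on U mu).
Hypothesis mu0 : forall x, U x -> mu x != 0.
Hypothesis Xu : forall x, U x -> 'D_(X x) u x = 1.
Hypothesis Yu : forall x, U x -> 'D_(Y x) u x = 0.
Hypothesis Xv : forall x, U x -> 'D_(X x) v x = 0.
Hypothesis Yv : forall x, U x -> 'D_(Y x) v x = mu x.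

Let du x : U x -> differentiable u x. Proof. by move=> Ux; apply: (su 1).1. Qed.
Let dv x : U x -> differentiable v x. Proof. by move=> Ux; apply: (sv 1).1. Qed.

Let Du x a b : U x -> 'D_(a *: X x + b *: Y x) u x = a.
Proof.
by move=> Ux; rewrite deriveDv ?deriveZv ?Xu ?Yu //; try exact: du; rewrite scaler0 addr0 [_ *: _]mulr1.
Qed.

Let Dv x a b : U x -> 'D_(a *: X x + b *: Y x) v x = b * mu x.
Proof.
by move=> Ux; rewrite deriveDv ?deriveZv ?Xv ?Yv //; try exact: dv; rewrite scaler0 add0r.
Qed.

(** Up to the factor [mu], the differentials of [u] and [v] are dual to [X] and [Y]; this also makes
    the two fields independent. *)
Let decomp x Z : U x -> Z = 'D_Z u x *: X x + ('D_Z v x / mu x) *: Y x.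
Proof.
move=> Ux; have [|a [b ->]] := @span2 (X x) (Y x) _ Z; last first.
  by rewrite Du // Dv // mulfK // mu0.
move=> a b ab; have := Du a b Ux; have := Dv a b Ux; rewrite ab !derive0 => /esym/eqP.
by rewrite mulf_eq0 (negbTE (mu0 Ux)) orbF => /eqP.
Qed.

(** The inverse function theorem for (u, v). Its differential sends X to (1, 0) and Y to (0, mu),
    hence the formula for the derivative of [psi]. *)
Lemma frame_coordinates : exists2 e, 0 < e & exists psi : R * R -> 'rV[R]_2,
  let O := [set z : R * R | `|z.1 - u x0| < e /\ `|z.2 - v x0| < e] in
  [/\ forall z, O z -> [/\ U (psi z), u (psi z) = z.1 & v (psi z) = z.2],
      psi (u x0, v x0) = x0,
      open (psi @` O),
      smooth_on O psi &
      forall z w, O z -> 'D_w psi z = w.1 *: X (psi z) + (w.2 / mu (psi z)) *: Y (psi z)].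
Proof.
(* [H] is (u, v) followed by the linear map making its differential at [x0] the
   identity. *)
pose La (z : R * R) := z.1 *: X x0 + (z.2 / mu x0) *: Y x0.
pose H x := La (u x, v x).
have sH k : Ck k U H.
  exact: (Ck_add oU (Ck_scale oU (su k) (Ck_cst k U (X x0)))
    (Ck_scale oU (Ck_mul oU (sv k) (Ck_cst k U (mu x0)^-1)) (Ck_cst k U (Y x0)))).
have DH Z : 'D_Z H x0 = Z.
  rewrite [RHS](decomp Z Ux0).
  have dvm : differentiable (fun x => v x / mu x0) x0 by apply: differentiableM; [exact: dv|].
  rewrite (deriveD (f := fun x => u x *: X x0) (g := fun x => (v x / mu x0) *: Y x0));
    [|exact/diff_derivable/differentiableZl/du|exact/diff_derivable/differentiableZl].
  rewrite (derive_scaler _ _ (du Ux0)) (derive_scaler _ _ dvm).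
  by congr (_ + _ *: _); rewrite (deriveMr _ (diff_derivable (dv Ux0))) mulrC.
have [r r0 [rU Hr]] := strict_diff (frame_rV 2) oU Ux0 (sH 1) (divr_gt0 ltr01 (ltr0n R 2)).
have {}Hr x y : `|x - x0| < r -> `|y - x0| < r -> `|H y - H x - (y - x)| <= 2^-1 * `|y - x|.
  by move=> xr yr; have := Hr x y xr yr; rewrite DH mul1r.
(* A lower bound for the expansion of [H]: it gives injectivity, and the Lipschitz bound for
   [psi]. *)
have lip x y : `|x - x0| < r -> `|y - x0| < r -> `|y - x| <= 2 * `|H y - H x|.
  move=> xr yr; have := Hr x y xr yr; have := ler_distD (H y - H x) (y - x) 0.
  rewrite !subr0 distrC; lra.
have LaP z z' : La z = La z' -> z = z'.
  move=> E; have {}E : (z.1 - z'.1) *: X x0 + ((z.2 - z'.2) / mu x0) *: Y x0 = 0.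
    by rewrite -lin2B -/(La z) -/(La z') E subrr.
  have := Du (z.1 - z'.1) ((z.2 - z'.2) / mu x0) Ux0.
  have := Dv (z.1 - z'.1) ((z.2 - z'.2) / mu x0) Ux0.
  rewrite E !derive0 divfK ?mu0 // => /esym/eqP; rewrite subr_eq0 => /eqP e2.
  move=> /esym/eqP; rewrite subr_eq0 => /eqP e1.
  by case: z z' e1 e2 {E} => [? ?] [? ?] /= -> ->.
pose K := `|X x0| + `|(mu x0)^-1| * `|Y x0| + 1.
have K0 : 0 < K by rewrite ltr_wpDl // addr_ge0 // mulr_ge0.
have LaK z z' c : `|z.1 - z'.1| <= c -> `|z.2 - z'.2| <= c -> `|La z - La z'| <= K * c.
  move=> h1 h2; have c0 : 0 <= c := le_trans (normr_ge0 _) h1.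
  have -> : La z - La z' = (z.1 - z'.1) *: X x0 + ((z.2 - z'.2) / mu x0) *: Y x0.
    exact: lin2B.
  apply: le_trans (ler_normD _ _) _.
  rewrite !normrZ /K mulrDl mul1r -[leLHS]addr0; apply: lerD => //.
  rewrite mulrDl; apply: lerD; first by rewrite mulrC ler_wpM2l.
  by rewrite -mulrA mulrC; apply: ler_wpM2l => //; rewrite mulr_ge0.
(* [La] moves points of the square of half-side [e] by at most K e = r / 4 from [H x0], within the
   radius r / 2 where [H x = w] is solvable. *)
pose e := r / 2 / (2 * K).
have e0 : 0 < e by rewrite !divr_gt0 // mulr_gt0.
have Ke : K * e < r / 2.
  have -> : K * e = r / 2 / 2 by rewrite /e; field; apply: lt0r_neq0.
  by rewrite ltr_pdivrMr // ltr_pMr ?ltr1n // divr_gt0.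
exists e => //.
pose O := [set z : R * R | `|z.1 - u x0| < e /\ `|z.2 - v x0| < e].
(* Off [O] the condition is void, so a single choice function is defined on the whole plane. *)
have expsi z : exists x, O z -> `|x - x0| < r /\ H x = La z.
  have [Oz|nOz] := pselect (O z); last by exists x0.
  have [|x xr Hx] := inverse_near_identity (w := La z) Hr; last by exists x.
  apply: le_lt_trans Ke; case: Oz => O1 O2.
  by apply: (@LaK z (u x0, v x0)) => /=; apply/ltW.
have [psi Hpsi] := choice expsi; exists psi => /=.
have psiF z : O z -> [/\ U (psi z), u (psi z) = z.1 & v (psi z) = z.2].
  move=> Oz; have [xr Hx] := Hpsi z Oz; split; first exact: rU.
    by have := LaP _ _ Hx => /(congr1 fst).
  by have := LaP _ _ Hx => /(congr1 snd).
have psiK x : `|x - x0| < r -> O (u x, v x) -> psi (u x, v x) = x.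
  move=> xr Ox; have [yr Hy] := Hpsi _ Ox; apply/eqP; rewrite -subr_eq0 -normr_le0.
  by apply: le_trans (lip _ _ xr yr) _; rewrite Hy /H subrr normr0 mulr0.
have oO : open O by exact: open_absball2.
have psi_lip z z' c : O z -> O z' -> `|z.1 - z'.1| <= c -> `|z.2 - z'.2| <= c ->
    `|psi z - psi z'| <= 2 * K * c.
  move=> Oz Oz' h1 h2; have [xr Hx] := Hpsi z Oz; have [xr' Hx'] := Hpsi z' Oz'.
  by apply: le_trans (lip _ _ xr' xr) _; rewrite Hx Hx' -mulrA ler_pM2l // LaK.
have dpsi z : O z -> differentiable psi z /\
    forall w, 'D_w psi z = w.1 *: X (psi z) + (w.2 / mu (psi z)) *: Y (psi z).
  move=> Oz; have [Ux ux vx] := psiF z Oz; set x := psi z in Ux ux vx *.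
  have lin : linear (fun w : R * R => w.1 *: X x + (w.2 / mu x) *: Y x).
    move=> a w w' /=; rewrite scalerDr !scalerA addrACA -!scalerDl mulrDl mulrA.
    by rewrite /GRing.scale.
  pose L : {linear (R * R)%type -> 'rV[R]_2} := HB.pack
    (fun w : R * R => w.1 *: X x + (w.2 / mu x) *: Y x) (GRing.isLinear.Build _ _ _ _ _ lin).
  have cL : continuous L.
    move=> w; apply: cvgD; apply: cvgZr_tmp; first exact: fst_continuous.
    by apply: cvgM; [exact: snd_continuous|exact: cvg_cst].
  suff [dp Dp] : differentiable psi z /\ 'd psi z = L :> (R * R -> _).
    by split=> // w; rewrite deriveE // Dp.
  apply: differentiable_of_eps => // c c0.
  pose C := `|X x| + `|(mu x)^-1| * `|Y x| + 1.
  have C0 : 0 < C by rewrite ltr_wpDl // addr_ge0 // mulr_ge0.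
  pose c' := c / (C * (2 * K)).
  have c'0 : 0 < c' by rewrite divr_gt0 // !mulr_gt0.
  have plip z' : O z' -> `|psi z' - x| <= 2 * K * `|z' - z|.
    by move=> Oz'; apply: psi_lip => //; rewrite [leRHS]prod_normE /= le_max lexx ?orbT.
  have nearO : \forall z' \near z, O z' by apply: open_nbhs_nbhs.
  have cpsi : psi y @[y --> z] --> x.
    apply/cvgrPdist_le => d d0; have d'0 : 0 < d / (2 * K) by rewrite divr_gt0 // mulr_gt0.
    have Nd : \forall z' \near z, `|z - z'| <= d / (2 * K).
      by have /cvgrPdist_le /(_ _ d'0) := @cvg_id _ (nbhs z).
    apply: filterS2 nearO Nd => z' Oz' Hd; rewrite distrC; apply: le_trans (plip z' Oz') _.
    by rewrite mulrC -ler_pdivlMr ?mulr_gt0 // distrC.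
  (* The expansions of [u] and [v] at [psi z], pulled back along [psi], which is already known to be
     continuous at [z]. *)
  have Nu : \forall z' \near z, `|u (psi z') - u x - 'd u x (psi z' - x)| <= c' * `|psi z' - x|.
    exact: cpsi _ (differentiable_eps (du Ux) c'0).
  have Nv : \forall z' \near z, `|v (psi z') - v x - 'd v x (psi z' - x)| <= c' * `|psi z' - x|.
    exact: cpsi _ (differentiable_eps (dv Ux) c'0).
  apply: filterS3 nearO Nu Nv => z' Oz' Hu Hv.
  have [_ ux' vx'] := psiF z' Oz'; rewrite ux' ux in Hu; rewrite vx' vx in Hv.
  (* In the frame, the error of [psi] has the remainders of [u] and [v] as coefficients, the second
     one divided by [mu x]. *)
  rewrite [X in X - L _](decomp (psi z' - x) Ux) !deriveE; [|exact: dv|exact: du].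
  have -> : 'd u x (psi z' - x) *: X x + ('d v x (psi z' - x) / mu x) *: Y x - L (z' - z) =
      ('d u x (psi z' - x) - (z'.1 - z.1)) *: X x + (('d v x (psi z' - x) - (z'.2 - z.2)) / mu x) *: Y x.
    exact: lin2B.
  apply: le_trans (ler_normD _ _) _; rewrite !normrZ.
  rewrite distrC in Hu; rewrite distrC in Hv.
  have step : c' * `|psi z' - x| * C <= c * `|z' - z|.
    have -> : c * `|z' - z| = c' * (2 * K * `|z' - z|) * C.
      by rewrite /c'; field; rewrite !gt_eqF.
    by rewrite ler_pM2r // ler_pM2l // plip.
  apply: le_trans step; rewrite /C !mulrDr mulr1 -[leLHS]addr0; apply: lerD; last first.
    by rewrite mulr_ge0 // ltW.
  apply: lerD; first by apply: ler_wpM2r.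
  by rewrite mulrA; apply: ler_wpM2r => //; apply: ler_wpM2r.
have Dpsi z w (Oz : O z) := (dpsi z Oz).2 w.
split=> //.
- by apply: psiK; rewrite ?subrr ?normr0 //; split; rewrite subrr normr0.
(* The image is cut out by strict inequalities between continuous functions, hence open. *)
- have -> : psi @` O = [set x | `|x - x0| < r /\ O (u x, v x)].
    apply/seteqP; split=> [_ [z Oz <-]|x [xr Ox]] /=; last by exists (u x, v x) => //; apply: psiK.
    have [xr _] := Hpsi z Oz; have [_ -> ->] := psiF z Oz; split=> //; exact: Oz.
  rewrite openE => x /= [xr [x1 x2]]; have Ux := rU _ xr.
  apply: filterI; first exact: (near_norm_lt (f := id) cvg_id xr).
  apply: filterI; first exact: (near_norm_lt (differentiable_continuous (du Ux)) x1).
  exact: (near_norm_lt (differentiable_continuous (dv Ux)) x2).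
- (* Bootstrap: the derivatives of psi are smooth functions of psi. *)
  elim=> [|k IH] /=.
    by move=> z Oz; apply: differentiable_continuous; apply: (dpsi z Oz).1.
  split=> [z Oz|w]; first exact: (dpsi z Oz).1.
  have psiU z : O z -> U (psi z) by move=> /psiF[].
  apply: (Ck_ext (f := (fun z => w.1 *: X (psi z)) \+ (fun z => (w.2 / mu (psi z)) *: Y (psi z)))) => //.
    by move=> z; rewrite inE => Oz; rewrite Dpsi.
  have Cmu := Ck_comp (frame_rV 2) oO oU psiU IH (smu k).
  apply: Ck_add => //; apply: Ck_scale => //; try exact: Ck_cst.
  + exact: Ck_comp (frame_rV 2) oO oU psiU IH (sX k).
  + apply: Ck_mul => //; first exact: Ck_cst.
    by apply: Ck_inv => // z /psiU /mu0.
  + exact: Ck_comp (frame_rV 2) oO oU psiU IH (sY k).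
Qed.

End FrameCoordinates.

(** * Derivatives along vector fields *)

Section DerivativeAlongField.
Context {R : realType}.
Local Notation e2 := (@basis2 R).

Lemma derive_e2 (W : normedModType R) (g : 'rV[R]_2 -> W) x (Z : 'rV[R]_2) :
  differentiable g x -> 'D_Z g x = \sum_i Z 0 i *: 'D_(e2 i) g x.
Proof. exact: derive_frame (frame_rV 2). Qed.

Lemma Ck_deriv_field (W : normedModType R) (U : set 'rV[R]_2) (g : 'rV[R]_2 -> W) X k :
  open U -> Ck k.+1 U g -> Ck k U X -> Ck k U (fun x => 'D_(X x) g x).
Proof.
move=> oU [dg Dg] CX; apply: (Ck_ext (f := fun x => \sum_i X x 0 i *: 'D_(e2 i) g x)) => //.
  by move=> x; rewrite inE => Ux; rewrite [RHS]derive_e2 //; apply: dg.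
by apply: Ck_sum => // i; exact: (Ck_scale oU (Ck_coord i oU CX) (Dg _)).
Qed.

(** The product rule for dg(X). The correction term lies in the image of dg, so second derivatives
    along fields and along constant vectors agree up to tangent vectors. *)
Lemma derive_deriv_field (W : normedModType R) (U : set 'rV[R]_2) (g : 'rV[R]_2 -> W) X x Z :
  open U -> U x -> Ck 2 U g -> Ck 1 U X ->
  'D_Z (fun y => 'D_(X y) g y) x = 'D_Z ('D_(X x) g) x + 'D_('D_Z X x) g x.
Proof.
move=> oU Ux Cg CX; have [dg Dg] := Cg; have [dX DX] := CX.
pose h i (y : 'rV[R]_2) := X y 0 i *: 'D_(e2 i) g y.
have dXi i : differentiable (fun y => X y 0 i) x by apply: differentiable_rcoord; apply: dX.
have dDg i : differentiable ('D_(e2 i) g) x by apply: (Dg _).1.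
have hE i := bilin_diff (b := @GRing.scale R W) (@scale_continuous2 R W) (dXi i) (dDg i).
have dh i : derivable (h i) x Z by apply/diff_derivable/(hE i).1.
have -> : 'D_Z (fun y => 'D_(X y) g y) x = 'D_Z (\sum_i h i) x.
  apply: near_eq_derive; apply: near_eq_open oU Ux _ => y; rewrite inE => Uy.
  by rewrite fct_sumE derive_e2 //; apply: dg.
have -> : 'D_Z ('D_(X x) g) x = 'D_Z (\sum_i (fun y => X x 0 i *: 'D_(e2 i) g y)) x.
  apply: near_eq_derive; apply: near_eq_open oU Ux _ => y; rewrite inE => Uy.
  by rewrite fct_sumE derive_e2 //; apply: dg.
rewrite !derive_sum //; last by move=> i; apply/diff_derivable/differentiableZ.
rewrite (derive_e2 _ (dg x Ux)) -big_split /=; apply: eq_bigr => i _.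
rewrite (hE i).2 /= (derive_coord Z i (dX x Ux)).
by rewrite (deriveZ _ (diff_derivable (dDg i))).
Qed.

Lemma derive_dotp (V : normedModType R) N (f h : V -> 'rV[R]_N) x v :
  differentiable f x -> differentiable h x ->
  'D_v (fun y => dotp (f y) (h y)) x = dotp (f x) ('D_v h x) + dotp ('D_v f x) (h x).
Proof.
by move=> df dh; have [_ ->] := bilin_diff (b := @dotp R N) (@dotp_continuous2 R N) df dh.
Qed.

Lemma derive_near_cst (V W : normedModType R) (U : set V) (f : V -> W) c x v :
  open U -> U x -> (forall y, U y -> f y = c) -> 'D_v f x = 0.
Proof.
move=> oU Ux fc; rewrite -(derive_cst c x v); apply: near_eq_derive.
by apply: near_eq_open oU Ux _ => y; rewrite inE; apply: fc.
Qed.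

Lemma orthonormal_coord N (t b : 'rV[R]_N) (p q : R) :
  dotp t t = 1 -> dotp b b = 1 -> dotp t b = 0 ->
  dotp t (p *: t + q *: b) = p /\ dotp b (p *: t + q *: b) = q.
Proof.
move=> tt bb tb; rewrite !dotpDr !dotpZr tt bb tb dotpC tb.
by rewrite !mulr1 !mulr0 addr0 add0r.
Qed.

Lemma derive_subc (V W : normedModType R) (f : V -> W) c x v : differentiable f x ->
  'D_v (fun y => f y - c) x = 'D_v f x.
Proof.
move=> df; rewrite (deriveB (g := cst c) (diff_derivable df) (derivable_cst _ _ _)).
by rewrite derive_cst subr0.
Qed.

Lemma derive_lin2 (V W : normedModType R) (f : V -> W) x a b v v' : differentiable f x ->
  'D_(a *: v + b *: v') f x = a *: 'D_v f x + b *: 'D_v' f x.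
Proof. by move=> df; rewrite deriveDv // !deriveZv. Qed.

(** Only the term in <q, s> survives, with the symmetric coefficient b d. *)
Lemma dotp_sym2 N (p q t s : 'rV[R]_N) a b c d :
  dotp p t = 0 -> dotp p s = 0 -> dotp q t = 0 ->
  dotp (a *: p + b *: q) (c *: t + d *: s) = dotp (c *: p + d *: q) (a *: t + b *: s).
Proof.
move=> pt ps qt; rewrite !dotpDl !dotpDr !dotpZl !dotpZr pt ps qt; ring.
Qed.

End DerivativeAlongField.

(** * Coordinates adapted to the net *)

Section SurfaceCoordinates.
Context {R : realType}.
Local Notation e2 := (@basis2 R).
Variables (N : nat) (U : set 'rV[R]_2) (g : 'rV[R]_2 -> 'rV[R]_N).
Variables (X Y : 'rV[R]_2 -> 'rV[R]_2) (x0 : 'rV[R]_2).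
Hypotheses (oU : open U) (Ux0 : U x0) (sg : smooth_on U g).
Hypotheses (sX : smooth_on U X) (sY : smooth_on U Y).
Variables T B : 'rV[R]_2 -> 'rV[R]_N.
Hypotheses (defT : forall x, T x = 'D_(X x) g x) (defB : forall x, B x = 'D_(Y x) g x).
Hypothesis TT : forall x, U x -> dotp (T x) (T x) = 1.
Hypothesis BB : forall x, U x -> dotp (B x) (B x) = 1.
Hypothesis TB : forall x, U x -> dotp (T x) (B x) = 0.
Hypothesis geoT : forall x Z, U x -> dotp ('D_(X x) T x) ('D_Z g x) = 0.
Hypothesis prinB : forall x, U x -> exists Z, 'D_(X x) ('D_(Y x) g) x = 'D_Z g x.

Let sT : smooth_on U T. Proof. by move=> k; rewrite (funext defT); apply: Ck_deriv_field. Qed.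
Let sB : smooth_on U B. Proof. by move=> k; rewrite (funext defB); apply: Ck_deriv_field. Qed.
Let dg x : U x -> differentiable g x. Proof. by move=> Ux; apply: (sg 1).1. Qed.
Let dT x : U x -> differentiable T x. Proof. by move=> Ux; apply: (sT 1).1. Qed.
Let dB x : U x -> differentiable B x. Proof. by move=> Ux; apply: (sB 1).1. Qed.

Let decomp x Z : U x -> exists a b, Z = a *: X x + b *: Y x /\ 'D_Z g x = a *: T x + b *: B x.
Proof.
move=> Ux; have D a b : 'D_(a *: X x + b *: Y x) g x = a *: T x + b *: B x.
  by rewrite defT defB; apply: derive_lin2 (dg Ux).
have [a b E|a [b ->]] := @span2 R (X x) (Y x) _ Z; last by exists a, b.
have [] := orthonormal_coord a b (TT Ux) (BB Ux) (TB Ux).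
by rewrite -D E derive0 !dotp0r.
Qed.

Let orth (f h : 'rV[R]_2 -> 'rV[R]_N) c x Z : U x -> differentiable f x -> differentiable h x ->
  (forall y, U y -> dotp (f y) (h y) = c) -> dotp (f x) ('D_Z h x) = - dotp ('D_Z f x) (h x).
Proof.
move=> Ux df dh fh; apply/eqP; rewrite -addr_eq0 -derive_dotp //.
by rewrite (derive_near_cst _ oU Ux fh).
Qed.

Let orth_self (f : 'rV[R]_2 -> 'rV[R]_N) c x Z : U x -> differentiable f x ->
  (forall y, U y -> dotp (f y) (f y) = c) -> dotp (f x) ('D_Z f x) = 0.
Proof.
move=> Ux df ff; have /eqP := orth Z Ux df df ff.
by rewrite [X in - X]dotpC -addr_eq0 -mulr2n mulrn_eq0 /= => /eqP.
Qed.

Lemma derive_binormal x : U x -> 'D_(X x) B x = 0.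
Proof.
move=> Ux; have [Z HZ] := prinB Ux.
have E : 'D_(X x) B x = 'D_(Z + 'D_(X x) Y x) g x.
  rewrite (funext defB) (deriveDv _ _ (dg Ux)) -HZ.
  exact: (derive_deriv_field _ oU Ux (sg 2) (sY 1)).
have [a [b [_ ]]] := decomp (Z + 'D_(X x) Y x) Ux; rewrite -E => {}E.
have BD := orth_self (X x) Ux (dB Ux) BB.
(* Differentiating <T, B> = 0 moves the derivative onto [T], whose derivative along X is normal. *)
have TD : dotp (T x) ('D_(X x) B x) = 0.
  rewrite (orth (X x) Ux (dT Ux) (dB Ux) TB).
  by rewrite defB geoT ?oppr0.
have [] := orthonormal_coord a b (TT Ux) (BB Ux) (TB Ux).
by rewrite -E TD BD E => <- <-; rewrite !scale0r addr0.
Qed.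

(** In the frame, D_X T is normal and D_Y T is orthogonal to [T], so the form <dT, dg> has a single
    coefficient left, the one on (Y, Y), and is symmetric. *)
Let sym x Z W : U x -> dotp ('D_Z T x) ('D_W g x) = dotp ('D_W T x) ('D_Z g x).
Proof.
move=> Ux; have [a [b [EZ DZ]]] := decomp Z Ux; have [c [d [EW DW]]] := decomp W Ux.
have TY : dotp ('D_(Y x) T x) (T x) = 0.
  by rewrite dotpC (orth_self (Y x) Ux (dT Ux) TT).
have gT : dotp ('D_(X x) T x) (T x) = 0 by have := geoT (X x) Ux; rewrite -defT.
have gB : dotp ('D_(X x) T x) (B x) = 0 by have := geoT (Y x) Ux; rewrite -defB.
rewrite DZ DW {1}EZ {1}EW !(derive_lin2 _ _ _ _ (dT Ux)).
exact: dotp_sym2 gT gB TY.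
Qed.

(* The 1-form <T, dg>, closed because the curves tangent to X are geodesics. *)
Lemma tangent_form : exists w : 'rV[R]_2 -> 'rV[R]_2, [/\ smooth_on U w,
  forall x Z, U x -> dotp (w x) Z = dotp (T x) ('D_Z g x) &
  forall x, U x -> 'D_(e2 0) w x 0 1 = 'D_(e2 1) w x 0 0].
Proof.
pose h i x := dotp (T x) ('D_(e2 i) g x).
have [w wE] : exists w : 'rV[R]_2 -> 'rV[R]_2, forall i, (fun x => w x 0 i) = h i.
  by exists (fun x => \row_i h i x) => i; apply/funext => x; rewrite mxE.
have sw : smooth_on U w.
  move=> k; apply: Ck_rV => // i; rewrite wE.
  exact: Ck_dotp oU (sT k) ((sg k.+1).2 _).
have wi x i : w x 0 i = dotp (T x) ('D_(e2 i) g x) by have /(congr1 (fun f => f x)) := wE i.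
exists w; split=> // [x Z Ux|x Ux].
  rewrite (derive_e2 _ (dg Ux)) dotpE linear_sumr; apply: eq_bigr => i _.
  by rewrite wi mulrC; apply/esym/dotpZr.
have dw : differentiable w x by apply: (sw 1).1.
have main i j : 'D_(e2 j) w x 0 i =
    dotp (T x) ('D_(e2 j) ('D_(e2 i) g) x) + dotp ('D_(e2 j) T x) ('D_(e2 i) g x).
  rewrite -(derive_coord _ _ dw) wE; apply: derive_dotp; first exact: dT.
  exact: ((sg 2).2 _).1.
(* The second derivatives of [g] agree by symmetry, and the remaining terms by [sym]. *)
apply: etrans (main 1 0) _; apply: etrans _ (esym (main 0 1)).
by rewrite (schwarz (e2 0) (e2 1) (frame_rV 2) oU Ux (sg 2)) (sym (e2 0) (e2 1) Ux).
Qed.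

Lemma surface_coordinates : exists u0 v0 e, 0 < e /\
  exists (psi : R * R -> 'rV[R]_2) (la : R * R -> R) (k : 'rV[R]_2 -> R * R),
  let O := [set z : R * R | `|z.1 - u0| < e /\ `|z.2 - v0| < e] in
  [/\ forall z, O z -> U (psi z) /\ k (psi z) = z,
      psi (u0, v0) = x0,
      open (psi @` O) /\ smooth_on (psi @` O) k,
      smooth_on O psi &
      forall z, O z -> la z != 0 /\
        forall c, 'D_c psi z = c.1 *: X (psi z) + (c.2 * la z) *: Y (psi z)].
Proof.
have [w [sw wE w_closed]] := tangent_form.
have [r r0 [u Hu]] := poincare oU Ux0 (sw 2) w_closed.
(* X v = 0, since B is constant along X and orthogonal to T. *)
pose v x := dotp (g x - g x0) (B x).
pose mu x := 1 + dotp (g x - g x0) ('D_(Y x) B x).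
have sgx : smooth_on U (fun x => g x - g x0).
  by move=> k; apply: (Ck_add oU (sg k) (Ck_cst k U (- g x0))).
have sv : smooth_on U v by move=> k; apply: Ck_dotp oU (sgx k) (sB k).
have smu : smooth_on U mu.
  move=> k; apply: (Ck_add oU (Ck_cst k U (1 : R))).
  by apply: Ck_dotp oU (sgx k) _; apply: Ck_deriv_field oU (sB k.+1) (sY k).
have Dv x Z : U x -> 'D_Z v x = dotp ('D_Z g x) (B x) + dotp (g x - g x0) ('D_Z B x).
  move=> Ux; have dgx : differentiable (fun x => g x - g x0) x by apply: (sgx 1).1.
  by rewrite (derive_dotp Z dgx (dB Ux)) (derive_subc _ _ (dg Ux)) addrC.
pose U' := [set x | `|x - x0| < r] `&` [set x | mu x != 0] `&` U.
have U'U : U' `<=` U by move=> x [].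
have oU' : open U'.
  rewrite openE => x [[/= xr mx] Ux].
  have Hr : \forall y \near x, `|y - x0| < r by apply: (near_norm_lt (f := id) cvg_id xr).
  have Hm : \forall y \near x, `|mu y - mu x| < `|mu x|.
    by apply: near_norm_lt; [exact: (smu 0)|rewrite subrr normr0 normr_gt0].
  have HU : \forall y \near x, U y by apply: open_nbhs_nbhs.
  apply: filterS3 Hr Hm HU => y yr ym Uy; apply: conj Uy; apply: conj yr _ => /=.
  by apply: contraTneq ym => ->; rewrite sub0r normrN ltxx.
(* [poincare] yields a differentiable function; its smoothness comes from that of the form [w]. *)
have su : smooth_on U' u.
  case=> [|k]; first by move=> x [[xr _] _]; apply: differentiable_continuous; have [] := Hu x xr.
  split=> [x [[xr _] _]|Z]; first by have [] := Hu x xr.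
  apply: (Ck_ext (f := fun x => dotp (w x) Z)) => // [x|].
    by rewrite inE => -[[xr _] _]; have [_ _ ->] := Hu x xr.
  apply: Ck_sub U'U _; apply: Ck_dotp oU (sw k) _; exact: Ck_cst.
have U'x0 : U' x0.
  apply: conj Ux0; split=> /=; first by rewrite subrr normr0.
  by rewrite /mu subrr dotp0l addr0 oner_neq0.
have sub (W : normedModType R) (f : 'rV[R]_2 -> W) : smooth_on U f -> smooth_on U' f.
  by move=> sf k; apply: Ck_sub U'U _.
have [|||||e e0 [psi /= [H1 H2 H3 H4 H5]]] := @frame_coordinates R U' X Y u v mu x0 oU' U'x0
  (sub _ _ sX) (sub _ _ sY) su (sub _ _ sv) (sub _ _ smu).
- by move=> x [[_ mx] _].
- by move=> x [[xr _] Ux]; have [_ _ ->] := Hu x xr; rewrite wE // -defT TT.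
- by move=> x [[xr _] Ux]; have [_ _ ->] := Hu x xr; rewrite wE // -defB TB.
- by move=> x [[xr _] Ux]; rewrite Dv // -defT TB // derive_binormal // dotp0r addr0.
- by move=> x [[xr _] Ux]; rewrite Dv // -defB BB.
exists (u x0), (v x0), e; split=> //; exists psi, (fun z => (mu (psi z))^-1), (fun x => (u x, v x)).
have psiO z : `|z.1 - u x0| < e /\ `|z.2 - v x0| < e -> U' (psi z) by move=> /H1[].
split=> //.
- by move=> z Oz; have [Uz -> ->] := H1 z Oz; split; [exact: U'U|case: z Oz Uz].
- split=> // k; apply: (Ck_sub (U := U')); first by move=> _ [z Oz <-]; apply: psiO.
  exact: Ck_pair oU' (su k) (sub _ _ sv k).
- move=> z Oz; split; last by move=> c; rewrite H5.
  by have [[_ mz] _] := psiO z Oz; rewrite invr_neq0.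
Qed.

End SurfaceCoordinates.

(** * The orthogonal projection onto the normal space *)

Section NormalProjection.
Context {R : realType}.

Lemma sub_kermx_tr N n (T : 'M[R]_(n, N)) (w : 'rV[R]_N) :
  (w <= kermx T^T)%MS <-> forall i, dotp w (row i T) = 0.
Proof.
split=> [/sub_kermxP E i|E].
  have := congr1 (fun M : 'rV_n => M 0 i) E; rewrite mxE [RHS]mxE dotpE => E0.
  by rewrite -[RHS]E0; apply: eq_bigr => j _; rewrite !mxE.
apply/sub_kermxP/rowP => i; rewrite !mxE -[RHS](E i) dotpE.
by apply: eq_bigr => j _; rewrite !mxE.
Qed.

(** Positive definiteness: a vector in the row space and orthogonal to it is orthogonal to itself.
    With the rank count of [add_kermx_tr] this makes the decomposition behind [normal_proj] a direct
    sum. *)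
Lemma cap_kermx_tr N n (T : 'M[R]_(n, N)) : (kermx T^T :&: <<T>>)%MS = 0.
Proof.
apply/eqP; rewrite -submx0; apply/row_subP => i; set x := row i _.
have : (x <= kermx T^T :&: <<T>>)%MS by apply: row_sub.
rewrite sub_capmx genmxE => /andP[/sub_kermxP xT /submxP[D xD]].
rewrite submx0; apply/eqP/dotp_eq0.
by rewrite /dotp {2}xD trmx_mul mulmxA xT mul0mx mxE.
Qed.

Lemma add_kermx_tr N n (T : 'M[R]_(n, N)) (w : 'rV[R]_N) : (w <= kermx T^T + <<T>>)%MS.
Proof.
apply: submx_full; rewrite /row_full; apply/eqP.
have := mxrank_sum_cap (kermx T^T) <<T>>%MS; rewrite cap_kermx_tr mxrank0 addn0 => ->.
by rewrite mxrank_ker mxrank_gen mxrank_tr subnK // rank_leq_col.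
Qed.

Variables (V : normedModType R) (n : nat) (e : 'I_n -> V) (N : nat).
Implicit Types (g : V -> 'rV[R]_N).

Lemma normal_proj_id g x (w : 'rV[R]_N) :
  (forall i, dotp w ('D_(e i) g x) = 0) -> w *m normal_proj e g x = w.
Proof.
move=> H; apply: proj_mx_id; first exact: cap_kermx_tr.
by apply/sub_kermx_tr => i; rewrite rowK.
Qed.

Lemma normal_proj_0 g x i a : (a *: 'D_(e i) g x) *m normal_proj e g x = 0.
Proof.
apply: proj_mx_0; first exact: cap_kermx_tr.
by rewrite genmxE scalemx_sub // -[X in (X <= _)%MS](rowK (fun i => 'D_(e i) g x)) row_sub.
Qed.

Lemma normal_proj_normal g x (w : 'rV[R]_N) i : dotp (w *m normal_proj e g x) ('D_(e i) g x) = 0.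
Proof.
have /sub_kermx_tr/(_ i) : (w *m normal_proj e g x <= kermx (tangent_mx e g x)^T)%MS.
  exact: proj_mx_sub.
by rewrite rowK.
Qed.

Lemma normal_proj_tangent g x (w : 'rV[R]_N) :
  w *m normal_proj e g x = 0 -> exists c : 'I_n -> R, w = \sum_i c i *: 'D_(e i) g x.
Proof.
move=> H; have := add_proj_mx (cap_kermx_tr (tangent_mx e g x)) (add_kermx_tr (tangent_mx e g x) w).
rewrite [X in X + _](_ : _ = 0) // add0r => E.
have : (w <= tangent_mx e g x)%MS by rewrite -E -(genmxE (tangent_mx e g x)) proj_mx_sub.
move=> /submxP[D ->]; exists (fun i => D 0 i); rewrite mulmx_sum_row.
by apply: eq_bigr => i _; rewrite rowK.
Qed.

End NormalProjection.

(** * Restriction to coordinate lines *)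

Section Lines.
Context {R : realType}.

Lemma Ck_id (V : normedModType R) k (U : set V) : Ck k U (fun x : V => x).
Proof. exact: (@Ck_clinear R V V k U idfun (fun x => cvg_id)). Qed.

Lemma Ck_line_v k (U : set R) (c : R) : open U -> Ck k U (fun v : R => (c, v)).
Proof. by move=> oU; exact: Ck_pair oU (Ck_cst k U c) (Ck_id k U). Qed.

Lemma Ck_line_u k (U : set R) (c : R) : open U -> Ck k U (fun u : R => (u, c)).
Proof. by move=> oU; exact: Ck_pair oU (Ck_id k U) (Ck_cst k U c). Qed.

Lemma derive_pair (V W Z : normedModType R) (f : V -> W) (g : V -> Z) x v :
  differentiable f x -> differentiable g x ->
  'D_v (fun y => (f y, g y)) x = ('D_v f x, 'D_v g x).
Proof.
by move=> df dg; rewrite deriveE ?diff_pair ?deriveE //; apply: differentiable_pair.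
Qed.

Lemma Ck_subf (V W : normedModType R) k (U : set V) (f g : V -> W) :
  open U -> Ck k U f -> Ck k U g -> Ck k U (fun x => f x - g x).
Proof.
move=> oU Cf Cg; apply: (Ck_ext (f := f \+ (fun x => (-1) *: g x))) => // [x _|].
  by rewrite /= scaleN1r.
exact: (Ck_add oU Cf (Ck_scale oU (Ck_cst k U (-1 : R)) Cg)).
Qed.

Lemma derive_sum_scale (V W : normedModType R) n (a : 'I_n -> V -> R) (f : 'I_n -> V -> W) x v :
  (forall i, differentiable (a i) x) -> (forall i, differentiable (f i) x) ->
  differentiable (fun y => \sum_i a i y *: f i y) x /\
  'D_v (fun y => \sum_i a i y *: f i y) x = \sum_i (a i x *: 'D_v (f i) x + 'D_v (a i) x *: f i x).
Proof.
move=> da df.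
have hE i := bilin_diff (b := @GRing.scale R W) (@scale_continuous2 R W) (da i) (df i).
have -> : (fun y => \sum_i a i y *: f i y) = \sum_i (fun y => a i y *: f i y).
  by apply/funext => y; rewrite fct_sumE.
split; first by apply: differentiable_sum => i; exact: (hE i).1.
rewrite derive_sum => [|i]; last by apply/diff_derivable/(hE i).1.
by apply: eq_bigr => i _; rewrite (hE i).2.
Qed.

Lemma derive_addZ (V W : normedModType R) (f g : V -> W) (a : R) x v :
  differentiable f x -> differentiable g x ->
  'D_v (fun y => f y + a *: g y) x = 'D_v f x + a *: 'D_v g x.
Proof.
move=> df dg; rewrite (deriveD (f := f) (g := fun y => a *: g y) (diff_derivable df)).
  by congr (_ + _); apply: (deriveZ (f := g)); exact: diff_derivable.
exact/diff_derivable/differentiableZ.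
Qed.

Lemma derive_line_v (W : normedModType R) (G : R * R -> W) u v : differentiable G (u, v) ->
  differentiable (fun v => G (u, v)) v /\ 'D_1 (fun v => G (u, v)) v = 'D_(0, 1) G (u, v).
Proof.
move=> dG; have d1 : differentiable (fun v : R => (u, v)) v.
  exact: (Ck_line_v 1 u openT).1.
split; first exact: (@differentiable_comp _ _ _ _ (fun v => (u, v)) G).
rewrite (derive_comp (f := fun v => (u, v)) (g := G)) //.
by rewrite (derive_pair (f := cst u) (g := id)) // derive_cst derive_id.
Qed.

Lemma derive_line_u (W : normedModType R) (G : R * R -> W) u v : differentiable G (u, v) ->
  differentiable (fun u => G (u, v)) u /\ 'D_1 (fun u => G (u, v)) u = 'D_(1, 0) G (u, v).
Proof.
move=> dG; have d1 : differentiable (fun u : R => (u, v)) u.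
  exact: (Ck_line_u 1 v openT).1.
split; first exact: (@differentiable_comp _ _ _ _ (fun u => (u, v)) G).
rewrite (derive_comp (f := fun u => (u, v)) (g := G)) //.
by rewrite (derive_pair (f := id) (g := cst v)) // derive_cst derive_id.
Qed.

End Lines.

(** * Partial tubes *)

Section Tube.
Context {R : realType}.
Local Notation e1 := (@basis1 R).
Variables (N : nat) (u0 v0 e : R) (e0 : 0 < e).
Let I := [set u : R | `|u - u0| < e].
Let J := [set v : R | `|v - v0| < e].
Let O := [set z : R * R | `|z.1 - u0| < e /\ `|z.2 - v0| < e].

Lemma eq_on_absball (f : R -> R) (a r v : R) : `|v - a| < r ->
  (forall t, `|t - a| < r -> differentiable f t /\ 'D_1 f t = 0) -> f v = f a.
Proof.
move=> vr H; have := @mvt_realR R f a v 0 0.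
rewrite mul0r mulr0 subr0 => h; apply/eqP; rewrite -subr_eq0 -normr_le0; apply: h => t tv.
by have [dt ->] := H t (le_lt_trans tv vr); rewrite subr0 normr0.
Qed.

Variables (G t : R * R -> 'rV[R]_N) (la : R * R -> R) (b : R -> 'rV[R]_N).
Hypothesis sG : smooth_on O G.
Hypothesis Gu : forall z, O z -> 'D_(1, 0) G z = t z.
Hypothesis Gv : forall z, O z -> 'D_(0, 1) G z = la z *: b z.2.
Hypothesis t0 : forall z, O z -> t z != 0.
Hypothesis tb : forall z, O z -> dotp (t z) (b z.2) = 0.
Hypothesis la0 : forall z, O z -> la z != 0.
Hypothesis bb : forall v, J v -> dotp (b v) (b v) = 1.

Let oI : open I. Proof. exact: open_absball. Qed.
Let oJ : open J. Proof. exact: open_absball. Qed.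
Let oO : open O. Proof. exact: open_absball2. Qed.
Let Iu0 : I u0. Proof. by rewrite /I /= subrr normr0. Qed.
Let Jv0 : J v0. Proof. by rewrite /J /= subrr normr0. Qed.
Let dG z : O z -> differentiable G z. Proof. by move=> Oz; apply: (sG 1).1. Qed.

Let sGv u k : I u -> Ck k J (fun v => G (u, v)).
Proof.
move=> Iu; apply: (Ck_comp frame_pair oJ oO (f := fun v => (u, v)) (g := G)) => //.
exact: Ck_line_v.
Qed.

Let sGu v k : J v -> Ck k I (fun u => G (u, v)).
Proof.
move=> Jv; apply: (Ck_comp frame_pair oI oO (f := fun u => (u, v)) (g := G)) => //.
exact: Ck_line_u.
Qed.

Let dGv u v : I u -> J v -> differentiable (fun v => G (u, v)) v /\
  'D_1 (fun v => G (u, v)) v = la (u, v) *: b v.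
Proof.
move=> Iu Jv; have Oz : O (u, v) by [].
by have [d ->] := derive_line_v (dG Oz); rewrite Gv.
Qed.

Let dGu u v : I u -> J v -> differentiable (fun u => G (u, v)) u /\
  'D_1 (fun u => G (u, v)) u = t (u, v).
Proof.
move=> Iu Jv; have Oz : O (u, v) by [].
by have [d ->] := derive_line_u (dG Oz); rewrite Gu.
Qed.

Let beta v := G (u0, v).
Let c v := la (u0, v).

Let sbeta : smooth_on J beta. Proof. by move=> k; apply: sGv. Qed.
Let Dbeta v : J v -> 'D_1 beta v = c v *: b v.
Proof. by move=> Jv; have [] := dGv Iu0 Jv. Qed.
Let c0 v : J v -> c v != 0. Proof. by move=> Jv; apply: la0. Qed.

Let P v := normal_proj e1 beta v.

Let P_id v w : J v -> dotp w (b v) = 0 -> w *m P v = w.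
Proof.
by move=> Jv wb; apply: normal_proj_id => i; rewrite Dbeta // dotpZr wb mulr0.
Qed.

Let P_0 v a : J v -> (a *: b v) *m P v = 0.
Proof.
move=> Jv; have := normal_proj_0 e1 beta v 0 (a / c v).
by rewrite Dbeta // scalerA divfK ?c0.
Qed.

(* The parallel normal sections along beta; their inner products are constant. *)
Let S (z : R -> 'rV[R]_N) := smooth_on J z /\ forall v, J v -> dotp (z v) (b v) = 0 /\
  exists a, 'D_1 z v = a *: b v.

Let S_d z v : S z -> J v -> differentiable z v.
Proof. by move=> [sz _] Jv; apply: (sz 1).1. Qed.

(** Both derivatives are multiples of [b], to which both sections are orthogonal. *)
Let S_const z y v : S z -> S y -> J v -> dotp (z v) (y v) = dotp (z v0) (y v0).
Proof.
move=> Sz Sy Jv; apply: (eq_on_absball (f := fun v => dotp (z v) (y v)) Jv) => s Js.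
have [_ /(_ s Js)[zb [a Da]]] := Sz; have [_ /(_ s Js)[yb [a' Da']]] := Sy.
have [d ->] := bilin_diff (b := @dotp R N) (@dotp_continuous2 R N) (S_d Sz Js) (S_d Sy Js).
split=> //; rewrite Da Da'; apply: etrans (_ : a' * dotp (z s) (b s) + a * dotp (b s) (y s) = _).
  by rewrite -dotpZr -dotpZl.
by rewrite zb dotpC yb !mulr0 addr0.
Qed.

Let S_lin z y a : S z -> S y -> S (fun v => z v + a *: y v).
Proof.
move=> Sz Sy; have [sz hz] := Sz; have [sy hy] := Sy; split=> [k|v Jv].
  exact: (Ck_add oJ (sz k) (Ck_scale oJ (Ck_cst k J a) (sy k))).
have [zb [p Dp]] := hz v Jv; have [yb [q Dq]] := hy v Jv.
split; first by rewrite dotpDl dotpZl zb yb mulr0 addr0.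
exists (p + a * q); rewrite scalerDl -scalerA -Dp -Dq.
exact: derive_addZ (S_d Sz Jv) (S_d Sy Jv).
Qed.

Let S_0 : S (cst 0).
Proof.
split=> [k|v Jv]; first exact: Ck_cst.
by split; [exact: dotp0l|exists 0; rewrite derive_cst scale0r].
Qed.

Let S_sum n (F : 'I_n -> R -> 'rV[R]_N) (a : 'I_n -> R) :
  (forall i, S (F i)) -> S (fun v => \sum_i a i *: F i v).
Proof.
move=> SF; elim: n F a SF => [|n IH] F a SF.
  have -> : (fun v => \sum_(i < 0) a i *: F i v) = cst 0 by apply/funext => v; rewrite big_ord0.
  exact: S_0.
have -> : (fun v => \sum_i a i *: F i v) =
    (fun v => \sum_(i < n) a (lift ord0 i) *: F (lift ord0 i) v + a ord0 *: F ord0 v).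
  by apply/funext => v; rewrite big_ord_recl addrC.
exact: (S_lin _ (IH _ _ (fun i => SF _)) (SF _)).
Qed.

(** Asked at [v0] only: [S_const] carries it along [J]. *)
Let orthonormal n (F : 'I_n -> R -> 'rV[R]_N) :=
  (forall i, S (F i)) /\ forall i j, dotp (F i v0) (F j v0) = (i == j)%:R.

(** The matrix of the values at [v0] has its transpose as right inverse. The bound is what makes a
    maximal family exist. *)
Let orthonormal_le n (F : 'I_n -> R -> 'rV[R]_N) : orthonormal F -> (n <= N)%N.
Proof.
move=> [_ FF]; pose M : 'M[R]_(n, N) := \matrix_i F i v0.
have /row_freeP/eqP : exists B, M *m B = 1%:M.
  exists M^T; apply/matrixP => i j; rewrite !mxE -FF dotpE; apply: eq_bigr => k _.
  by rewrite !mxE.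
by move=> rM; rewrite -rM; apply: rank_leq_col.
Qed.

Let dotp_orthonormal_sum n (F : 'I_n -> 'rV[R]_N) (a : 'I_n -> R) j :
  (forall i, dotp (F i) (F j) = (i == j)%:R) -> dotp (\sum_i a i *: F i) (F j) = a j.
Proof.
move=> FF; rewrite dotpC linear_sumr (bigD1 j) //= big1 ?addr0 => [|i ij].
  by rewrite -[LHS]/(dotp _ _) dotpZr FF eqxx mulr1.
by rewrite -[LHS]/(dotp _ _) dotpZr dotpC FF (negbTE ij) mulr0.
Qed.

(* A maximal orthonormal family of parallel sections spans all of them. *)
Lemma maximal_orthonormal : exists s (F : 'I_s -> R -> 'rV[R]_N), orthonormal F /\
  forall z, S z -> forall v, J v -> z v = \sum_i dotp (z v0) (F i v0) *: F i v.
Proof.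
pose p n := `[< exists F : 'I_n -> R -> 'rV[R]_N, orthonormal F >].
have exp : exists n, p n by exists 0%N; apply/asboolP; exists (fun _ _ => 0); split=> -[].
have pN n : p n -> (n <= N)%N by move=> /asboolP[F] /orthonormal_le.
case: (ex_maxnP exp pN) => s /asboolP[F oF] smax; exists s, F; split=> // z Sz v Jv.
have [SF FF] := oF.
pose a i := dotp (z v0) (F i v0).
(* [z] minus its projection onto the family, written in the form of [S_lin]. Were it nonzero at
   [v0], its normalization would enlarge the family. *)
pose y v := z v + (-1) *: \sum_i a i *: F i v.
have Sy : S y by apply: S_lin => //; apply: S_sum.
have yF j : dotp (y v0) (F j v0) = 0.
  by rewrite /y dotpDl dotpZl (@dotp_orthonormal_sum s (fun i => F i v0) a j (FF ^~ j)) mulN1r subrr.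
have y0 : dotp (y v0) (y v0) = 0.
  apply/eqP; apply: contraT => yy.
  have yy0 : 0 < dotp (y v0) (y v0) by rewrite lt_def yy dotp_ge0.
  pose q := (Num.sqrt (dotp (y v0) (y v0)))^-1.
  have qq : q * (q * dotp (y v0) (y v0)) = 1.
    by rewrite mulrA -expr2 exprVn sqr_sqrtr ?ltW // mulVf.
  pose F' (i : 'I_s.+1) := if unlift ord0 i is Some j then F j else fun v => cst 0 v + q *: y v.
  suff oF' : orthonormal F'.
    by have /smax : p s.+1 by [apply/asboolP; exists F']; rewrite ltnn.
  split=> [i|i j]; rewrite /F'.
    by case: unliftP => [k _|_]; [exact: SF|apply: S_lin => //; exact: S_0].
  case: unliftP => [i' ->|->]; case: unliftP => [j' ->|->].
  - by rewrite FF (inj_eq lift_inj).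
  - by rewrite /= add0r dotpZr dotpC yF mulr0.
  - by rewrite /= add0r dotpZl yF mulr0.
  - by rewrite /= add0r dotpZl dotpZr qq.
have : dotp (y v) (y v) = 0 by rewrite (S_const Sy Sy Jv).
by move=> /dotp_eq0/eqP; rewrite /y scaleN1r subr_eq0 => /eqP.
Qed.

Lemma partial_tube_structure : exists s (E : R -> {vspace 'rV[R]_N})
    (phi : R -> 'rV[R]_s -> 'rV[R]_N) (alpha : R -> 'rV[R]_s),
  immersion_on e1 J beta /\
  flat_parallel_subbundle e1 J beta s E /\
  parallel_bundle_isometry J beta E phi /\
  immersion_on e1 I alpha /\
  alpha @` I `<=` Omega J beta phi /\
  forall u v, I u -> J v -> G (u, v) = partial_tube alpha beta phi u v.
Proof.
have [s [F [[SF FF0] Fspan]]] := maximal_orthonormal.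
have FF i j v : J v -> dotp (F i v) (F j v) = (i == j)%:R.
  by move=> Jv; rewrite (S_const (SF i) (SF j) Jv).
pose phi v (y : 'rV[R]_s) := \sum_i y 0 i *: F i v.
pose Fs v : s.-tuple 'rV[R]_N := [tuple F i v | i < s].
pose E v := <<Fs v>>%VS.
pose xi u v := G (u, v) - beta v.
pose alpha u : 'rV[R]_s := \row_i dotp (xi u v0) (F i v0).
have memE v w : w \in E v <-> exists y, w = phi v y.
  split=> [/coord_span ->|[y ->]].
    exists (\row_i coord (Fs v) i w); apply: eq_bigr => i _.
    by rewrite mxE -tnth_nth tnth_mktuple.
  apply: memv_suml => i _; apply/memvZ/memv_span.
  by rewrite -[F i v](tnth_mktuple (fun i => F i v)) mem_tnth.
have phi_b v y : J v -> dotp (phi v y) (b v) = 0.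
  move=> Jv; have [_ /(_ v Jv)[]] := S_sum (y 0) SF; done.
have phi_F v y i : J v -> dotp (phi v y) (F i v) = y 0 i.
  by move=> Jv; apply: (@dotp_orthonormal_sum s (fun i => F i v) (y 0)) => j; apply: FF.
have P_phi v y : J v -> phi v y *m P v = phi v y by move=> Jv; apply: P_id => //; apply: phi_b.
have Sxi u : I u -> S (xi u).
  move=> Iu; split=> [k|v Jv].
    exact: Ck_subf oJ (sGv k Iu) (sbeta k).
  split.
    (* The difference is normal to beta: its product with [b v] vanishes at [u0] and has the
       u-derivative <t, b> = 0. *)
    have xb : (fun u => dotp (xi u v) (b v)) u = (fun u => dotp (xi u v) (b v)) u0.
      apply: (@eq_on_absball (fun u => dotp (xi u v) (b v)) u0 e u Iu) => u' Iu'.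
      have [du Du] := dGu Iu' Jv.
      have dx : differentiable (fun u => xi u v) u'
        by apply: (differentiableB du); exact: differentiable_cst.
      have [d ->] := bilin_diff (b := @dotp R N) (@dotp_continuous2 R N) dx
        (differentiable_cst (b v) u').
      split=> //; rewrite derive_cst.
      have -> : 'D_1 (fun u => xi u v) u' = t (u', v) by rewrite (derive_subc _ _ du) Du.
      by apply: etrans (congr2 +%R (dotp0r _) (tb (z := (u', v)) (conj Iu' Jv))) _; rewrite addr0.
    by rewrite xb /xi subrr dotp0l.
  exists (la (u, v) - c v); rewrite scalerBl -Dbeta //.
  have [dg Dg] := dGv Iu Jv; have [db _] := dGv Iu0 Jv.
  by rewrite -Dg; exact: (deriveB (diff_derivable dg) (diff_derivable db)).
have xiE u v : I u -> J v -> xi u v = phi v (alpha u).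
  move=> Iu Jv; rewrite (Fspan _ (Sxi u Iu) v Jv); apply: eq_bigr => i _.
  by rewrite mxE.
have row_tangent m (g : R -> 'rV[R]_m) v : tangent_mx e1 g v = 'D_1 g v.
  by apply/matrixP => i j; rewrite mxE !ord1.
have row_free_neq0 m (w : 'rV[R]_m) : w != 0 -> row_free w by rewrite /row_free rank_rV => ->.
have Dbeta0 v : J v -> 'D_1 beta v != 0.
  move=> Jv; rewrite Dbeta // scaler_eq0 negb_or c0 //=.
  by apply: contra_eq_neq (bb Jv) => ->; rewrite dotp0l eq_sym oner_neq0.
exists s, E, phi, alpha; split; last split; last split; last split; last split.
- by split=> // v Jv; rewrite row_tangent; apply/row_free_neq0/Dbeta0.
- have sec_mem v (a : 'I_s -> R) : \sum_i a i *: F i v \in E v.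
    apply/memE; exists (\row_i a i); apply: eq_bigr => i _; by rewrite mxE.
  (* In the parallel frame [F] the normal connection just differentiates coordinates, since the
     derivatives of the frame itself are tangent. Both parallelism and flatness of [E] follow. *)
  pose co (z : R -> 'rV[R]_N) i v := dotp (z v) (F i v).
  pose sec z v := \sum_i 'D_1 (co z i) v *: F i v.
  have conn U' z X v : open U' -> U' `<=` J -> is_section U' (fun x => [set w | w \in E x]) z ->
      U' v -> smooth_on U' (sec z) /\ normal_conn e1 beta X z v = X *: sec z v.
    move=> oU' U'J [sz zE] U'v; have Jv := U'J v U'v.
    have sF i k : Ck k U' (F i) by apply: Ck_sub U'J _; have [] := SF i.
    have sco i : smooth_on U' (co z i) by move=> k; exact: Ck_dotp oU' (sz k) (sF i k).
    split=> [k|]; first by apply: Ck_sum => // i; exact: Ck_scale oU' ((sco i k.+1).2 1) (sF i k).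
    rewrite /normal_conn (derive_real X ((sz 1).1 v U'v)) -scalemxAl; congr (_ *: _).
    have -> : 'D_1 z v = 'D_1 (fun v => \sum_i co z i v *: F i v) v.
      apply: near_eq_derive; apply: (near_eq_open oU' U'v) => y; rewrite inE => U'y.
      have /memE[w zw] := zE y U'y; rewrite {1}zw; apply: eq_bigr => i _.
      by rewrite /co zw phi_F //; exact: U'J.
    have [_ ->] := derive_sum_scale (1 : R) (fun i => (sco i 1).1 v U'v) (fun i => (sF i 1).1 v U'v).
    rewrite big_split /= mulmxDl mulmx_suml big1 ?add0r => [|i _].
      have -> : \sum_i 'D_1 (co z i) v *: F i v = phi v (\row_i 'D_1 (co z i) v).
        by apply: eq_bigr => i _; rewrite mxE.
      by rewrite -/(P v) P_phi // /sec; apply: eq_bigr => i _; rewrite mxE.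
    have [_ /(_ v Jv)[_ [a ->]]] := SF i.
    by rewrite scalerA -/(P v) P_0.
  split.
  + move=> v Jv; exists J; split=> //; exists F; split=> [i|y Jy]; first by have [] := SF i.
    suff frF : free (Fs y) by apply/andP; split; [exact: eqxx|exact: frF].
    apply/(@freeP _ _ s (Fs y)) => k Hk i.
    rewrite -(@dotp_orthonormal_sum s (fun i => F i y) k i (fun j => FF j i y Jy)).
    have -> : \sum_j k j *: F j y = \sum_j k j *: (Fs y)`_j.
      by apply: eq_bigr => j _; rewrite -tnth_nth tnth_mktuple.
    by rewrite Hk dotp0l.
  + move=> v Jv w /= /memE[y ->] X.
    rewrite (derive_real X ((sbeta 1).1 v Jv)) Dbeta // !dotpZr phi_b // !mulr0 //.
  + move=> U' z oU' U'J zE v X U'v.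
    have [_ ->] := conn U' z X v oU' U'J zE U'v.
    by apply/memvZ/sec_mem.
  + move=> U' z oU' U'J zE v X Y U'v.
    (* Directions on a line are scalars, so either order of differentiation gives p q times the same
       second derivative. *)
    have main p q : normal_conn e1 beta p (normal_conn e1 beta q z) v =
        q *: (p *: ('D_1 (sec z) v *m P v)).
      have dsec : differentiable (sec z) v.
        by have [ss _] := conn U' z 0 v oU' U'J zE U'v; exact: (ss 1).1.
      rewrite {1}/normal_conn -/(P v) !scalemxAl; congr (_ *m _).
      have -> : 'D_p (normal_conn e1 beta q z) v = 'D_p (fun v => q *: sec z v) v.
        apply: near_eq_derive; apply: (near_eq_open oU' U'v) => y; rewrite inE => U'y.
        by have [_ ->] := conn U' z q y oU' U'J zE U'y.
      rewrite (deriveZ (f := sec z) q (diff_derivable dsec)) (derive_real p dsec) //.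
    by rewrite !main scalerA mulrC -scalerA.
- split.
  + have oJT : open (J `*` [set: 'rV[R]_s]).
      rewrite openE => z [/= Jz _].
      by apply: filterS (near_norm_lt (@fst_continuous R R 'rV[R]_s z) Jz) => y Jy; split.
    move=> k.
    apply: Ck_sum => // i; apply: Ck_scale => //.
      apply: (Ck_comp_clinear (L := @rcoord R s i) oJT); first exact: coord_continuous.
      exact: (Ck_clinear k _ (L := snd) (@snd_continuous R R 'rV[R]_s)).
    apply: (Ck_comp frame_real oJT oJ (f := fst)); first by move=> z [].
      exact: (Ck_clinear k _ (L := fst) (@fst_continuous R R 'rV[R]_s)).
    by have [] := SF i.
  + move=> v Jv a y z; rewrite /phi scaler_sumr -big_split; apply: eq_bigr => i _ /=.
    by rewrite !mxE scalerDl scalerA.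
  + move=> v Jv y z; rewrite {1}/phi dotpC linear_sumr dotpE; apply: eq_bigr => i _.
    by apply: etrans (dotpZr _ _ _) _; rewrite phi_F.
  + move=> v Jv; apply/seteqP; split=> [_ [y _ <-]|w /= /memE[y ->]]; last by exists y.
    by apply/memE; exists y.
  + move=> v y Jv; have [_ /(_ v Jv)[_ [a Da]]] := S_sum (y 0) SF.
    by rewrite /normal_conn Da -/(P v) P_0.
- split=> [k|u Iu].
    apply: Ck_rV => // i; apply: (Ck_ext (f := fun u => dotp (xi u v0) (F i v0))) => //.
      by move=> u _; rewrite mxE.
    exact: Ck_dotp oI (Ck_subf oI (sGu k Jv0) (Ck_cst k I (beta v0))) (Ck_cst k I (F i v0)).
  rewrite row_tangent; apply: row_free_neq0.
  have [du Du] := dGu Iu Jv0.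
  have xiu i : differentiable (fun u => alpha u 0 i) u.
    have -> : (fun u => alpha u 0 i) = (fun u => dotp (xi u v0) (F i v0)).
      by apply/funext => u'; rewrite mxE.
    exact: (Ck_dotp oI (Ck_subf oI (sGu 1 Jv0) (Ck_cst 1 I (beta v0))) (Ck_cst 1 I (F i v0))).1.
  (* If alpha' vanished, so would the u-derivative of G(u, v0) - beta(v0), the combination of the
     F_i with coefficients alpha'; but that derivative is [t]. *)
  apply: contra_neq (t0 (conj Iu Jv0 : O (u, v0))) => Da.
  rewrite -Du -(derive_subc (beta v0) _ du).
  have -> : 'D_1 (fun u => G (u, v0) - beta v0) u = 'D_1 (fun u => \sum_i alpha u 0 i *: F i v0) u.
    apply: near_eq_derive; apply: (near_eq_open oI Iu) => y; rewrite inE => Iy.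
    exact: (xiE y v0 Iy Jv0).
  have [_ ->] := derive_sum_scale (1 : R) xiu (fun i => differentiable_cst (F i v0) u).
  rewrite big1 // => i _; rewrite derive_cst scaler0 add0r.
  by rewrite derive_coord ?Da ?mxE ?scale0r //; apply: differentiable_rV.
- move=> _ [u Iu <-] v Jv /=; rewrite -xiE //.
  have [sx /(_ v Jv)[xb _]] := Sxi u Iu.
  have [dg Dg] := dGv Iu Jv; have [db _] := dGv Iu0 Jv.
  have Dx : 'D_1 (xi u) v = la (u, v) *: b v - c v *: b v.
    by rewrite -Dg -Dbeta //; exact: (deriveB (diff_derivable dg) (diff_derivable db)).
  pose w := 'D_1 ('D_1 beta) v.
  have dDb : differentiable ('D_1 beta) v by apply: ((sbeta 2).2 1).1.
  (* Obtained by differentiating <beta', xi> = 0 along [J]; [w] is beta''. *)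
  have wxi : dotp w (xi u v) = - (c v * (la (u, v) - c v)).
    have bx y : J y -> dotp ('D_1 beta y) (xi u y) = 0.
      by move=> Jy; have [_ /(_ y Jy)[h _]] := Sxi u Iu; rewrite Dbeta // dotpZl dotpC h mulr0.
    have := derive_near_cst (1 : R) oJ Jv bx; rewrite (derive_dotp _ dDb ((sx 1).1 v Jv)).
    rewrite -/w Dx -scalerBl Dbeta // dotpZl dotpZr bb // mulr1 => /eqP.
    by rewrite addrC addr_eq0 => /eqP.
  (* [w] and its normal part differ by a multiple of [b], which is orthogonal to xi. *)
  have Pw : dotp (w *m P v) (xi u v) = dotp w (xi u v).
    have wE : w = (w - dotp w (b v) *: b v) + dotp w (b v) *: b v by rewrite subrK.
    rewrite {1}wE mulmxDl P_0 // addr0 P_id //; last first.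
      by rewrite dotpBl dotpZl bb // mulr1 subrr.
    by rewrite dotpBl dotpZl [dotp (b v) _]dotpC xb mulr0 subr0.
  (* All matrices are 1 by 1: I - A_xi is the number 1 - <beta'', xi> / <beta', beta'>. *)
  rewrite /shape_op.
  have -> : \matrix_(i, j) dotp (second_ff e1 beta v (e1 i) (e1 j)) (xi u v) = (dotp w (xi u v))%:M.
    by apply/matrixP => i j; rewrite !mxE !ord1 eqxx mulr1n -Pw.
  have -> : \matrix_(i, j) metric beta v (e1 i) (e1 j) = (c v * c v)%:M.
    apply/matrixP => i j; rewrite !mxE !ord1 eqxx mulr1n /metric Dbeta //.
    by rewrite dotpZl dotpZr bb // mulr1.
  rewrite invmx_scalar -scalar_mxM -raddfB /= unitmxE det_scalar1 unitfE wxi.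
  have cv := c0 Jv; have lv := la0 (conj Iu Jv : O (u, v)).
  have -> : 1 - - (c v * (la (u, v) - c v)) / (c v * c v) = la (u, v) / c v by field.
  by rewrite mulf_neq0 // invr_neq0.
- by move=> u v Iu Jv; rewrite /partial_tube -xiE // addrC subrK.
Qed.

End Tube.

(** * Charts *)

Section Charts.
Context {R : realType} {M : topologicalType} {n : nat} (A : atlas R M n).
Local Notation cm p := (cmap (chart_at A p)).
Local Notation ci p := (cinv (chart_at A p)).
Local Notation cd p := (cdom (chart_at A p)).

Definition transition_dom p q : set 'rV[R]_n := cm p @` (cd p `&` cd q).

Lemma cimgP p x : cimg A p x -> cd p (ci p x) /\ cm p (ci p x) = x.
Proof. by move=> [q qp <-]; rewrite cmapK. Qed.

Lemma cimg_coord p : cimg A p (Defs.coord A p).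
Proof. by exists p => //; apply: mem_chart_at. Qed.

Lemma cinv_coord p : ci p (Defs.coord A p) = p.
Proof. by rewrite /Defs.coord cmapK //; apply: mem_chart_at. Qed.

Lemma open_cimg p : open (cimg A p). Proof. exact: cimg_open. Qed.

Lemma transition_domP p q x : transition_dom p q x <-> cimg A p x /\ cd q (ci p x).
Proof.
split=> [[m [mp mq] <-]|[[m mp <-]]].
  by rewrite cmapK //; split=> //; exists m.
by rewrite cmapK // => mq; exists m.
Qed.

Lemma open_chart_preimage p (W : set M) : open W ->
  open [set x | cimg A p x /\ W (ci p x)].
Proof.
move=> oW; rewrite openE => x [px Wx]; apply: filterI.
  by apply: open_nbhs_nbhs; split=> //; apply: open_cimg.
by apply: (cinv_cont px); apply: open_nbhs_nbhs.
Qed.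

Lemma open_transition_dom p q : open (transition_dom p q).
Proof.
have -> : transition_dom p q = [set x | cimg A p x /\ cd q (ci p x)].
  by apply/seteqP; split=> x /transition_domP.
by apply/open_chart_preimage/cdom_open.
Qed.

Lemma open_chart_image p (W : set 'rV[R]_n) : open W -> W `<=` cimg A p -> open (ci p @` W).
Proof.
move=> oW Wp.
have -> : ci p @` W = [set q | cd p q /\ W (cm p q)].
  apply/seteqP; split=> [_ [x Wx <-]|q [qp Wq]]; last by exists (cm p q) => //; rewrite cmapK.
  by have [? E] := cimgP (Wp x Wx); rewrite /= E.
rewrite openE => q [qp Wq]; apply: filterI.
  by apply: open_nbhs_nbhs; split=> //; apply: cdom_open.
by apply: (cmap_cont qp); apply: open_nbhs_nbhs.
Qed.

Lemma transition_smooth p q : smooth_on (transition_dom p q) (cm q \o ci p).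
Proof. exact: chart_compat. Qed.

Lemma transition_self p x : cimg A p x -> transition_dom p (ci p x) x.
Proof. by move=> px; apply/transition_domP; split=> //; apply: mem_chart_at. Qed.

Lemma transition_map p q x : transition_dom p q x -> transition_dom q p (cm q (ci p x)).
Proof.
move=> [m [mp mq] <-]; rewrite cmapK //; by exists m.
Qed.

Lemma transitionK p q x : transition_dom p q x -> cm p (ci q (cm q (ci p x))) = x.
Proof. by move=> [m [mp mq] <-]; rewrite !cmapK. Qed.

(** [smooth_into] tests the map in the preferred chart at each image point; near the point one
    passes there from chart [p] by a transition map. *)
Lemma smooth_into_chart (V : normedModType R) (K : set V) (c : V -> 'rV[R]_n) p :
  open K -> smooth_on K c -> (forall t, K t -> cimg A p (c t)) -> smooth_into A K (ci p \o c).
Proof.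
move=> oK sc cp t Kt; set q := (ci p \o c) t.
exists (K `&` (c @^-1` transition_dom p q)).
have oU' : open (K `&` (c @^-1` transition_dom p q)).
  rewrite openE => s [Ks cs]; apply: filterI; first by apply: open_nbhs_nbhs.
  by apply: (sc 0%N s Ks); apply: open_nbhs_nbhs; split=> //; exact: open_transition_dom.
have sU' : K `&` (c @^-1` transition_dom p q) `<=` K by move=> s [].
split=> //; first by split=> //; apply/transition_self/cp.
  by move=> _ [s [Ks /transition_domP[_ ?]] <-].
move=> k; apply: (Ck_comp (frame_rV n) oU' (@open_transition_dom p q) (f := c) (g := cm q \o ci p)).
- by move=> s [].
- exact: Ck_sub sU' (sc k).
- exact: transition_smooth.
Qed.

(** Tangent vectors are written in the preferred chart of their base point, so [mdiff] of the
    inverse chart is the change of coordinates applied to the velocity in chart [p]. *)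
Lemma mdiff_chart (V : normedModType R) (c : V -> 'rV[R]_n) p t w :
  differentiable c t -> cimg A p (c t) ->
  mdiff A (ci p \o c) t w = mdiff A (ci p) (c t) ('D_w c t).
Proof.
move=> dc ct; rewrite /mdiff.
apply: (derive_comp (f := c) (g := cm (ci p (c t)) \o ci p)) => //.
exact: (transition_smooth _ _ 1).1 (transition_self ct).
Qed.

Lemma mdiff_linear p x a Z W : cimg A p x ->
  mdiff A (ci p) x (a *: Z + W) = a *: mdiff A (ci p) x Z + mdiff A (ci p) x W.
Proof.
by move=> px; apply: derive_linear; exact: (transition_smooth _ _ 1).1 (transition_self px).
Qed.

(** A preimage is supplied by the derivative of the reverse transition map. *)
Lemma mdiff_surj p x W : cimg A p x -> exists Z, W = mdiff A (ci p) x Z.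
Proof.
move=> px; have Tx := transition_self px; set q := ci p x in Tx *.
pose tau := cm q \o ci p; pose sig := cm p \o ci q.
have dtau : differentiable tau x by exact: (transition_smooth _ _ 1).1 Tx.
have Tq := transition_map Tx.
have dsig : differentiable sig (tau x) by exact: (transition_smooth _ _ 1).1 Tq.
have sx : sig (tau x) = x by exact: transitionK Tx.
have E : 'D_('D_W sig (tau x)) tau (sig (tau x)) = W.
  rewrite -(derive_comp (f := sig) (g := tau)) ?sx //.
  rewrite -[RHS](derive_id (tau x) W); apply: near_eq_derive.
  apply: (near_eq_open (@open_transition_dom q p) Tq) => y; rewrite inE => Ty.
  exact: transitionK.
by exists ('D_W sig (tau x)); rewrite sx in E.
Qed.

Variables (N : nat) (f : M -> 'rV[R]_N).
Local Notation g p := (local_expr A f p).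

Lemma local_expr_transition p q x : transition_dom p q x ->
  g p x = g q (cm q (ci p x)).
Proof. by move=> [m [mp mq] <-]; rewrite /local_expr /= !cmapK. Qed.

Hypothesis sf : forall p, smooth_on (cimg A p) (g p).

Lemma derive_local_expr p q x Z : transition_dom p q x ->
  'D_Z (g p) x = 'D_('D_Z (cm q \o ci p) x) (g q) (cm q (ci p x)).
Proof.
move=> Tx; have [qy _] := (transition_domP _ _ _).1 (transition_map Tx).
rewrite -(derive_comp (f := cm q \o ci p) (g := g q)).
- apply: near_eq_derive; apply: (near_eq_open (@open_transition_dom p q) Tx) => y.
  by rewrite inE; exact: local_expr_transition.
- exact: (transition_smooth _ _ 1).1 Tx.
- exact: (sf q 1).1 qy.
Qed.

End Charts.

(** * The immersion seen in different charts: second fundamental form and geodesics *)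

Section SurfaceCharts.
Context {R : realType} {M : topologicalType} (A : atlas R M 2).
Local Notation cm p := (cmap (chart_at A p)).
Local Notation ci p := (cinv (chart_at A p)).
Local Notation cd p := (cdom (chart_at A p)).
Local Notation e2 := (@basis2 R).
Variables (N : nat) (f : M -> 'rV[R]_N).
Local Notation g p := (local_expr A f p).
Hypothesis immf : surface_immersion A f.

Let sf p : smooth_on (cimg A p) (g p). Proof. by have [] := immf p. Qed.

(* Up to tangent vectors, second derivatives do not depend on the chart. *)
Lemma derive2_local_expr p q x Z W : transition_dom A p q x ->
  exists V, 'D_Z ('D_W (g p)) x =
    'D_('D_Z (cm q \o ci p) x) ('D_('D_W (cm q \o ci p) x) (g q)) (cm q (ci p x)) +
    'D_V (g q) (cm q (ci p x)).
Proof.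
move=> Tx; have Tq := transition_map Tx; have oT := @open_transition_dom _ _ _ A.
pose tau := cm q \o ci p; pose sig := cm p \o ci q; set y := cm q (ci p x).
have stau : smooth_on (transition_dom A p q) tau := transition_smooth A p q.
have ssig : smooth_on (transition_dom A q p) sig := transition_smooth A q p.
have Tq_sub : transition_dom A q p `<=` cimg A q by move=> z /transition_domP[].
(* The constant field [W] of chart [p], transported to chart [q], is no longer constant; its
   derivative accounts for the tangent correction. *)
pose Y z := 'D_W tau (sig z).
have CY k : Ck k (transition_dom A q p) Y.
  apply: (Ck_comp (frame_rV 2) (oT q p) (oT p q) (f := sig) (g := 'D_W tau)).
  - by move=> z; exact: transition_map.
  - exact: ssig.
  - exact: (stau k.+1).2.
pose K z := 'D_(Y z) (g q) z.
have Cg k : Ck k (transition_dom A q p) (g q) := Ck_sub Tq_sub (sf q k).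
have CK k : Ck k (transition_dom A q p) K by apply: Ck_deriv_field => //; exact: oT.
exists ('D_('D_Z tau x) Y y).
have Yy : Y y = 'D_W tau x by rewrite /Y /sig /= transitionK.
rewrite -/tau -Yy -(derive_deriv_field _ (oT q p) Tq (Cg 2) (CY 1)) -/K.
rewrite -(derive_comp (f := tau) (g := K)); [|exact: (stau 1).1 Tx|exact: (CK 1).1 Tq].
apply: near_eq_derive; apply: (near_eq_open (oT p q) Tx) => z; rewrite inE => Tz.
by rewrite (derive_local_expr sf W Tz) /K /Y /= /sig /= transitionK.
Qed.

(** If c annihilates the Gram matrix, then c T has length 0. For an immersion this makes the [invmx]
    in [shape_op] a true inverse. *)
Lemma row_free_gram n m (T : 'M[R]_(n, m)) : row_free T -> T *m T^T \in unitmx.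
Proof.
move=> rT; rewrite -row_free_unit -kermx_eq0; apply/eqP/row_matrixP => i; rewrite row0.
have /sub_kermxP := row_sub i (kermx (T *m T^T)); set c := row i _ => cE.
apply: (row_free_inj rT); rewrite mul0mx; apply/dotp_eq0.
by rewrite /dotp trmx_mul mulmxA -[c *m T *m T^T]mulmxA cE mul0mx mxE.
Qed.

Lemma derive_tangent_mx q y Z : cimg A q y -> 'D_Z (g q) y = Z *m tangent_mx e2 (g q) y.
Proof.
move=> qy; rewrite (derive_e2 _ ((sf q 1).1 y qy)) mulmx_sum_row.
by apply: eq_bigr => i _; rewrite rowK.
Qed.

Lemma second_ff_bilinear q y X Y : cimg A q y ->
  second_ff e2 (g q) y X Y = \sum_i \sum_j (X 0 i * Y 0 j) *: second_ff e2 (g q) y (e2 i) (e2 j).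
Proof.
move=> qy; have oq := @open_cimg _ _ _ A q.
have dD W : differentiable ('D_W (g q)) y by exact: ((sf q 2).2 W).1 y qy.
rewrite /second_ff (derive_e2 X (dD Y)) mulmx_suml; apply: eq_bigr => i _.
have -> : 'D_(e2 i) ('D_Y (g q)) y = 'D_(e2 i) (fun z => \sum_j Y 0 j *: 'D_(e2 j) (g q) z) y.
  apply: near_eq_derive; apply: (near_eq_open oq qy) => z; rewrite inE => qz.
  exact: derive_e2 ((sf q 1).1 z qz).
have [_ ->] := derive_sum_scale (e2 i) (fun j => differentiable_cst (Y 0 j) y) (fun j => dD (e2 j)).
rewrite -scalemxAl mulmx_suml scaler_sumr; apply: eq_bigr => j _.
by rewrite derive_cst scale0r addr0 -scalemxAl scalerA.
Qed.

Lemma normal_space_second_ff q y X Y : cimg A q y ->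
  Defs.normal_space (g q) y (second_ff e2 (g q) y X Y).
Proof.
move=> qy Z; rewrite (derive_e2 Z ((sf q 1).1 y qy)).
rewrite dotp_sumr big1 // => i _.
by rewrite dotpZr normal_proj_normal mulr0.
Qed.

Lemma conjugate_net q (X Y : 'rV[R]_2) (L : {vspace 'rV[R]_2}) :
  principal_line A f q L -> X \in L -> metric (g q) (Defs.coord A q) X Y = 0 ->
  exists V, 'D_X ('D_Y (g q)) (Defs.coord A q) = 'D_V (g q) (Defs.coord A q).
Proof.
move=> [_ prin] XL XY; set y := Defs.coord A q in prin XY *.
have qy : cimg A q y := cimg_coord A q.
have [_ /(_ y qy) rfT] := immf q.
(* Apply the shape operator of [xi] = second_ff X Y itself: <xi, xi> = lam <X, Y> = 0. *)
have [xi xiE] : exists xi, xi = second_ff e2 (g q) y X Y by exists (second_ff e2 (g q) y X Y).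
have nxi : Defs.normal_space (g q) y xi by rewrite xiE; apply: normal_space_second_ff.
have [lam /(_ X XL) E] := prin xi nxi.
pose T := tangent_mx e2 (g q) y.
pose Sm := \matrix_(i < 2, j < 2) dotp (second_ff e2 (g q) y (e2 i) (e2 j)) xi.
have GE : \matrix_(i < 2, j < 2) metric (g q) y (e2 i) (e2 j) = T *m T^T.
  by apply/matrixP => i j; rewrite !mxE /metric dotpE; apply: eq_bigr => k _; rewrite !mxE.
have XS : X *m Sm = lam *: (X *m (T *m T^T)).
  move: E; rewrite /shape_op GE -/Sm => /(congr1 (mulmx ^~ (T *m T^T))).
  by rewrite (mulmxA X Sm) mulmxKV ?row_free_gram // -scalemxAl.
have xx : dotp xi xi = 0.
  have -> : dotp xi xi = (X *m Sm *m Y^T) 0 0.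
    rewrite {1}xiE second_ff_bilinear // dotpC dotp_sumr mxE.
    under [RHS]eq_bigr => j _ do rewrite mxE [Y^T _ _]mxE mulr_suml.
    rewrite exchange_big /=; apply: eq_bigr => i _.
    rewrite dotp_sumr; apply: eq_bigr => j _.
    by rewrite dotpZr [Sm i j]mxE [dotp xi _]dotpC mulrAC.
  rewrite XS -scalemxAl mxE -(mulmxA X) -(mulmxA T) -trmx_mul mulmxA.
  move: XY; rewrite /metric !derive_tangent_mx // -/T /dotp => ->.
  by rewrite mulr0.
have := dotp_eq0 xx; rewrite xiE /second_ff => /normal_proj_tangent[c Ec].
exists (\row_i c i); rewrite Ec (derive_e2 _ ((sf q 1).1 y qy)).
by apply: eq_bigr => i _; rewrite mxE.
Qed.

(** The geodesic equation in a chart says that the acceleration of the image curve has no tangential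
    part: the Christoffel symbols of the induced metric are the products <D_v D_v g, D_Z g>. *)
Lemma acceleration q (V : set R) (c : R -> 'rV[R]_2) (t : R) Z :
  open V -> V t -> smooth_on V c -> (forall s, V s -> cimg A q (c s)) ->
  metric (g q) (c t) (derive1 (derive1 c) t) Z +
    christoffel1 (g q) (c t) (derive1 c t) (derive1 c t) Z =
  dotp ('D_1 ('D_1 (g q \o c)) t) ('D_Z (g q) (c t)).
Proof.
move=> oV Vt sc cq; have qt := cq t Vt; have oq := @open_cimg _ _ _ A q.
have dD W y : cimg A q y -> differentiable ('D_W (g q)) y by move=> qy; exact: ((sf q 2).2 W).1 y qy.
have dgq y : cimg A q y -> differentiable (g q) y by move=> qy; exact: (sf q 1).1 y qy.
have -> : derive1 c = 'D_1 c by apply/funext => s; rewrite derive1E.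
rewrite derive1E.
have dc s : V s -> differentiable c s by exact: (sc 1).1.
have dDc : differentiable ('D_1 c) t by exact: ((sc 2).2 1).1.
set v := 'D_1 c t.
have acc : 'D_1 ('D_1 (g q \o c)) t = 'D_('D_1 ('D_1 c) t) (g q) (c t) + 'D_v ('D_v (g q)) (c t).
  have -> : 'D_1 ('D_1 (g q \o c)) t = 'D_1 (fun s => \sum_i 'D_1 c s 0 i *: ('D_(e2 i) (g q) \o c) s) t.
    apply: near_eq_derive; apply: (near_eq_open oV Vt) => s; rewrite inE => Vs.
    rewrite (derive_comp _ (dc s Vs) (dgq _ (cq s Vs))) (derive_e2 _ (dgq _ (cq s Vs))) //.
  have dDi i : differentiable (fun s => 'D_1 c s 0 i) t by exact: differentiable_rcoord.
  have dgi i : differentiable ('D_(e2 i) (g q) \o c) t.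
    by apply: differentiable_comp; [exact: dc|exact: dD].
  have [_ ->] := derive_sum_scale (1 : R) dDi dgi.
  rewrite big_split /= addrC; congr (_ + _).
    rewrite (derive_e2 _ (dgq _ qt)); apply: eq_bigr => i _.
    by rewrite (derive_coord (1 : R) i dDc).
  have -> : 'D_v ('D_v (g q)) (c t) = 'D_v (fun y => \sum_i v 0 i *: 'D_(e2 i) (g q) y) (c t).
    apply: near_eq_derive; apply: (near_eq_open oq qt) => y; rewrite inE => qy.
    exact: derive_e2 (dgq _ qy).
  have [_ ->] := derive_sum_scale v
    (fun i => differentiable_cst (v 0 i) (c t)) (fun i => dD (e2 i) _ qt).
  apply: eq_bigr => i _; rewrite derive_cst scale0r addr0.
  by rewrite (derive_comp _ (dc t Vt) (dD (e2 i) _ qt)).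
rewrite acc dotpDl; congr (_ + _); rewrite /christoffel1.
have Dm W P Q : 'D_W (fun y => metric (g q) y P Q) (c t) =
    dotp ('D_P (g q) (c t)) ('D_W ('D_Q (g q)) (c t)) +
    dotp ('D_W ('D_P (g q)) (c t)) ('D_Q (g q) (c t)).
  exact: derive_dotp (dD _ _ qt) (dD _ _ qt).
rewrite (Dm v v Z) (Dm Z v v) (schwarz Z v (frame_rV 2) oq qt (sf q 2)).
move: ('D_v (g q) (c t)) ('D_v ('D_Z (g q)) (c t)) ('D_v ('D_v (g q)) (c t)) ('D_Z (g q) (c t)).
by move=> p1 p2 p3 p4; rewrite (dotpC p2 p1); field.
Qed.

End SurfaceCharts.

(** * From the hypotheses on the net to identities for its unit fields *)

Section Net.
Context {R : realType} {M : topologicalType} (A : atlas R M 2).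
Local Notation cm p := (cmap (chart_at A p)).
Local Notation ci p := (cinv (chart_at A p)).
Local Notation e2 := (@basis2 R).
Variables (N : nat) (f : M -> 'rV[R]_N).
Local Notation g p := (local_expr A f p).
Hypothesis immf : surface_immersion A f.

Let sf p : smooth_on (cimg A p) (g p). Proof. by have [] := immf p. Qed.

Lemma vline_scale (v : 'rV[R]_2) a : a != 0 -> <[a *: v]>%VS = <[v]>%VS.
Proof.
move=> a0; apply/eqP; rewrite eqEsubv -!memvE memvZ ?memv_line //=.
by rewrite -[v in X in X \in _](scalerK a0) memvZ // memv_line.
Qed.

(** A local spanning field is divided by the length of its image. That length is positive: a zero
    would force the field to vanish, as the immersion is injective on tangent vectors, and the line
    would have dimension 0. *)
Lemma unit_line_field (E : M -> {vspace 'rV[R]_2}) p : smooth_line_field A E ->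
  exists U X, [/\ open U, U (Defs.coord A p), U `<=` cimg A p, smooth_on U X &
    forall x, U x -> dotp ('D_(X x) (g p) x) ('D_(X x) (g p) x) = 1 /\
      E (ci p x) = <[mdiff A (ci p) x (X x)]>%VS].
Proof.
move=> [dimE /(_ p)[U [X0 [oU Ux0 Up sX0 EX0]]]].
pose T0 x := 'D_(X0 x) (g p) x.
have sT0 : smooth_on U T0.
  by move=> k; apply: Ck_deriv_field oU (Ck_sub Up (sf p k.+1)) (sX0 k).
have T0_gt0 x : U x -> 0 < dotp (T0 x) (T0 x).
  move=> Ux; apply: dotp_gt0; apply: contraTneq isT => T00.
  have := dimE (ci p x); rewrite (EX0 x Ux) dim_vline; suff -> : X0 x = 0.
    by rewrite /mdiff derive0 eqxx.
  have [_ /(_ x (Up x Ux)) rT] := immf p; apply: (row_free_inj rT).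
  by rewrite mul0mx -derive_tangent_mx //; exact: Up.
pose a x := (Num.sqrt (dotp (T0 x) (T0 x)))^-1.
have a_neq0 x : U x -> a x != 0 by move=> Ux; rewrite invr_neq0 // gt_eqF // sqrtr_gt0 T0_gt0.
exists U, (fun x => a x *: X0 x); split=> // [k|x Ux].
  have Ca : Ck k U (fun x => Num.sqrt (dotp (T0 x) (T0 x))).
    exact: (Ck_sqrt oU T0_gt0 (Ck_dotp oU (sT0 k) (sT0 k))).
  apply: Ck_scale oU (Ck_inv oU _ Ca) (sX0 k) => x Ux.
  by rewrite gt_eqF // sqrtr_gt0 T0_gt0.
split.
  rewrite (deriveZv _ _ ((sf p 1).1 x (Up x Ux))) -/(T0 x) dotpZl dotpZr mulrA /a.
  by rewrite -invfM -expr2 sqr_sqrtr ?mulVf // ?gt_eqF ?T0_gt0 // ltW // T0_gt0.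
rewrite (EX0 x Ux) -(vline_scale _ (a_neq0 x Ux)); congr (<[_]>%VS).
have := mdiff_linear (a x) (X0 x) 0 (Up x Ux).
by rewrite !addr0 => ->; rewrite /mdiff derive0 addr0.
Qed.

(** In c' = X(c), each order of regularity of [c] yields the next. *)
Lemma integral_curve_smooth n (U : set 'rV[R]_n) (X : 'rV[R]_n -> 'rV[R]_n) (K : set R) c :
  open U -> smooth_on U X -> open K ->
  (forall t, K t -> [/\ U (c t), differentiable c t & 'D_1 c t = X (c t)]) -> smooth_on K c.
Proof.
move=> oU sX oK Hc; elim=> [|k IH].
  by move=> t /Hc[_ dc _]; apply: differentiable_continuous.
split=> [t /Hc[]//|a].
apply: (Ck_ext (f := fun t => a *: X (c t))) => //.
  by move=> t; rewrite inE => /Hc[_ dc <-]; rewrite -derive_real.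
apply: Ck_scale => //; first exact: Ck_cst.
by apply: (Ck_comp (frame_rV n) oK oU) => // t /Hc[].
Qed.

Variables (E0 E1 : M -> {vspace 'rV[R]_2}).
Hypothesis netE : curvature_net A f E0 E1.
Hypothesis geodE0 : geodesic_lines A f E0.

Variables (p : M) (U : set 'rV[R]_2) (X Y : 'rV[R]_2 -> 'rV[R]_2).
Hypotheses (oU : open U) (Up : U `<=` cimg A p) (sX : smooth_on U X) (sY : smooth_on U Y).
Hypothesis TT : forall x, U x -> dotp ('D_(X x) (g p) x) ('D_(X x) (g p) x) = 1.
Hypothesis EX : forall x, U x -> E0 (ci p x) = <[mdiff A (ci p) x (X x)]>%VS.
Hypothesis EY : forall x, U x -> E1 (ci p x) = <[mdiff A (ci p) x (Y x)]>%VS.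

Let Tself x (Ux : U x) := transition_self (Up Ux).

Lemma net_orthogonal x : U x -> dotp ('D_(X x) (g p) x) ('D_(Y x) (g p) x) = 0.
Proof.
move=> Ux; have [_ _ orth _] := netE.
have := orth (ci p x) (mdiff A (ci p) x (X x)) (mdiff A (ci p) x (Y x)).
rewrite (EX Ux) (EY Ux) !memv_line => /(_ isT isT).
by rewrite /metric !(derive_local_expr sf _ (Tself Ux)).
Qed.

(** Conjugacy is known in the preferred chart at the point. Passing to chart [p] adds only a tangent
    vector, and [mdiff_surj] brings the total back to chart [p]. *)
Lemma net_conjugate x : U x -> exists Z, 'D_(X x) ('D_(Y x) (g p)) x = 'D_Z (g p) x.
Proof.
move=> Ux; have [_ _ orth prin] := netE.
set q := ci p x; have Tx : transition_dom A p q x := Tself Ux.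
have XE : mdiff A (ci p) x (X x) \in E0 q by rewrite (EX Ux) memv_line.
have YE : mdiff A (ci p) x (Y x) \in E1 q by rewrite (EY Ux) memv_line.
have [V HV] := conjugate_net immf (prin q).1 XE (orth q _ _ XE YE).
have [V' ->] := derive2_local_expr immf (X x) (Y x) Tx.
have dq : differentiable (g q) (Defs.coord A q) by exact: (sf q 1).1 (cimg_coord A q).
have [Z EZ] := mdiff_surj (V + V') (Up Ux).
have DZ : 'D_Z (g p) x = 'D_(V + V') (g q) (Defs.coord A q).
  by rewrite EZ /mdiff (derive_local_expr sf Z Tx).
by exists Z; rewrite DZ (deriveDv _ _ dq) -HV.
Qed.

(* The geodesic hypothesis concerns curves; an integral curve of X through x makes
   it a statement about X. *)
Lemma net_geodesic x Z : U x ->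
  dotp ('D_(X x) (fun y => 'D_(X y) (g p) y) x) ('D_Z (g p) x) = 0.
Proof.
move=> Ux; have [r [c [r0 c0 Hc]]] := picard oU Ux (sX 1).
pose K := [set t : R | `|t| < r].
have KE : K = [set t : R | `|t - 0| < r] by apply/funext => t; rewrite /K /= subr0.
have oK : open K by rewrite KE; exact: open_absball.
have K0 : K 0 by rewrite /K /= normr0.
have cK t : K t -> U (c t) by move=> /Hc[].
have sc : smooth_on K c by apply: integral_curve_smooth oU sX oK Hc.
have dc t : K t -> differentiable c t by exact: (sc 1).1.
have cp t : K t -> cimg A p (c t) by move=> /cK/Up.
pose C := ci p \o c.
have uC : unit_speed_integral_curve A f E0 K C.
  split; first exact: smooth_into_chart.
  move=> t Kt; rewrite /C mdiff_chart //; [|exact: dc|exact: cp].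
  have [Ut _ ->] := Hc t Kt; rewrite [E0 _](EX Ut) memv_line; split=> //.
  by rewrite /metric -!(derive_local_expr sf _ (Tself Ut)) TT.
have iK : is_interval K by rewrite KE; exact: interval_absball.
have := geodE0 oK iK uC K0; rewrite /geodesic_at.
have C0 : C 0 = ci p x by rewrite /C /= c0.
rewrite C0; set q := ci p x; set gam := cm q \o C => geo.
(* Restricts the curve to times at which it lies in the chart at its initial point, where [gam] is
   smooth. *)
pose V := K `&` (c @^-1` transition_dom A p q).
have oV : open V.
  rewrite openE => s [Ks cs]; apply: filterI; first by apply: open_nbhs_nbhs.
  by apply: (sc 0%N s Ks); apply: open_nbhs_nbhs; split=> //; exact: open_transition_dom.
have V0 : V 0 by split=> //; rewrite /= c0; exact: Tself.
have VK : V `<=` K by move=> s [].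
have sgam : smooth_on V gam.
  move=> k; apply: (Ck_comp (frame_rV 2) oV (@open_transition_dom _ _ _ A p q)
    (f := c) (g := cm q \o ci p)).
  - by move=> s [].
  - exact: Ck_sub VK (sc k).
  - exact: transition_smooth.
have gamq s : V s -> cimg A q (gam s) by move=> [_ /transition_map/transition_domP[]].
have := geo ('D_Z (cm q \o ci p) x); rewrite (acceleration immf _ oV V0 sgam gamq).
have g0 : gam 0 = cm q (ci p x) by rewrite /gam /= C0.
pose T y := 'D_(X y) (g p) y.
have sT k : Ck k U T by apply: Ck_deriv_field oU (Ck_sub Up (sf p k.+1)) (sX k).
(* The image curve in R^N is the same in both charts. Its velocity is [T \o c], so its acceleration
   at 0 is the derivative of [T] along X. *)
have -> : 'D_1 ('D_1 (g q \o gam)) 0 = 'D_(X x) T x; last first.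
  by rewrite g0 -(derive_local_expr sf Z (Tself Ux)).
apply: etrans (_ : 'D_1 (T \o c) 0 = _).
  apply: near_eq_derive; apply: (near_eq_open oV V0) => s; rewrite inE => Vs.
  have Ks := VK s Vs; have [Us _ Ds] := Hc s Ks.
  rewrite /= /T -Ds -(derive_comp _ (dc s Ks) ((sf p 1).1 _ (Up Us))).
  apply: near_eq_derive; apply: (near_eq_open oV Vs) => s'; rewrite inE => -[_ Ts'].
  by rewrite /= (local_expr_transition f Ts').
have dTc : differentiable T (c 0) by rewrite c0; exact: (sT 1).1.
rewrite (derive_comp _ (dc 0 K0) dTc).
by have [_ _ ->] := Hc 0 K0; rewrite c0.
Qed.

End Net.

(** Adapted coordinates in one chart suffice: composition with transition maps gives smoothness in
    all others. Since [la] never vanishes, the second partial derivative spans the whole line E1. *)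
Lemma chart_product_representation (R : realType) (M : topologicalType) (A : atlas R M 2)
    (E0 E1 : M -> {vspace 'rV[R]_2}) (p : M) (U : set 'rV[R]_2) (X Y : 'rV[R]_2 -> 'rV[R]_2)
    (I J : set R) (psi : R * R -> 'rV[R]_2) (la : R * R -> R) (k : 'rV[R]_2 -> R * R) :
  U `<=` cimg A p ->
  (forall x, U x -> E0 (cinv (chart_at A p) x) = <[mdiff A (cinv (chart_at A p)) x (X x)]>%VS) ->
  (forall x, U x -> E1 (cinv (chart_at A p) x) = <[mdiff A (cinv (chart_at A p)) x (Y x)]>%VS) ->
  open (I `*` J) ->
  (forall z, (I `*` J) z -> U (psi z) /\ k (psi z) = z) ->
  open (psi @` (I `*` J)) -> smooth_on (psi @` (I `*` J)) k -> smooth_on (I `*` J) psi ->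
  (forall z, (I `*` J) z -> la z != 0 /\
     forall c, 'D_c psi z = c.1 *: X (psi z) + (c.2 * la z) *: Y (psi z)) ->
  product_representation A E0 E1 I J (cinv (chart_at A p) \o psi).
Proof.
move=> Up EX EY oIJ kpsi oW sk spsi Dpsi.
set O := I `*` J in oIJ kpsi oW sk spsi Dpsi *; set W := psi @` O in oW sk.
have cimgpsi z : O z -> cimg A p (psi z) by move=> /kpsi[/Up].
have Wp : W `<=` cimg A p by move=> _ [z Oz <-]; exact: cimgpsi.
have imW : (cinv (chart_at A p) \o psi) @` O = cinv (chart_at A p) @` W.
  by apply/seteqP; split=> [_ [z Oz <-]|_ [_ [z Oz <-] <-]]; [exists (psi z) => //; exists z|exists z].
have oM : open (cinv (chart_at A p) @` W) by exact: open_chart_image.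
split.
  rewrite /diffeo_onto_open imW; split=> //; first exact: smooth_into_chart.
  exists (k \o cmap (chart_at A p)); split=> [z Oz|q m].
    by have [_ E] := cimgP (cimgpsi z Oz); rewrite /= E; have [] := kpsi z Oz.
  set D := _ @` _.
  have DE : D = [set x | cimg A q x /\ (cinv (chart_at A p) @` W) (cinv (chart_at A q) x)].
    apply/seteqP; split=> [_ [r [qr Wr] <-]|_ [[r qr <-] Wr]].
      by split; [exists r|rewrite cmapK].
    by exists r => //; split=> //; rewrite cmapK in Wr.
  have oD : open D by rewrite DE; exact: open_chart_preimage.
  have DT x : D x -> transition_dom A q p x /\ W ((cmap (chart_at A p) \o cinv (chart_at A q)) x).
    rewrite DE => -[qx [y Wy yx]]; have [py E] := cimgP (Wp y Wy).
    by split; [apply/transition_domP; rewrite -yx|rewrite /= -yx E].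
  apply: (Ck_comp (frame_rV 2) oD oW (f := cmap (chart_at A p) \o cinv (chart_at A q)) (g := k)).
  - by move=> x /DT[].
  - by apply: (Ck_sub (U := transition_dom A q p)); [move=> x /DT[]|exact: transition_smooth].
  - exact: sk.
move=> z Oz; have [Uz _] := kpsi z Oz; have [l0 Dz] := Dpsi z Oz.
have dpsi : differentiable psi z by exact: (spsi 1).1.
have md Z a : mdiff A (cinv (chart_at A p)) (psi z) (a *: Z) =
    a *: mdiff A (cinv (chart_at A p)) (psi z) Z.
  have := mdiff_linear a Z 0 (cimgpsi z Oz).
  by rewrite {3}/mdiff derive0 !addr0.
split; apply/seteqP; split.
- move=> _ [a _ <-]; rewrite /= (mdiff_chart _ dpsi (cimgpsi z Oz)) Dz /= mul0r scale0r addr0 md.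
  by rewrite EX // memvZ // memv_line.
- move=> w; rewrite /= EX // => /vlineP[a ->]; exists a => //.
  by rewrite (mdiff_chart _ dpsi (cimgpsi z Oz)) Dz /= mul0r scale0r addr0 md.
- move=> _ [b _ <-]; rewrite /= (mdiff_chart _ dpsi (cimgpsi z Oz)) Dz /= scale0r add0r md.
  by rewrite EY // memvZ // memv_line.
- move=> w; rewrite /= EY // => /vlineP[a ->]; exists (a / la z) => //.
  by rewrite (mdiff_chart _ dpsi (cimgpsi z Oz)) Dz /= scale0r add0r divfK // md.
Qed.

Theorem corollary19 (R : realType) (M : topologicalType) (A : atlas R M 2)
  (N : nat) (f : M -> 'rV[R]_N) (E0 E1 : M -> {vspace 'rV[R]_2})
  (hausdorffM : hausdorff_space M) (countableM : @second_countable M)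
  (immf : surface_immersion A f)
  (flatf : flat_normal_bundle A f)
  (umbf : umbilic_free A f)
  (netE : curvature_net A f E0 E1)
  (geodE0 : geodesic_lines A f E0) :
  forall p : M,
  exists (I J : set R) (psi : R * R -> M) (s : nat) (beta : R -> 'rV[R]_N)
    (E : R -> {vspace 'rV[R]_N}) (phi : R -> 'rV[R]_s -> 'rV[R]_N)
    (alpha : R -> 'rV[R]_s),
    [/\ open I, is_interval I, open J & is_interval J] /\
    (psi @` (I `*` J)) p /\
    product_representation A E0 E1 I J psi /\
    immersion_on (@basis1 R) J beta /\
    flat_parallel_subbundle (@basis1 R) J beta s E /\
    parallel_bundle_isometry J beta E phi /\
    immersion_on (@basis1 R) I alpha /\
    alpha @` I `<=` Omega J beta phi /\
    (forall u v, I u -> J v -> f (psi (u, v)) = partial_tube alpha beta phi u v).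
Proof.
move=> p; have [lE0 lE1 _ _] := netE.
have [U0 [X [oU0 U0p U0c sX0 HX]]] := unit_line_field immf p lE0.
have [U1 [Y [oU1 U1p U1c sY1 HY]]] := unit_line_field immf p lE1.
pose U := U0 `&` U1; pose g := local_expr A f p.
have oU : open U by exact: openI.
have UU0 : U `<=` U0 by move=> x [].
have UU1 : U `<=` U1 by move=> x [].
have Up : U `<=` cimg A p by move=> x /UU0/U0c.
have sX : smooth_on U X by move=> k; exact: Ck_sub UU0 (sX0 k).
have sY : smooth_on U Y by move=> k; exact: Ck_sub UU1 (sY1 k).
have sg : smooth_on U g by move=> k; exact: Ck_sub Up ((immf p).1 k).
have EX x (Ux : U x) := (HX x (UU0 x Ux)).2.
have EY x (Ux : U x) := (HY x (UU1 x Ux)).2.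
have TT x (Ux : U x) := (HX x (UU0 x Ux)).1.
have BB x (Ux : U x) := (HY x (UU1 x Ux)).1.
have TB := net_orthogonal immf netE Up EX EY.
have prinB := net_conjugate immf netE Up EX EY.
have geoT x Z Ux := net_geodesic immf geodE0 oU Up sX TT EX Z (x := x) Ux.
pose T x := 'D_(X x) g x; pose B x := 'D_(Y x) g x.
have defT x : T x = 'D_(X x) g x by [].
have defB x : B x = 'D_(Y x) g x by [].
have [u0 [v0 [e [e0 [psi [la [k [kpsi psi0 [oW sk] spsi Dpsi]]]]]]]] :=
  surface_coordinates oU (conj U0p U1p : U (Defs.coord A p)) sg sX sY defT defB TT BB TB geoT prinB.
have DB := derive_binormal oU sg sX sY defT defB TT BB TB geoT prinB.
(* From here on only the equations [defT] and [defB] are used. *)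
clearbody T B.
set O := [set z | _] in kpsi oW sk spsi Dpsi.
pose I := [set u : R | `|u - u0| < e]; pose J := [set v : R | `|v - v0| < e].
have oO : open (I `*` J) by exact: open_absball2.
pose G := g \o psi.
have sG : smooth_on O G.
  by move=> n; apply: (Ck_comp (frame_rV 2) oO oU) => // z /kpsi[].
have dpsi z : O z -> differentiable psi z by exact: (spsi 1).1.
have dg x : U x -> differentiable g x by exact: (sg 1).1.
have sB : smooth_on U B.
  by move=> n; rewrite (funext defB); exact: Ck_deriv_field oU (sg n.+1) (sY n).
have DG c z : O z -> 'D_c G z = c.1 *: T (psi z) + (c.2 * la z) *: B (psi z).
  move=> Oz; have [Uz _] := kpsi z Oz.
  rewrite (derive_comp _ (dpsi z Oz) (dg _ Uz)) (Dpsi z Oz).2.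
  by rewrite (derive_lin2 _ _ _ _ (dg _ Uz)) -defT -defB.
(* The identity D_X B = 0 in coordinates; it allows [b] in the tube to be taken along the single
   line u = u0. *)
have Bpsi u v : I u -> J v -> B (psi (u, v)) = B (psi (u0, v)).
  move=> Iu Jv; have := @mvt_real R N (fun u => B (psi (u, v))) u0 u 0 0.
  rewrite mul0r scaler0 subr0 => h; apply/eqP; rewrite -subr_eq0 -normr_le0; apply: h => t tu.
  have Oz : O (t, v) by split=> //; exact: le_lt_trans tu Iu.
  have [Uz _] := kpsi _ Oz; have dB := (sB 1).1 _ Uz.
  have dBpsi : differentiable (B \o psi) (t, v) by exact: differentiable_comp (dpsi _ Oz) dB.
  have [d ->] := derive_line_u dBpsi; split=> //.
  rewrite (derive_comp _ (dpsi _ Oz) dB) (Dpsi _ Oz).2 (derive_lin2 _ _ _ _ dB) (DB _ Uz) /=.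
  by rewrite mul0r scale0r scaler0 addr0 subr0 normr0.
have bb v : J v -> dotp (B (psi (u0, v))) (B (psi (u0, v))) = 1.
  have O0 : J v -> O (u0, v) by move=> Jv; split=> //=; rewrite subrr normr0.
  by move=> /O0/kpsi[Uz _]; rewrite defB; exact: BB.
have [||||||s [E [phi [alpha [Hb [HE [Hphi [Ha [HO HG]]]]]]]]] :=
  @partial_tube_structure R N u0 v0 e e0 G (T \o psi) la (fun v => B (psi (u0, v))) sG.
- by move=> z Oz; rewrite DG //= mul0r scale1r scale0r addr0.
- by move=> [u v] /= Oz; rewrite DG //= scale0r add0r mul1r Bpsi //; case: Oz.
- move=> z /kpsi[Uz _] /=; apply: contra_eq_neq (TT _ Uz) => T0.
  by rewrite -defT T0 dotp0l eq_sym oner_neq0.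
- move=> [u v] Oz; have [Uz _] := kpsi _ Oz; rewrite /= -(Bpsi u v) ?defT ?defB; first exact: TB.
    by case: Oz.
  by case: Oz.
- by move=> z /Dpsi[].
- exact: bb.
exists I, J, (cinv (chart_at A p) \o psi), s, (fun v => G (u0, v)), E, phi, alpha.
split; first by split; (exact: open_absball || exact: interval_absball).
split.
  exists (u0, v0); first by split; rewrite /I /J /= subrr normr0.
  by rewrite /= psi0 cinv_coord.
split; last by [].
exact: (chart_product_representation Up EX EY oO kpsi oW sk spsi Dpsi).
Qed.
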